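(* Let $q$ be a power of an odd prime $p$. Let $k$ be a positive even integer, let $d\ge 2$ be a divisor of $k$ with $p\nmid d$, let $n$ be an integer with $n\equiv k\pmod{2k}$ and $n>k$, and let $a$ be an integer with $\phi(d)+2a=2k$. Write $\Phi_d(x)=\sum_{i=0}^{\phi(d)}c_ix^i$. Then the curve $$\mathcal{X}:\quad y^q-y=x\sum_{j=0}^{\frac{n-k}{2k}-1}\varphi_d(x)^{q^{a+kj}}+x\sum_{i=0}^{\frac{\phi(d)}{2}-1}c_i\,x^{q^{k-a-i}}+\frac{c_{\phi(d)/2}}{2}x^2$$ is minimal over $\mathbb{F}_{q^{2n}}$.
   Context: $\phi$ is Euler's totient function. For $d$ not divisible by the characteristic $p$ of $\mathbb{F}_q$, $\Phi_d(x)=\prod_{1\le s\le d,\ \gcd(s,d)=1}(x-\xi^s)$, with $\xi$ a primitive $d$-th root of unity over $\mathbb{F}_q$, is the $d$-th cyclotomic polynomial over $\mathbb{F}_q$ (its coefficients lie in $\mathbb{F}_p$). With $\Phi_d(x)=\sum_{i=0}^{\phi(d)}c_ix^i$, define $\varphi_d(x)=\sum_{i=0}^{\phi(d)}c_ix^{q^i}$. A curve given by an affine equation $y^q-y=xS(x)$ means the smooth, projective, geometrically irreducible curve with that function field; it has exactly one point at infinity, which is rational, so its number of rational points over a finite field is one plus the number of affine solutions over that field. A curve of genus $g$ defined over $\mathbb{F}_{q^{N}}$ is called minimal over $\mathbb{F}_{q^{N}}$ if its number of $\mathbb{F}_{q^N}$-rational points equals $q^N+1-2g\sqrt{q^N}$.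 *)

(* Defs.v *)
From mathcomp Require Import all_boot all_order all_algebra all_field.
From mathcomp Require Import boolp classical_sets cardinality.
Set Implicit Arguments.
Unset Strict Implicit.
Unset Printing Implicit Defensive.
Import GRing.Theory Num.Theory.
Local Open Scope classical_set_scope.
Local Open Scope ring_scope.

(* The roots of unity live in an extension L of K, since K need not contain
   them; [cyclotomic xi d] lets s range over 0 <= s < d instead of 1 <= s <= d,
   which gives the same product because xi ^+ d = 1. *)
Definition is_cyclotomic_poly (K : fieldType) (d : nat) (Phi : {poly K}) : Prop :=
  exists (L : fieldType) (iota : {rmorphism K -> L}) (xi : L),
    d.-primitive_root xi /\ map_poly iota Phi = cyclotomic xi d.

Definition qassociate (K : fieldType) (q : nat) (P : {poly K}) : {poly K} :=
  \sum_(i < size P) P`_i *: 'X^(q ^ i).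

(* F is the function field K(x, y) of the curve y^q - y = f(x) over K; F is an
   extension of K by means of iota. *)
Definition AS_function_field (K F : fieldType) (iota : {rmorphism K -> F})
    (q : nat) (f : {poly K}) (x y : F) : Prop :=
  [/\ forall p : {poly K}, (map_poly iota p).[x] = 0 -> p = 0,
      y ^+ q - y = (map_poly iota f).[x]
    & forall z : F, exists u v : {poly {poly K}},
        (map_poly (map_poly iota) v).[x%:P].[y] != 0 /\
        z = (map_poly (map_poly iota) u).[x%:P].[y]
              / (map_poly (map_poly iota) v).[x%:P].[y]].

(* The closed points of the smooth projective curve with function field F / K:
   the valuation rings O of F / K, with K contained in O and O <> F. *)
Record place (K F : fieldType) (iota : {rmorphism K -> F}) := Place {
  local_ring : set F;
  place_const : forall c : K, local_ring (iota c);
  place_sub : forall z w : F, local_ring z -> local_ring w -> local_ring (z - w);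
  place_mul : forall z w : F, local_ring z -> local_ring w -> local_ring (z * w);
  place_total : forall z : F, local_ring z \/ local_ring z^-1;
  place_proper : exists z : F, ~ local_ring z }.

(* Repartitions (or adeles) of F / K: families of functions that are regular at
   all but finitely many points. *)
Definition repartition (K F : fieldType) (iota : {rmorphism K -> F})
    (r : place iota -> F) : Prop :=
  finite_set [set P : place iota | ~ local_ring P (r P)].

(* g = dim_K H^1(X, O_X), where H^1(X, O_X) = R / (R(0) + F) with R the space of
   repartitions, R(0) the subspace of the everywhere regular ones, and F embedded
   diagonally (Weil, Serre). The dimension is expressed by a basis e of the
   quotient. *)
Definition is_genus (K F : fieldType) (iota : {rmorphism K -> F}) (g : nat) : Prop :=
  exists e : 'I_g -> place iota -> F,
    (forall i, repartition (e i)) /\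
    forall r : place iota -> F, repartition r ->
      exists! c : {ffun 'I_g -> K}, exists z : F,
        forall P : place iota, local_ring P (r P - \sum_(i < g) iota (c i) * e i P - z).

(* The leading 1 is the unique point at infinity, which is rational. *)
Definition AS_points (K : finFieldType) (q : nat) (f : {poly K}) : nat :=
  (1 + #|[pred u : K * K | (u.2 ^+ q - u.2 == f.[u.1])%R]|)%N.

(* The curve y^q - y = f(x), with function field F / K, is minimal over the
   finite field K: its number of rational points is #K + 1 - 2 g sqrt(#K). *)
Definition AS_minimal (K : finFieldType) (F : fieldType)
    (iota : {rmorphism K -> F}) (q : nat) (f : {poly K}) : Prop :=
  exists g : nat, is_genus iota g /\
    (AS_points q f)%:R = #|K|%:R + 1 - 2 * g%:R * sqrtC #|K|%:R :> algC.

(* Main.v *)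
(* Let h = (n - k + phi(d)) / 2, so that deg f = q^h + 1, and let T be the q-power map.

   Points.  N = 1 + q * #{x : Q(x) = 0} for the quadratic form Q(x) = Tr(f(x)) over F_q.
   Its polar form is Tr(x L(y)) where, up to a power of T, L is Phi_d(T) (T^n - 1) /
   (T^k - 1) because Phi_d is palindromic; hence the radical has dimension 2h and lies in
   F_{q^n}.  Every such form is elliptic.  For h > 0 rescale so that 1 is in the radical;
   then Q(x) = Q'(x^q - x) for a form Q' of the same kind with h - 1 in place of h, and the
   numbers of zeros of Q and Q' are related by counting on the hyperplane Tr = 0.  For
   h = 0 the form is Tr(s x^2) with s in F_{q^n}, which a linear substitution turns into
   Tr(2 s i z^{q^n + 1}) with i^2 = -1, and the norm z^{q^n + 1} has fibres of known size.

   Genus.  Adeles are cleared at the places over the affine line by strong approximation: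
   the ring K[x, y] is unramified over K[x] with finite residue fields, so for a suitable
   W the W-th power is the identity modulo the separable polynomial x^{|K|^s} - x, which
   yields uniformizers, idempotents and the fact that everywhere regular functions lie in
   K[x, y].  What remains is F / (O_infinity + K[x, y]), which has as basis the functions
   y^j / x^l whose pole orders are the gaps of the semigroup generated by q and q^h + 1. *)
From HB Require Import structures.
Require Import Defs.
From mathcomp Require Import all_boot all_order all_algebra all_field.
From mathcomp Require Import zify ring.
Set Implicit Arguments.
Unset Strict Implicit.
Unset Printing Implicit Defensive.
Import GRing.Theory Num.Theory.
Local Open Scope ring_scope.

(** * The trace and the Artin-Schreier map of a finite field *)

(** The dimension [2h] of the radical only gives [N = q^(2n) + 1 + e (q-1) q^(n+h)] with a sign [e];
    as [2g = (q-1) q^h], minimality means [e = -1], and the sign is the real difficulty. It is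
    settled by an invariant of the descent on [h]: the coefficients of the form and [q^(2h)]
    elements of its radical lie in F_{q^n}. Rescaling by a radical element taken from F_{q^n} keeps
    this true, so the descent ends at [s x^2] with [s] in F_{q^n}. There the evenness of [k] enters:
    it makes [n] even, so [-1] is a square in F_{q^n}, and the form becomes a multiple of the norm
    from F_{q^(2n)}, whose zeros can be counted by hand. No classification of quadratic forms is
    involved, only counts of zeros. *)

Lemma exprB_pchar (R : comNzRingType) (N : nat) : [pchar R].-nat N ->
  {morph (fun x : R => x ^+ N) : x y / x - y}.
Proof. by move=> hN x y /=; rewrite exprDn_pchar // exprNn_pchar. Qed.

Lemma expr_sum_pchar (R : comNzRingType) (N : nat) (I : Type) (r : seq I)
    (P : pred I) (E : I -> R) : [pchar R].-nat N ->
  (\sum_(i <- r | P i) E i) ^+ N = \sum_(i <- r | P i) E i ^+ N.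
Proof.
move=> hN; apply: (big_morph (fun x => x ^+ N)).
  by move=> x y; rewrite exprDn_pchar.
by case/andP: hN => N0 _; rewrite expr0n -[N]prednK.
Qed.

(** The nonempty fibres of [g] on [A] are the translates of its kernel in [A]. *)
Lemma card_additive_fibres (V W : finZmodType) (g : V -> W) (A : {set V}) :
  zmod_closed A -> {in A &, {morph g : x y / x - y}} ->
  #|A| = (#|[set x in A | g x == 0%R]| * #|g @: A|)%N.
Proof.
move=> [A0 AB] gB.
have g0 : g 0 = 0 by rewrite -[X in g X](subrr 0) gB // subrr.
rewrite -sum1_card (partition_big_imset g) /= mulnC -sum_nat_const.
apply: eq_bigr => _ /imsetP[a aA ->]; rewrite sum1dep_card.
rewrite -[RHS](card_imset _ (addIr a)); apply: eq_card => z.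
rewrite inE; apply/idP/imsetP.
  move=> /andP[zA /eqP gz]; exists (z - a); last by rewrite subrK.
  by rewrite inE AB //= gB // gz subrr.
move=> [w]; rewrite inE => /andP[wA /eqP gw] ->.
have aN : - a \in A by rewrite -sub0r AB.
have -> : w + a = w - (- a) by rewrite opprK.
have gN : g (- a) = - g a by rewrite -[in LHS]sub0r gB // g0 sub0r.
by rewrite AB //= gB // gw gN opprK add0r.
Qed.

Lemma card_root_set (K : finFieldType) (g : {poly K}) :
  g != 0 -> (#|[set x | root g x]| < size g)%N.
Proof.
move=> g0; rewrite cardE; apply: max_poly_roots => //; last exact: enum_uniq.
by apply/allP => x; rewrite mem_enum inE.
Qed.

Section Trace.

Variables (K : finFieldType) (q N : nat).
Hypotheses (q_pchar : [pchar K].-nat q) (q_gt1 : (1 < q)%N) (N_gt0 : (0 < N)%N).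
Hypothesis cardK : #|K| = (q ^ N)%N.

Lemma q_pchar_exp i : [pchar K].-nat (q ^ i)%N.
Proof. by rewrite pnatX q_pchar. Qed.

Lemma frobB i : {morph (fun x : K => x ^+ (q ^ i)) : x y / x - y}.
Proof. exact: exprB_pchar (q_pchar_exp i). Qed.

Lemma frobD i : {morph (fun x : K => x ^+ (q ^ i)) : x y / x + y}.
Proof. by move=> x y; rewrite exprDn_pchar // q_pchar_exp. Qed.

Lemma frob_add i j (x : K) : x ^+ (q ^ (i + j)) = (x ^+ (q ^ i)) ^+ (q ^ j).
Proof. by rewrite expnD exprM. Qed.

Lemma frob_card (x : K) : x ^+ (q ^ N) = x.
Proof. by rewrite -cardK expf_card. Qed.

Definition trace (x : K) : K := \sum_(i < N) x ^+ (q ^ i).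

Lemma traceB : {morph trace : x y / x - y}.
Proof. by move=> x y; rewrite /trace -sumrB; apply: eq_bigr => i _; exact: frobB. Qed.

Lemma trace0 : trace 0 = 0.
Proof. by rewrite -[X in trace X](subrr 0) traceB subrr. Qed.

Lemma traceN x : trace (- x) = - trace x.
Proof. by rewrite -sub0r traceB trace0 sub0r. Qed.

Lemma traceD : {morph trace : x y / x + y}.
Proof. by move=> x y; rewrite -{1}[y]opprK traceB traceN opprK. Qed.

Lemma trace_frob1 x : trace (x ^+ q) = trace x.
Proof.
rewrite /trace -(prednK N_gt0) big_ord_recr [RHS]big_ord_recl /= addrC expn0 expr1.
rewrite -exprM -expnS (prednK N_gt0) frob_card; congr (_ + _).
by apply: eq_bigr => i _; rewrite -exprM -expnS.
Qed.

Lemma trace_frob i x : trace (x ^+ (q ^ i)) = trace x.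
Proof.
elim: i => [|i IH]; first by rewrite expn0 expr1.
by rewrite expnSr exprM trace_frob1.
Qed.

Lemma trace_fixed x : trace x ^+ q = trace x.
Proof.
rewrite -[in RHS]trace_frob1 /trace expr_sum_pchar //.
by apply: eq_bigr => i _; rewrite -!exprM mulnC.
Qed.

Definition base_field : {set K} := [set c | c ^+ q == c].

Lemma frob_base i c : c \in base_field -> c ^+ (q ^ i) = c.
Proof.
rewrite inE => /eqP cq; elim: i => [|i IH]; first by rewrite expn0 expr1.
by rewrite expnSr exprM IH.
Qed.

Lemma traceZ c x : c \in base_field -> trace (c * x) = c * trace x.
Proof.
move=> cF; rewrite /trace mulr_sumr; apply: eq_bigr => i _.
by rewrite exprMn frob_base.
Qed.

Lemma trace_base x : trace x \in base_field.
Proof. by rewrite inE trace_fixed. Qed.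

Definition artin (x : K) : K := x ^+ q - x.

Lemma artinB : {morph artin : x y / x - y}.
Proof. by move=> x y; rewrite /artin exprB_pchar // !opprD !opprK addrACA. Qed.

Lemma trace_artin x : trace (artin x) = 0.
Proof. by rewrite traceB trace_frob1 subrr. Qed.

Lemma artin_eq0 x : (artin x == 0) = (x \in base_field).
Proof. by rewrite inE subr_eq0. Qed.

(** This degree bound and the next have product [q ^ N], the size of [K]. As [artin] has kernel
    [base_field] and maps into the kernel of [trace], both bounds must be attained, which gives the
    additive form of Hilbert 90 in [artin_image]. *)
Let card_base_le : (#|base_field| <= q)%N.
Proof.
have sz : size ('X^q - 'X : {poly K}) = q.+1.
  by rewrite size_polyDl size_polyXn // size_polyN size_polyX ltnS.
rewrite -ltnS -sz (leq_ltn_trans _ (card_root_set _)) //.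
  apply: subset_leq_card; apply/subsetP => c; rewrite !inE => /eqP cq.
  by rewrite rootE !hornerE /= cq subrr.
by rewrite -size_poly_eq0 sz.
Qed.

Let card_trace_ker_le : (#|[set x | trace x == 0%R]| <= q ^ N.-1)%N.
Proof.
pose g : {poly K} := \sum_(i < N) 'X^(q ^ i).
have sz : size g = (q ^ N.-1).+1.
  rewrite /g -(prednK N_gt0) big_ord_recr /= addrC size_polyDl size_polyXn //.
  rewrite ltnS (leq_trans (size_sum _ _ _)) //.
  apply/bigmax_leqP => i _; rewrite size_polyXn.
  by rewrite ltn_exp2l.
rewrite -ltnS -sz (leq_ltn_trans _ (card_root_set _)) //.
  apply: subset_leq_card; apply/subsetP => c; rewrite !inE /trace => /eqP cq.
  rewrite rootE /g horner_sum -[X in _ == X]cq; apply/eqP.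
  by apply: eq_bigr => i _; rewrite hornerXn.
by rewrite -size_poly_eq0 sz.
Qed.

Let artin_sub : artin @: [set: K] \subset [set x | trace x == 0].
Proof. by apply/subsetP => _ /imsetP[x _ ->]; rewrite inE trace_artin. Qed.

Let card_artin : (q ^ N = #|base_field| * #|artin @: [set: K]|)%N.
Proof.
rewrite -cardK -cardsT (card_additive_fibres (g := artin)) //.
- by congr (_ * _)%N; apply: eq_card => x; rewrite !inE /= subr_eq0.
- by split=> [|u v]; rewrite !inE.
- by move=> u v _ _; exact: artinB.
Qed.

Let q_N : (q ^ N = q * q ^ N.-1)%N.
Proof. by rewrite -expnS prednK. Qed.

Lemma card_base_field : #|base_field| = q.
Proof.
apply/eqP; rewrite eqn_leq card_base_le /=.
rewrite -(leq_pmul2r (m := q ^ N.-1)) ?expn_gt0 ?(ltnW q_gt1) //.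
rewrite -q_N card_artin leq_mul2l; apply/orP; right.
exact: leq_trans (subset_leq_card artin_sub) card_trace_ker_le.
Qed.

Lemma card_artin_image : #|artin @: [set: K]| = (q ^ N.-1)%N.
Proof.
have := card_artin; rewrite card_base_field q_N => /eqP.
by rewrite eqn_pmul2l ?(ltnW q_gt1) // => /eqP.
Qed.

Lemma artin_image : artin @: [set: K] = [set x | trace x == 0].
Proof. by apply/eqP; rewrite eqEcard artin_sub card_artin_image. Qed.

Lemma card_trace_ker : #|[set x | trace x == 0]| = (q ^ N.-1)%N.
Proof. by rewrite -artin_image card_artin_image. Qed.

Lemma trace_neq0 : exists x, trace x != 0.
Proof.
apply/existsP; rewrite -negb_forall; apply/negP => /forallP T0.
have := card_trace_ker; rewrite (_ : [set _ | _] = [set: K]).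
  rewrite cardsT cardK q_N => /eqP; rewrite -[X in _ == X]mul1n eqn_pmul2r.
    by rewrite gtn_eqF.
  by rewrite expn_gt0 (ltnW q_gt1).
by apply/setP => x; rewrite !inE T0.
Qed.

Lemma trace_nondegenerate c : (forall x, trace (x * c) = 0) -> c = 0.
Proof.
move=> T0; apply/eqP/negPn/negP => c0; case: trace_neq0 => x /eqP[].
by rewrite -(T0 (x / c)) divfK.
Qed.

Lemma artin_preimage x : trace x = 0 -> exists y, artin y = x.
Proof.
move=> T0; have: x \in artin @: [set: K] by rewrite artin_image inE T0.
by case/imsetP => y _ ->; exists y.
Qed.

(** Over each [z] of trace 0 the fibre of [artin] is a translate of [base_field], over any other [z]
    it is empty. This serves twice: for the points above a given [x], and for the descent from
    [h.+1] to [h]. *)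
Lemma card_artin_fibre (D : {set K}) :
  #|[set x | artin x \in D]| = (q * #|[set z in D | trace z == 0%R]|)%N.
Proof.
rewrite -card_base_field mulnC -sum_nat_const -sum1dep_card.
rewrite (partition_big artin (mem [set z in D | trace z == 0])) /=; last first.
  by move=> x xD; rewrite inE xD trace_artin eqxx.
apply: eq_bigr => z; rewrite inE => /andP[zD /eqP /artin_preimage[y yz]].
rewrite sum1dep_card -[RHS](card_imset _ (addrI y)); apply: eq_card => x.
rewrite inE; apply/idP/imsetP => [/andP[_ /eqP xz]|[c cF ->]].
  exists (x - y); last by rewrite addrC subrK.
  by rewrite -artin_eq0 artinB xz yz subrr.
rewrite -[c]opprK artinB yz; have -> : artin (- c) = 0; last by rewrite subr0 zD eqxx.
apply/eqP; rewrite -sub0r artinB subr_eq0 eq_sym; move: cF; rewrite -artin_eq0.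
by move/eqP->; rewrite /artin expr0n gtn_eqF ?subr0 // ltnW.
Qed.

End Trace.

(** * Trace forms *)

Section TraceForm.

Variables (K : finFieldType) (q n : nat).
Hypotheses (q_pchar : [pchar K].-nat q) (q_gt1 : (1 < q)%N) (n_gt0 : (0 < n)%N).
Hypothesis cardK : #|K| = (q ^ (2 * n))%N.
Hypothesis q_odd : odd q.

Let N_gt0 : (0 < 2 * n)%N. Proof. by rewrite muln_gt0. Qed.

Local Notation tr := (trace q (2 * n)).
Local Notation art := (artin q).
Local Notation Fq := (base_field K q).

Let trD := traceD (2 * n) q_pchar.
Let trB := traceB (2 * n) q_pchar.
Let trN := traceN (2 * n) q_pchar.
Let tr0 := trace0 (2 * n) q_pchar.
Let tr_frob1 := trace_frob1 N_gt0 cardK.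
Let tr_frob := trace_frob N_gt0 cardK.

Lemma natr2_neq0 : 2%:R != 0 :> K.
Proof.
apply/negP => /eqP K2; have ch2 : 2%N \in [pchar K] by rewrite inE /= K2 eqxx.
move: q_pchar; rewrite (eq_pnat _ (pcharf_eq ch2)) => /p_natP[[|i] qE].
  by move: q_gt1; rewrite qE.
by move: q_odd; rewrite qE oddX.
Qed.

Local Notation half_field := (base_field K (q ^ n)).

Lemma half_fieldP x : reflect (x ^+ (q ^ n) = x) (x \in half_field).
Proof. by rewrite inE; exact: eqP. Qed.

Lemma half_fieldB : {in half_field &, forall x y, x - y \in half_field}.
Proof.
move=> x y /half_fieldP hx /half_fieldP hy; apply/half_fieldP.
by rewrite (frobB q_pchar) hx hy.
Qed.

Lemma half_fieldN : {in half_field, forall x, - x \in half_field}.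
Proof.
move=> x hx; rewrite -sub0r half_fieldB //; apply/half_fieldP.
by rewrite expr0n gtn_eqF // expn_gt0 ltnW.
Qed.

Lemma half_fieldD : {in half_field &, forall x y, x + y \in half_field}.
Proof. by move=> x y hx hy; rewrite -[y]opprK half_fieldB // half_fieldN. Qed.

Lemma half_fieldM : {in half_field &, forall x y, x * y \in half_field}.
Proof.
move=> x y /half_fieldP hx /half_fieldP hy; apply/half_fieldP.
by rewrite exprMn hx hy.
Qed.

Lemma half_fieldV : {in half_field, forall x, x^-1 \in half_field}.
Proof. by move=> x /half_fieldP hx; apply/half_fieldP; rewrite exprVn hx. Qed.

Lemma half_fieldX i : {in half_field, forall x, x ^+ i \in half_field}.
Proof. by move=> x /half_fieldP hx; apply/half_fieldP; rewrite exprAC hx. Qed.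

Lemma half_field_nat i : i%:R \in half_field.
Proof.
apply/half_fieldP; elim: i => [|i IH]; first by rewrite expr0n gtn_eqF // expn_gt0 ltnW.
by rewrite -natr1 (frobD q_pchar) IH expr1n.
Qed.

Definition qform (h : nat) (s : nat -> K) (x : K) : K :=
  tr (\sum_(i < h.+1) s i * x * x ^+ (q ^ i)).

Definition polar (h : nat) (s : nat -> K) (x y : K) : K :=
  tr (\sum_(i < h.+1) s i * (x * y ^+ (q ^ i) + y * x ^+ (q ^ i))).

Definition rad (h : nat) (s : nat -> K) : {set K} :=
  [set w | [forall x, polar h s x w == 0]].

Lemma qformD h s x y : qform h s (x + y) = qform h s x + qform h s y + polar h s x y.
Proof.
rewrite /qform /polar -!trD -!big_split /=; congr (tr _); apply: eq_bigr => i _.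
by rewrite (frobD q_pchar); ring.
Qed.

Lemma polarC h s x y : polar h s x y = polar h s y x.
Proof. by congr (tr _); apply: eq_bigr => i _; rewrite addrC. Qed.

Lemma polarBl h s y : {morph (polar h s)^~ y : x z / x - z}.
Proof.
move=> x z; rewrite /polar -!trB -!sumrB /=; congr (tr _); apply: eq_bigr => i _.
by rewrite (frobB q_pchar); ring.
Qed.

Lemma polarBr h s x : {morph polar h s x : y z / y - z}.
Proof. by move=> y z; rewrite !(polarC h s x) polarBl. Qed.

Lemma polarZl h s c x y : c \in Fq -> polar h s (c * x) y = c * polar h s x y.
Proof.
move=> cF; rewrite /polar -traceZ // mulr_sumr; congr (tr _); apply: eq_bigr => i _.
by rewrite exprMn (frob_base _ cF); ring.
Qed.

Lemma qformZ h s c x : c \in Fq -> qform h s (c * x) = c ^+ 2 * qform h s x.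
Proof.
move=> cF; rewrite /qform expr2 -mulrA -!traceZ // !mulr_sumr; congr (tr _).
by apply: eq_bigr => i _; rewrite exprMn (frob_base _ cF); ring.
Qed.

Lemma polarxx h s x : polar h s x x = qform h s x *+ 2.
Proof.
rewrite /polar /qform mulr2n -trD -big_split /=; congr (tr _).
by apply: eq_bigr => i _; ring.
Qed.

Lemma rad_qform h s w : w \in rad h s -> qform h s w = 0.
Proof.
rewrite inE => /forallP/(_ w)/eqP; rewrite polarxx -mulr_natr => /eqP.
by rewrite mulf_eq0 (negPf natr2_neq0) orbF => /eqP.
Qed.

Lemma rad_sub h s : zmod_closed (rad h s).
Proof.
split=> [|u v].
  by rewrite inE; apply/forallP => x; rewrite -[X in polar _ _ _ X](subrr 0) polarBr subrr.
rewrite !inE => /forallP hu /forallP hv; apply/forallP => x.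
by rewrite polarBr (eqP (hu x)) (eqP (hv x)) subrr.
Qed.

(** The power [q ^ (2 * n - i)] moves the Frobenius from [x] to [s i * w] under the trace. As the
    trace pairing is nondegenerate, [w] is in the radical exactly when the second factor
    vanishes. *)
Lemma polar_trace h s x w : (h <= 2 * n)%N ->
  polar h s x w =
  tr (x * \sum_(i < h.+1) (s i * w ^+ (q ^ i) + (s i * w) ^+ (q ^ (2 * n - i)))).
Proof.
move=> hn; rewrite mulr_sumr /polar.
pose tr_sum := big_morph tr trD tr0.
rewrite !tr_sum; apply: eq_bigr => i _.
rewrite !mulrDr !trD; congr (_ + _); first by rewrite mulrCA.
rewrite mulrA -[LHS](tr_frob (2 * n - i)) exprMn -frob_add subnKC; last first.
  by rewrite (leq_trans _ hn) // -ltnS.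
by rewrite (frob_card cardK) mulrC.
Qed.

(** The [q ^ h]-th power of the second factor in [polar_trace] is a polynomial in [w] of degree
    [q ^ (2 * h)]. For [h > n] the bound exceeds the size of [K]. *)
Lemma card_rad h s : s h != 0 -> (#|rad h s| <= q ^ (2 * h))%N.
Proof.
move=> sh0; case: (leqP h n) => [hn|nh]; last first.
  rewrite (leq_trans (max_card _)) // cardK leq_exp2l // leq_pmul2l //.
  exact: ltnW.
pose g : {poly K} := \sum_(i < h.+1) ((s i ^+ (q ^ h)) *: 'X^(q ^ (i + h))
                                  + (s i ^+ (q ^ (h - i))) *: 'X^(q ^ (h - i))).
have szg : (size g <= (q ^ (2 * h)).+1)%N.
  rewrite (leq_trans (size_sum _ _ _)) //; apply/bigmax_leqP => i _.
  have ih : (i <= h)%N by rewrite -ltnS.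
  rewrite (leq_trans (size_polyD _ _)) // geq_max.
  by rewrite !(leq_trans (size_scale_leq _ _)) ?size_polyXn // ltnS leq_exp2l //; lia.
have gh : g`_(q ^ (2 * h)) != 0.
  rewrite coef_sum big_ord_recr /= big1 ?add0r; last first.
    move=> i _; have ih := ltn_ord i; rewrite coefD !coefZ !coefXn !eqn_exp2l //.
    by rewrite !gtn_eqF ?mulr0 ?addr0 //; lia.
  rewrite coefD !coefZ !coefXn !eqn_exp2l // subnn addnn mul2n eqxx mulr1.
  (* For [h = 0] the two monomials of the last term coincide and the coefficient is [2 * s 0];
     otherwise only the first one has top degree. *)
  case: h sh0 {szg g hn} => [|h] sh0 /=; last by rewrite mulr0 addr0 expf_neq0.
  by rewrite !expn0 !expr1 mulr1 -mulr2n -mulr_natr mulf_neq0 // natr2_neq0.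
have g0 : g != 0 by apply: contraNneq gh => ->; rewrite coef0.
rewrite -ltnS (leq_trans _ szg) // (leq_ltn_trans _ (card_root_set g0)) //.
apply: subset_leq_card; apply/subsetP => w; rewrite !inE => /forallP hw.
have hn2 : (h <= 2 * n)%N by lia.
have : \sum_(i < h.+1) (s i * w ^+ (q ^ i) + (s i * w) ^+ (q ^ (2 * n - i))) = 0.
  apply: (trace_nondegenerate q_pchar q_gt1 N_gt0 cardK) => x.
  by rewrite -polar_trace // (eqP (hw x)).
move/(congr1 (fun z => z ^+ (q ^ h))); rewrite expr_sum_pchar ?q_pchar_exp //.
rewrite expr0n gtn_eqF ?expn_gt0 ?(ltnW q_gt1) // => E0.
rewrite rootE horner_sum -[X in _ == X]E0; apply/eqP; apply: eq_bigr => i _.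
have ih : (i <= h)%N by rewrite -ltnS.
rewrite hornerD !hornerZ !hornerXn (frobD q_pchar) !exprMn -!frob_add.
congr (_ + _); rewrite (_ : (2 * n - i + h = 2 * n + (h - i))%N); last by lia.
by rewrite !(frob_add _ (2 * n)) !(frob_card cardK).
Qed.

Lemma qform_scale h s w x :
  qform h (fun i => s i * (w * w ^+ (q ^ i))) x = qform h s (w * x).
Proof. by congr (tr _); apply: eq_bigr => i _; rewrite exprMn; ring. Qed.

Lemma polar_scale h s w x y :
  polar h (fun i => s i * (w * w ^+ (q ^ i))) x y = polar h s (w * x) (w * y).
Proof. by congr (tr _); apply: eq_bigr => i _; rewrite !exprMn; ring. Qed.

Let root_half t : t \in half_field -> exists2 r, r \in half_field & r ^+ q = t.
Proof.
move=> ht; exists (t ^+ (q ^ (2 * n).-1)); first exact: half_fieldX.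
by rewrite -exprM -expnSr prednK // (frob_card cardK).
Qed.

Let tr_root (r t x y : K) : r ^+ q = t -> tr (t * x ^+ q * y ^+ q) = tr (r * x * y).
Proof. by move<-; rewrite -[RHS]tr_frob1 !exprMn. Qed.

(** In the expanded product, the terms in which both factors carry a Frobenius are brought back by
    the invariance of the trace, at the price of replacing [t] by its [q]-th root [r]. *)
Let artin_term (r t x : K) j : r ^+ q = t ->
  tr (t * art x * art x ^+ (q ^ j.+1)) =
  tr (r * x * x ^+ (q ^ j.+1)) - tr (r * x * x ^+ (q ^ j))
  - tr (t * x * x ^+ (q ^ j.+2)) + tr (t * x * x ^+ (q ^ j.+1)).
Proof.
move=> rt; rewrite -!(tr_root _ _ rt) -!exprM -!expnSr -!trB -!trD; congr (tr _).
rewrite /artin (frobB q_pchar) -exprM -expnS; ring.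
Qed.

Let artin_term0 (r t x : K) : r ^+ q = t ->
  tr (t * art x * art x) = tr (r * x * x) - tr (t * x * x ^+ q) *+ 2 + tr (t * x * x).
Proof.
move=> rt; rewrite -!(tr_root _ _ rt) mulr2n -!trD -!trB -!trD; congr (tr _).
rewrite /artin; ring.
Qed.

Let tr_sum := big_morph tr trD tr0.

(* As tr is invariant under x |-> x ^+ q, the leading term s * x * x ^+ (q ^ h.+1) is
   - s * art x * art x ^+ (q ^ h) up to terms of lower degree. *)
Lemma qform_artin h s : (forall i, s i \in half_field) ->
  exists t c, [/\ forall i, t i \in half_field, s h.+1 != 0 -> t h != 0
    & forall x, qform h.+1 s x = qform h t (art x) + tr (c * x * x)].
Proof.
elim: h s => [|h IH] s hs.
  (* The square of [art x] produces the cross term [x * x ^+ q] twice, hence the division by 2. *)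
  pose t := - s 1%N / 2%:R.
  have ht : t \in half_field.
    by rewrite half_fieldM ?half_fieldN ?half_fieldV ?half_field_nat.
  have [r hr rt] := root_half ht.
  exists (fun=> t), (s 0%N - r - t); split=> // [s1|x].
    by rewrite mulf_neq0 ?oppr_eq0 ?invr_eq0 // natr2_neq0.
  rewrite /qform !tr_sum !big_ord_recl !big_ord0 /= !addr0 !expn0 !expr1.
  rewrite (artin_term0 _ rt) !mulrBl !trB expn1.
  suff -> : tr (s 1%N * x * x ^+ q) = - (tr (t * x * x ^+ q) *+ 2) by ring.
  rewrite mulr2n -trD -trN; congr (tr _).
  rewrite /t; field; exact: natr2_neq0.
pose t := - s h.+2; have ht : t \in half_field by rewrite half_fieldN.
have [r hr rt] := root_half ht.
(* By [artin_term], subtracting the form with leading coefficient [t] cancels index [h.+2] and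
   changes only the indices [h.+1] and [h]. *)
pose s' i := if i == h.+1 then s i - r - t else if i == h then s i + r else s i.
have [i|t' [c [ht' _ tc]]] := IH s'.
  by rewrite /s'; case: ifP => _; [|case: ifP => _];
    rewrite ?half_fieldB ?half_fieldD ?hs ?half_fieldN.
exists (fun i => if i == h.+1 then t else t' i), c; split=> [i||x].
- by case: ifP.
- by rewrite eqxx oppr_eq0.
have -> : qform h.+1 (fun i => if i == h.+1 then t else t' i) (art x) =
    qform h t' (art x) + tr (t * art x * art x ^+ (q ^ h.+1)).
  rewrite /qform !tr_sum [in LHS]big_ord_recr /= eqxx; congr (_ + _).
  by apply: eq_bigr => i _; rewrite ltn_eqF.
rewrite addrAC -tc (artin_term _ _ rt) /qform !tr_sum.
rewrite 3![in LHS]big_ord_recr 2![in RHS]big_ord_recr /=.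
have -> : \sum_(i < h) tr (s' i * x * x ^+ (q ^ i)) =
          \sum_(i < h) tr (s i * x * x ^+ (q ^ i)).
  by apply: eq_bigr => i _; have ih := ltn_ord i; rewrite /s' !ltn_eqF //; lia.
rewrite /s' eqxx eqxx ltn_eqF // /t !(mulrDl, mulNr, opprK, trD, trN); ring.
Qed.

End TraceForm.

(** * The norm to the subfield of index two, and the zeros of [tr (c * x * x)] *)

Section NormForm.

Variables (K : finFieldType) (q n : nat).
Hypotheses (q_pchar : [pchar K].-nat q) (q_gt1 : (1 < q)%N) (n_gt0 : (0 < n)%N).
Hypothesis cardK : #|K| = (q ^ (2 * n))%N.
Hypotheses (q_odd : odd q) (n_even : ~~ odd n).

Let N_gt0 : (0 < 2 * n)%N. Proof. by rewrite muln_gt0. Qed.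

Local Notation tr := (trace q (2 * n)).
Local Notation Fq := (base_field K q).
Local Notation half_field := (base_field K (q ^ n)).

Let trD := traceD (2 * n) q_pchar.
Let trB := traceB (2 * n) q_pchar.
Let tr0 := trace0 (2 * n) q_pchar.
Let tr_frob := trace_frob N_gt0 cardK.

Let qn_gt0 : (0 < q ^ n)%N. Proof. by rewrite expn_gt0 ltnW. Qed.

Let frob2 (x : K) : (x ^+ (q ^ n)) ^+ (q ^ n) = x.
Proof. by rewrite -frob_add addnn -mul2n (frob_card cardK). Qed.

Lemma card_half_field : #|half_field| = (q ^ n)%N.
Proof.
apply: (@card_base_field K (q ^ n) 2) => //; first exact: q_pchar_exp.
  by rewrite -(exp1n n) ltn_exp2r.
by rewrite -expnM mulnC.
Qed.

Lemma base_sub_half : {subset Fq <= half_field}.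
Proof. by move=> c cF; apply/half_fieldP; rewrite frob_base. Qed.

(** For even [n] the number [q ^ n] is an odd square. *)
Let qn_mod4 : exists i, (q ^ n = 4 * i + 1)%N.
Proof.
have -> : (n = n./2 * 2)%N by rewrite muln2 even_halfK.
rewrite expnM; set r := (q ^ n./2)%N.
have rE : (r = r./2.*2 + 1)%N by rewrite addn1 -[LHS]odd_double_half oddX q_odd orbT.
exists (r./2 * r./2 + r./2)%N; rewrite [in LHS]rE -mulnn -mul2n; lia.
Qed.

Lemma sqrt_opp1 : exists2 mu : K, mu ^+ 2 = -1 & mu \in half_field.
Proof.
(* [e] is a quarter of [#|K| - 1]. For a nonsquare [z] the power [z ^+ (2 * e)] is [-1], so [z ^+ e]
   is the root sought; its order divides 4, hence divides [q ^ n - 1]. *)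
have [i qn] := qn_mod4; pose e := (4 * i * i + 2 * i)%N.
have cK : #|K| = (2 * (2 * e) + 1)%N.
  by rewrite cardK mul2n -addnn expnD qn /e; lia.
have i0 : (0 < i)%N.
  case: i qn {e cK} => // /eqP; rewrite muln0 add0n -[X in _ == X](expn0 q) eqn_exp2l //.
  by rewrite gtn_eqF.
have e0 : (0 < e)%N by rewrite /e; lia.
have [z z0 ze] : exists2 z : K, z != 0 & z ^+ (2 * e) != 1.
  apply/exists_inP; rewrite -negb_forall_in; apply/negP => /forall_inP z1.
  have sz : size ('X^(2 * e) - 1 : {poly K}) = (2 * e).+1.
    by rewrite size_polyDl size_polyXn // size_polyN size_poly1 ltnS muln_gt0.
  have g0 : 'X^(2 * e) - 1 != 0 :> {poly K} by rewrite -size_poly_eq0 sz.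
  have := card_root_set g0; rewrite sz ltnNge.
  have -> // : (2 * e < #|[set x : K | root ('X^(2 * e) - 1) x]|)%N.
  have := cardsC1 (0 : K); rewrite cK.
  have : ([set~ 0] \subset [set x : K | root ('X^(2 * e) - 1) x]).
    apply/subsetP => x; rewrite !inE => /z1 /eqP xe.
    by rewrite rootE !hornerE xe subrr.
  move/subset_leq_card => le1 cc; apply: leq_trans le1; rewrite cc; lia.
have z2 : (z ^+ (2 * e)) ^+ 2 = 1.
  apply: (mulfI z0); rewrite mulr1 -exprM -exprS.
  by rewrite (_ : (2 * e * 2).+1 = #|K|)%N ?expf_card // cK; lia.
have mu2 : (z ^+ e) ^+ 2 = -1.
  rewrite -exprM mulnC; apply/eqP; rewrite -addr_eq0.
  move: z2 => /eqP; rewrite -subr_eq0 subr_sqr_1 mulf_eq0.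
  by rewrite subr_eq0 (negPf ze).
exists (z ^+ e) => //; apply/half_fieldP; rewrite qn addn1 exprS.
by rewrite (_ : 4 * i = 2 * (2 * i))%N ?[in X in _ * X]exprM ?mu2
   ?exprM ?sqrrN ?expr1n ?mulr1 //; lia.
Qed.

Definition half_norm (z : K) : K := z * z ^+ (q ^ n).

Lemma half_norm_in z : half_norm z \in half_field.
Proof. by apply/half_fieldP; rewrite exprMn frob2 mulrC. Qed.

Lemma half_norm_eq0 z : (half_norm z == 0) = (z == 0).
Proof. by rewrite mulf_eq0 expf_eq0 qn_gt0 orbb. Qed.

(** The degree bounds each fibre by [q ^ n + 1]. The [q ^ n - 1] fibres over nonzero elements of the
    subfield cover all [q ^ (2 * n) - 1] nonzero [z], so every bound is attained. *)
Lemma card_half_norm_fibre t : t \in half_field -> t != 0 ->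
  #|[set z | half_norm z == t]| = (q ^ n).+1.
Proof.
have fibre_le u : (#|[set z | half_norm z == u]| <= (q ^ n).+1)%N.
  have sz : size ('X^((q ^ n).+1) - u%:P : {poly K}) = (q ^ n).+2.
    by rewrite size_polyDl size_polyXn // size_polyN (leq_ltn_trans (size_polyC_leq1 _)).
  have g0 : 'X^((q ^ n).+1) - u%:P != 0 :> {poly K} by rewrite -size_poly_eq0 sz.
  rewrite -ltnS -sz (leq_ltn_trans _ (card_root_set g0)) //.
  apply: subset_leq_card; apply/subsetP => z; rewrite !inE rootE !hornerE exprS.
  by rewrite subr_eq0.
pose D := [set t in half_field | t != 0].
have sumD : \sum_(u in D) #|[set z | half_norm z == u]| = \sum_(u in D) (q ^ n).+1.
  rewrite sum_nat_const (_ : #|D| = (q ^ n).-1); last first.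
    rewrite -card_half_field (cardsD1 0 half_field).
    have -> : 0 \in half_field by apply/half_fieldP; rewrite expr0n gtn_eqF.
    by rewrite add1n; apply: eq_card => x; rewrite !inE andbC.
  transitivity #|[set~ 0 : K]|; last first.
    rewrite cardsC1 cardK mul2n -addnn expnD; case: (q ^ n)%N qn_gt0 => // r _.
    by rewrite /=; lia.
  rewrite -[RHS]sum1_card [RHS](partition_big half_norm (mem D)) /=; last first.
    move=> z; rewrite 2!inE => z0.
    by rewrite inE half_norm_eq0 z0 andbT half_norm_in.
  apply: eq_bigr => u; rewrite inE => /andP[_ u0]; rewrite sum1dep_card.
  apply: eq_card => z; rewrite !inE -half_norm_eq0.
  by case: (half_norm z =P u) => [->|_]; rewrite ?andbF // u0.
have := leqif_sum (fun u (_ : u \in D) => leqif_eq (fibre_le u)).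
move/eq_leqif; rewrite sumD eqxx => /esym/forall_inP Hall tF t0.
by apply/eqP/Hall; rewrite inE tF.
Qed.

Lemma card_half_trace_ker kappa : kappa \in half_field -> kappa != 0 ->
  #|[set t in half_field | tr (kappa * t) == 0]| = (q ^ n.-1)%N.
Proof.
move=> kF k0; pose g t := tr (kappa * t).
have gB : {morph g : x y / x - y} by move=> x y; rewrite /g mulrBr trB.
have [x tx] := trace_neq0 q_pchar q_gt1 N_gt0 cardK.
(* [x + x ^+ (q ^ n)] is the relative trace of [x], and its trace is [2 * tr x]; so [g] is nonzero
   on the subfield, hence onto F_q. *)
pose t0 := (x + x ^+ (q ^ n)) / kappa.
have t0F : t0 \in half_field.
  rewrite half_fieldM ?half_fieldV //; apply/half_fieldP.
  by rewrite (frobD q_pchar) frob2 addrC.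
have gt0 : g t0 != 0.
  rewrite /g mulrC divfK // trD tr_frob -mulr2n -mulr_natr mulf_neq0 //.
  exact: natr2_neq0 q_pchar q_gt1 q_odd.
have im : g @: half_field = Fq.
  apply/setP => c; apply/imsetP/idP => [[t _ ->]|cF]; first exact: trace_base.
  exists (c / g t0 * t0).
    rewrite half_fieldM // base_sub_half // inE exprMn exprVn.
    by rewrite (trace_fixed q_pchar N_gt0 cardK) (frob_base 1 cF : c ^+ q = c).
  have cg : c / g t0 \in Fq.
    rewrite inE exprMn exprVn (trace_fixed q_pchar N_gt0 cardK).
    by rewrite (frob_base 1 cF : c ^+ q = c).
  by rewrite /g mulrCA (traceZ _ _ cg) -/(g t0) divfK.
have E : #|half_field| = (#|[set t in half_field | g t == 0%R]| * #|g @: half_field|)%N.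
  apply: card_additive_fibres; last by move=> u v _ _; exact: gB.
  split=> [|u v uF vF]; last exact: half_fieldB.
  by apply/half_fieldP; rewrite expr0n gtn_eqF.
rewrite im (card_base_field q_pchar q_gt1 N_gt0 cardK) card_half_field in E.
by apply/eqP; rewrite -(eqn_pmul2r (ltnW q_gt1)) -expnSr prednK //; apply/eqP/esym.
Qed.

Lemma card_norm_form kappa : kappa \in half_field -> kappa != 0 ->
  #|[set z | tr (kappa * half_norm z) == 0]| = (1 + (q ^ n).+1 * (q ^ n.-1).-1)%N.
Proof.
move=> kF k0; pose D := [set t in half_field | tr (kappa * t) == 0].
rewrite -sum1dep_card (partition_big half_norm (mem D)) /=; last first.
  by move=> z; rewrite inE half_norm_in.
have D0 : 0 \in D.
  by rewrite inE mulr0 tr0 eqxx andbT; apply/half_fieldP; rewrite expr0n gtn_eqF.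
rewrite (bigD1 0) //=; congr addn.
  rewrite sum1dep_card -[RHS](cards1 (0 : K)); apply: eq_card => z; rewrite !inE half_norm_eq0.
  by case: (z =P 0) => [->|]; rewrite ?andbF // /half_norm mul0r mulr0 tr0 eqxx.
have <- : #|D :\ 0| = (q ^ n.-1).-1.
  by rewrite -(card_half_trace_ker kF k0) (cardsD1 0 D) D0.
rewrite [RHS]mulnC -sum_nat_const; apply: eq_big => [t|t /andP[]].
  by rewrite !inE andbC.
rewrite inE => /andP[tF /eqP tk] t0; rewrite -(card_half_norm_fibre tF t0) sum1dep_card.
by apply: eq_card => z; rewrite !inE; case: (half_norm z =P t) => [->|]; rewrite ?andbF // tk eqxx.
Qed.

(* With mu ^+ 2 = -1, the substitution x = z + mu * z ^+ (q ^ n) turns the square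
   into 2 * mu times the norm to the subfield of index two. *)
Lemma card_square_form c : c \in half_field -> c != 0 ->
  (#|[set x | (tr (c * x * x) == 0)%R]| + (q - 1) * q ^ n.-1 = q ^ (2 * n).-1)%N.
Proof.
move=> cF c0; have [mu mu2 muF] := sqrt_opp1.
pose phi z := z + mu * z ^+ (q ^ n).
have mu0 : mu != 0.
  by apply: contra_eq_neq mu2 => ->; rewrite expr0n /= eq_sym oppr_eq0 oner_eq0.
have phiB : {morph phi : x y / x - y}.
  by move=> x y; rewrite /phi (frobB q_pchar); ring.
have phi_inj : injective phi.
  move=> x y /eqP; rewrite -subr_eq0 -phiB => /eqP; set z := x - y => pz.
  apply/eqP; rewrite -subr_eq0 -/z.
  (* Conjugating [z = - mu * z ^+ (q ^ n)] gives [z ^+ (q ^ n) = - mu * z], whence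
     [z = mu ^+ 2 * z = - z]. *)
  have z1 : z = - (mu * z ^+ (q ^ n)) by apply/eqP; rewrite -addr_eq0; apply/eqP.
  have z2 : z ^+ (q ^ n) = - (mu * z).
    rewrite [in LHS]z1 -mulN1r exprMn exprMn frob2 (half_fieldP _ _ _ muF).
    rewrite -signr_odd oddX q_odd orbT expr1.
    by rewrite mulN1r.
  have : z *+ 2 = 0 by rewrite mulr2n {1}z1 z2 mulrN mulrA -expr2 mu2; ring.
  move/eqP; rewrite -mulr_natr mulf_eq0 (negPf (natr2_neq0 q_pchar q_gt1 q_odd)).
  by rewrite orbF.
have phi_tr z : tr (c * phi z * phi z) = tr (c * mu *+ 2 * half_norm z).
  (* As [mu ^+ 2 = -1], the two terms besides the norm are [c * z * z] and minus its conjugate, so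
     their traces cancel. *)
  have -> : c * phi z * phi z = c * mu *+ 2 * half_norm z
      + (c * z * z + c * mu ^+ 2 * z ^+ (q ^ n) * z ^+ (q ^ n)).
    by rewrite /phi /half_norm; ring.
  rewrite trD -[RHS]addr0; congr (_ + _).
  rewrite trD -[tr (c * z * z)](tr_frob n) -trD -[RHS]tr0; congr (tr _).
  rewrite !exprMn (half_fieldP _ _ _ cF) mu2; ring.
rewrite -(card_preimset _ phi_inj).
have -> : phi @^-1: [set x | tr (c * x * x) == 0] =
    [set z | tr (c * mu *+ 2 * half_norm z) == 0].
  by apply/setP => z; rewrite !inE phi_tr.
rewrite card_norm_form.
- have -> : ((2 * n).-1 = n + n.-1)%N by lia.
  rewrite expnD (_ : q ^ n = q * q ^ n.-1)%N; last by rewrite -expnS prednK.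
  have: (0 < q ^ n.-1)%N by rewrite expn_gt0 ltnW.
  case: (q ^ n.-1)%N => // r _; rewrite -(subnK (ltnW q_gt1)) addnK /=.
  by move: (q - 1)%N => b; lia.
- by rewrite -mulr_natr !half_fieldM // half_field_nat.
- by rewrite -mulr_natr !mulf_neq0 //; exact: natr2_neq0 q_pchar q_gt1 q_odd.
Qed.

End NormForm.

(** * Descent on [h]: zeros of a form with large radical in the subfield *)

Section EllipticForm.

Variables (K : finFieldType) (q n : nat).
Hypotheses (q_pchar : [pchar K].-nat q) (q_gt1 : (1 < q)%N) (n_gt0 : (0 < n)%N).
Hypothesis cardK : #|K| = (q ^ (2 * n))%N.
Hypotheses (q_odd : odd q) (n_even : ~~ odd n).

Let N_gt0 : (0 < 2 * n)%N. Proof. by rewrite muln_gt0. Qed.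
Let q_gt0 : (0 < q)%N. Proof. exact: ltnW. Qed.

Local Notation tr := (trace q (2 * n)).
Local Notation art := (artin q).
Local Notation Fq := (base_field K q).
Local Notation half_field := (base_field K (q ^ n)).
Local Notation qf := (qform q n).
Local Notation pol := (polar q n).
Local Notation radical := (rad q n).

Let trD := traceD (2 * n) q_pchar.
Let trB := traceB (2 * n) q_pchar.
Let tr0 := trace0 (2 * n) q_pchar.
Let trZ := @traceZ K q (2 * n).
Let qfD := qformD n q_pchar.
Let polBl := polarBl n q_pchar.
Let polBr := polarBr n q_pchar.

Let baseV c : c \in Fq -> c^-1 \in Fq.
Proof. by rewrite !inE exprVn => /eqP ->. Qed.

Let baseM c e : c \in Fq -> e \in Fq -> c * e \in Fq.
Proof. by rewrite !inE exprMn => /eqP -> /eqP ->. Qed.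

Let tr_base x : tr x \in Fq.
Proof. exact: trace_base. Qed.

Let artB := artinB q_pchar.

Let half_field_zmod : zmod_closed half_field.
Proof.
split=> [|u v]; last exact: half_fieldB.
by apply/half_fieldP; rewrite expr0n gtn_eqF // expn_gt0 q_gt0.
Qed.

Section Step.

Variables (h : nat) (s t : nat -> K).
Hypothesis st : forall x, qf h.+1 s x = qf h t (art x).

Let W := radical h.+1 s :&: half_field.
Let V := art @: W.

Hypothesis card_W : (q ^ (2 * h.+1) <= #|W|)%N.

Let pol_st x y : pol h.+1 s x y = pol h t (art x) (art y).
Proof.
have artD : art (x + y) = art x + art y.
  by rewrite /artin (exprDn_pchar _ _ q_pchar); ring.
apply: (addrI (qf h.+1 s x + qf h.+1 s y)).
by rewrite -qfD !st artD qfD.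
Qed.

Let W_zmod : zmod_closed W.
Proof.
have [r0 rB] := rad_sub n q_pchar h.+1 s; have [f0 fB] := half_field_zmod.
split=> [|u v]; first by rewrite inE r0 f0.
by rewrite !(in_setI _ _ half_field) => /andP[u1 u2] /andP[v1 v2]; rewrite rB ?fB.
Qed.

Let card_V : (q ^ (2 * h).+1 <= #|V|)%N.
Proof.
rewrite -(leq_pmul2l q_gt0) -expnS (_ : (2 * h).+2 = 2 * h.+1)%N; last by lia.
rewrite (leq_trans card_W) // (card_additive_fibres W_zmod (in2W artB)).
rewrite leq_mul2r; apply/orP; right.
rewrite -[X in (_ <= X)%N](card_base_field q_pchar q_gt1 N_gt0 cardK).
apply: subset_leq_card; apply/subsetP => x.
by rewrite !inE subr_eq0 => /andP[].
Qed.

Let V_zmod : zmod_closed V.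
Proof.
have [W0 WB] := W_zmod; split.
  by apply/imsetP; exists 0; rewrite // /artin expr0n gtn_eqF // subrr.
move=> _ _ /imsetP[u uW ->] /imsetP[v vW ->].
by apply/imsetP; exists (u - v); rewrite ?artB // WB.
Qed.

Let V_half : {subset V <= half_field}.
Proof.
move=> y /imsetP[w]; rewrite inE => /andP[_ wF] ->.
by rewrite half_fieldB ?half_fieldX.
Qed.

Let V_singular v : v \in V -> qf h t v = 0.
Proof.
case/imsetP=> w; rewrite inE => /andP[wr _] ->; rewrite -st.
exact: rad_qform wr.
Qed.

Let V_trace v : v \in V -> tr v = 0.
Proof. by case/imsetP => w _ ->; exact: trace_artin. Qed.

Let V_orth z v : v \in V -> tr z = 0 -> pol h t z v = 0.
Proof.
case/imsetP=> w; rewrite !inE => /andP[/forallP wr _] ->.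
case/(artin_preimage q_pchar q_gt1 N_gt0 cardK) => x <-.
by rewrite -pol_st (eqP (wr x)).
Qed.

Let pol_split x0 x v : tr x0 != 0 -> v \in V ->
  pol h t x v = tr x / tr x0 * pol h t x0 v.
Proof.
move=> x00 vV; have cF : tr x / tr x0 \in Fq by rewrite baseM ?baseV.
apply/eqP; rewrite -(polarZl _ _ _ _ _ cF) -subr_eq0 -polBl V_orth //.
by rewrite trB trZ // divfK // subrr.
Qed.

(** By [pol_split], an element of [V] is in the new radical once it is orthogonal to a single [x0]
    of nonzero trace. This is one F_q-linear condition on a set of at least [q ^ (2 * h + 1)]
    elements. *)
Lemma card_rad_descent : (q ^ (2 * h) <= #|radical h t :&: half_field|)%N.
Proof.
have [x0 x00] := trace_neq0 q_pchar q_gt1 N_gt0 cardK.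
rewrite -(leq_pmul2r q_gt0) -expnSr (leq_trans card_V) //.
rewrite (card_additive_fibres (g := pol h t x0) V_zmod); last first.
  by move=> u v _ _; exact: polBr.
rewrite leq_mul //.
  apply: subset_leq_card; apply/subsetP => v; rewrite inE => /andP[vV /eqP v0].
  rewrite inE V_half // andbT inE; apply/forallP => x.
  by rewrite (pol_split x x00 vV) v0 mulr0.
rewrite -[X in (_ <= X)%N](card_base_field q_pchar q_gt1 N_gt0 cardK) subset_leq_card //.
by apply/subsetP => _ /imsetP[v _ ->]; exact: tr_base.
Qed.

Let out := [set x : K | tr x != 0].

(* Some v in V is singular and orthogonal to exactly the hyperplane tr = 0, so off
   that hyperplane qf h t is equidistributed on the lines directed by v. *)
Lemma card_singular_off_hyperplane : t h != 0 ->
  #|out| = (#|[set x in out | qf h t x == 0%R]| * q)%N.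
Proof.
move=> th; have [x0 x00] := trace_neq0 q_pchar q_gt1 N_gt0 cardK.
(* [V] has at least [q ^ (2 * h + 1)] elements, more than [card_rad] allows for the radical. *)
have [v vV vr] : exists2 v, v \in V & v \notin radical h t.
  apply/subsetPn; apply/negP => /subset_leq_card; rewrite leqNgt => /negP[].
  rewrite (leq_ltn_trans (card_rad q_pchar q_gt1 n_gt0 cardK q_odd th)) //.
  by rewrite (leq_trans _ card_V) // ltn_exp2l.
have pol_neq0 x : x \in out -> pol h t x v != 0.
  rewrite inE => xo; rewrite (pol_split x x00 vV) !mulf_neq0 ?invr_eq0 //.
  apply: contraNneq vr => v0; rewrite inE; apply/forallP => y.
  by rewrite (pol_split y x00 vV) v0 mulr0.
have v0 : v != 0.
  apply: contraNneq vr => ->; exact: (rad_sub n q_pchar h t).1.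
have NF c : c \in Fq -> - c \in Fq.
  by rewrite !inE exprNn_pchar // => /eqP ->.
have vD x c : c \in Fq ->
    [/\ tr (x + c * v) = tr x, qf h t (x + c * v) = qf h t x + c * pol h t x v
      & pol h t (x + c * v) v = pol h t x v].
  move=> cF; have pv : pol h t v v = 0 by rewrite polarxx // V_singular // mul0rn.
  split; first by rewrite trD trZ // (V_trace vV) mulr0 addr0.
    rewrite qfD qformZ // (V_singular vV) mulr0 addr0.
    by rewrite polarC polarZl // polarC.
  by rewrite -[c * v]opprK polBl -mulNr polarZl ?NF // pv mulr0 subr0.
(* Along the line directed by [v] the form is affine with slope [pol h t x v], so [psi x] is the
   unique zero on the line of [x]. *)
pose coef x := qf h t x / pol h t x v.
have coefF x : coef x \in Fq by rewrite baseM ?baseV //; exact: tr_base.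
pose psi x := x + - coef x * v.
rewrite -sum1_card (partition_big psi (mem [set x in out | qf h t x == 0])) /=.
  rewrite -sum_nat_const; apply: eq_bigr => y; rewrite inE => /andP[yo /eqP y0].
  rewrite -[RHS](card_base_field q_pchar q_gt1 N_gt0 cardK) sum1dep_card.
  have inj : injective (fun c => y + c * v).
    by move=> c e /addrI/(mulIf v0).
  rewrite -[RHS](card_imset _ inj); apply: eq_card => x; rewrite inE.
  apply/andP/imsetP => [[_ /eqP <-]|[c cF ->]].
    by exists (coef x); rewrite // /psi mulNr subrK.
  have [E1 E2 E3] := vD y c cF; split; first by rewrite inE E1; rewrite inE in yo.
  by rewrite /psi /coef E2 E3 y0 add0r mulfK ?pol_neq0 // mulNr addrK.
move=> x xo; have [E1 E2 _] := vD x (- coef x) (NF _ (coefF x)).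
rewrite inE /psi [_ \in out]inE E1 E2 mulNr divfK ?pol_neq0 // subrr eqxx andbT.
by rewrite inE in xo.
Qed.

End Step.

(** The value is the number of zeros of an elliptic form of rank [2n - 2h] in [2n] variables. Only
    the lower bound on the radical is carried along; with [card_rad] it is in fact an equality. *)
Lemma card_qform h s : (forall i, s i \in half_field) -> s h != 0 ->
  (q ^ (2 * h) <= #|radical h s :&: half_field|)%N ->
  (#|[set x | qf h s x == 0%R]| + (q - 1) * q ^ (n + h).-1 = q ^ (2 * n).-1)%N.
Proof.
elim: h s => [|h IH] s sF sh card_W.
  rewrite addn0 -(card_square_form q_pchar q_gt1 n_gt0 cardK q_odd n_even (sF 0%N) sh).
  congr addn; apply: eq_card => x; rewrite !inE /qform big_ord_recl big_ord0 /=.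
  by rewrite addr0 expn0 expr1.
have [w wW w0] : exists2 w, w \in radical h.+1 s :&: half_field & w != 0.
  have : (1 < #|radical h.+1 s :&: half_field|)%N.
    by rewrite (leq_trans _ card_W) // -{1}(expn0 q) ltn_exp2l.
  case/card_gt1P => u [v [uW vW uv]]; case: (eqVneq u 0) => [u0|]; last by exists u.
  by exists v; rewrite // -u0 eq_sym.
move: wW; rewrite inE => /andP[wr wF].
(* The form with coefficients [s1] is [x |-> qf h.+1 s (w * x)]. Since [w] lies in the subfield,
   [s1] has coefficients there and the radical keeps its intersection with the subfield, divided by
   [w]. *)
pose s1 i := s i * (w * w ^+ (q ^ i)).
have s1F i : s1 i \in half_field by rewrite !half_fieldM ?half_fieldX.
have qf1 x : qf h.+1 s1 x = qf h.+1 s (w * x) by exact: qform_scale.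
have pol1 x y : pol h.+1 s1 x y = pol h.+1 s (w * x) (w * y) by exact: polar_scale.
have winj : injective ( *%R w) := mulfI w0.
have rad1 : radical h.+1 s1 :&: half_field =
    ( *%R w) @^-1: (radical h.+1 s :&: half_field).
  apply/setP => x; rewrite !inE; congr andb.
    apply/forallP/forallP => H y; last by rewrite pol1 H.
    by have := H (y / w); rewrite pol1 mulrCA divff // mulr1.
  by rewrite exprMn (half_fieldP _ _ _ wF) (inj_eq winj).
have -> : #|[set x | qf h.+1 s x == 0]| = #|[set x | qf h.+1 s1 x == 0]|.
  rewrite -(card_preimset _ winj); apply: eq_card => x.
  by rewrite !inE qf1.
rewrite -(card_preimset _ winj) -rad1 in card_W.
have one_rad x : pol h.+1 s1 x 1 = 0.
  by move: wr; rewrite inE => /forallP/(_ (w * x)); rewrite pol1 mulr1 => /eqP.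
have qf_one : qf h.+1 s1 1 = 0.
  by apply: (rad_qform q_pchar q_gt1 q_odd); rewrite inE; apply/forallP => x; rewrite one_rad.
have [t [c [tF th st]]] := qform_artin q_pchar q_gt1 n_gt0 cardK q_odd h s1F.
have art1 (x : K) : art (x + 1) = art x.
  by rewrite /artin exprDn_pchar // expr1n; ring.
(* Both [qf h.+1 s1] and [art] are unchanged by [x |-> x + 1], so the leftover [tr (c * x * x)] is
   too: [2 * tr (x * c) + tr c = 0] for all [x]. *)
have c0 : c = 0.
  have trc x : tr (x * c) *+ 2 + tr c = 0.
    have := qfD h.+1 s1 x 1; rewrite one_rad qf_one !addr0 !st art1.
    move/addrI; rewrite (_ : c * (x + 1) * (x + 1) = c * x * x + (x * c + x * c + c)); last by ring.
    rewrite trD => /eqP; rewrite -[X in _ == X]addr0 => /eqP/addrI.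
    by rewrite !trD mulr2n.
  have trc0 : tr c = 0 by have := trc 0; rewrite mul0r tr0 mul0rn add0r.
  apply: (trace_nondegenerate q_pchar q_gt1 N_gt0 cardK) => x.
  have := trc x; rewrite trc0 addr0 -mulr_natr => /eqP.
  by rewrite mulf_eq0 (negPf (natr2_neq0 q_pchar q_gt1 q_odd)) orbF => /eqP.
have {}st x : qf h.+1 s1 x = qf h t (art x) by rewrite st c0 !mul0r tr0 addr0.
have {}th : t h != 0 by rewrite th // !mulf_neq0 // expf_neq0.
have := IH t tF th (card_rad_descent st card_W).
pose D := [set z | qf h t z == 0].
have -> : [set x | qf h.+1 s1 x == 0] = [set x | art x \in D].
  by apply/setP => x; rewrite !inE st.
(* Off the hyperplane [tr = 0] there are [(q - 1) * q ^ (2 * n).-1] points, one in [q] of which is a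
   zero of the form for [t]. Removing these zeros from the inductive count and multiplying by [q]
   gives the claim. *)
rewrite (card_artin_fibre q_pchar q_gt1 N_gt0 cardK).
have := card_singular_off_hyperplane st card_W th.
have := cardsC [set x : K | tr x == 0]; rewrite (card_trace_ker q_pchar q_gt1 N_gt0 cardK).
rewrite cardK (_ : ~: _ = [set x | tr x != 0]); last by apply/setP => x; rewrite !inE.
rewrite -/D -(cardsID [set x : K | tr x == 0] D).
rewrite (_ : D :&: _ = [set z in D | tr z == 0]); last by apply/setP => x; rewrite !inE.
rewrite (_ : D :\: _ = [set x in [set x | tr x != 0] | qf h t x == 0]); last first.
  by apply/setP => x; rewrite !inE.
have -> : (q ^ (n + h.+1).-1 = q * q ^ (n + h).-1)%N.
  by rewrite -expnS; congr expn; lia.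
have -> : (q ^ (2 * n) = q * q ^ (2 * n).-1)%N by rewrite -expnS prednK.
move: #|_| => o; move: #|_| => a; move: #|_| => b; move: (q ^ _)%N (q ^ _)%N => x y.
nia.
Qed.

End EllipticForm.

(** * Cyclotomic polynomials *)

Section CyclotomicCoefficients.

(** The difference has degree below [totient d] and vanishes at [totient d] distinct points. Below,
    [P] is the Frobenius conjugate or the reversal of the cyclotomic polynomial. *)
Lemma cyclotomic_unique (L : fieldType) (d : nat) (xi : L) (P : {poly L}) :
  d.-primitive_root xi -> (size P <= (totient d).+1)%N ->
  (forall x, d.-primitive_root x -> root P x) ->
  P = P`_(totient d) *: cyclotomic xi d.
Proof.
move=> xi_prim szP P_root; set G := cyclotomic xi d.
have szG : size G = (totient d).+1 by exact: size_cyclotomic.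
have Gphi : G`_(totient d) = 1.
  by have /monicP := cyclotomic_monic xi d; rewrite lead_coefE szG.
apply/eqP; rewrite -subr_eq0; apply/eqP; set R := P - _.
pose rs := [seq xi ^+ i | i : 'I_d in [pred i : 'I_d | coprime i d]].
apply: (roots_geq_poly_eq0 (rs := rs)).
- apply/allP => _ /imageP[i co_i ->].
  have prim_i : d.-primitive_root (xi ^+ i) by rewrite prim_root_exp_coprime.
  rewrite /R rootE hornerD hornerN hornerZ (eqP (P_root _ prim_i)).
  by have := root_cyclotomic xi_prim (xi ^+ i); rewrite prim_i => /eqP ->; rewrite mulr0 subrr.
- rewrite map_inj_in_uniq ?enum_uniq // => i j _ _ /eqP.
  rewrite (eq_prim_root_expr xi_prim) !modn_small // => /eqP; exact: val_inj.
have -> : size rs = totient d.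
  rewrite size_map -cardE -[LHS]sum1_card totient_count_coprime -big_mkcond.
  by rewrite big_mkord; apply: eq_bigl => i; rewrite coprime_sym.
apply/leq_sizeP => j; rewrite leq_eqVlt => /predU1P[<-|jd].
  by rewrite coefB coefZ Gphi mulr1 subrr.
have szR : (size R <= (totient d).+1)%N.
  rewrite (leq_trans (size_polyD _ _)) // geq_max szP size_polyN.
  by rewrite (leq_trans (size_scale_leq _ _)) // szG.
by rewrite nth_default // (leq_trans szR).
Qed.

Variables (K : fieldType) (d : nat) (Phi : {poly K}).
Hypothesis Phi_cyclo : is_cyclotomic_poly d Phi.

Lemma size_cyclo : size Phi = (totient d).+1.
Proof.
case: Phi_cyclo => L [iota [xi [_ PhiE]]].
by rewrite -(size_map_poly iota) PhiE size_cyclotomic.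
Qed.

Lemma monic_cyclo : Phi \is monic.
Proof.
case: Phi_cyclo => L [iota [xi [_ PhiE]]].
by rewrite -(map_monic iota) PhiE cyclotomic_monic.
Qed.

Lemma dvdp_cyclo k : (d %| k)%N -> Phi %| 'X^k - 1.
Proof.
case: Phi_cyclo => L [iota [xi [xi_prim PhiE]]] dk.
rewrite -(dvdp_map iota) PhiE rmorphB rmorph1 /= map_polyXn.
apply: (@dvdp_trans _ ('X^d - 1)).
  rewrite (prod_cyclotomic xi_prim) (big_rem d) /=.
    by rewrite divnn (prim_order_gt0 xi_prim) expr1 dvdp_mulr.
  by rewrite -dvdn_divisors ?(prim_order_gt0 xi_prim).
have /dvdnP[e ->] := dk; rewrite mulnC exprM.
by rewrite -[X in _ %| _ - X](expr1n _ e) subrXX dvdp_mulIl.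
Qed.

(** As [p] is prime to [d], the Frobenius permutes the primitive [d]-th roots of unity, so it fixes
    their monic polynomial. *)
Lemma cyclo_frobenius p m i : p \in [pchar K] -> ~~ (p %| d)%N ->
  Phi`_i ^+ (p ^ m) = Phi`_i.
Proof.
move=> pK pd; suff fix1 j : Phi`_j ^+ p = Phi`_j.
  by elim: m => [|m IH]; rewrite ?expn0 ?expr1 // expnSr exprM IH.
case: Phi_cyclo => L [iota [xi [xi_prim PhiE]]].
have pL : p \in [pchar L] by rewrite (fmorph_pchar iota).
have p_pr : prime p by case/andP: pK.
have cop : coprime p d by rewrite prime_coprime.
pose P := map_poly (pFrobenius_aut pL) (cyclotomic xi d).
have szP : size P = (totient d).+1 by rewrite size_map_poly size_cyclotomic.
have PE : P = P`_(totient d) *: cyclotomic xi d.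
  apply: (cyclotomic_unique xi_prim); first by rewrite szP.
  (* [u] is an inverse of [p] modulo [d], so [x] is the Frobenius image of the primitive root
     [x ^+ u]. *)
  move=> x x_prim; have [u _ uE] : exists2 u, (0 < u)%N & (u * p = 1 %[mod d])%N.
    case: (egcdnP d (prime_gt0 p_pr)) => u v uE _.
    rewrite (eqP (cop : gcdn p d == 1%N)) in uE.
    case: u uE => [|u] uE; first by move: uE; rewrite mul0n addn1.
    by exists u.+1; rewrite // uE -modnDml modnMl add0n.
  have xE : x = (x ^+ u) ^+ p.
    by rewrite -exprM -(prim_expr_mod x_prim) uE (prim_expr_mod x_prim).
  have u_prim : d.-primitive_root (x ^+ u).
    rewrite prim_root_exp_coprime //.
    have : coprime (u * p) d by rewrite -coprime_modl uE coprime_modl coprime1n.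
    by rewrite coprimeMl => /andP[].
  rewrite xE rootE; have -> : (x ^+ u) ^+ p = pFrobenius_aut pL (x ^+ u) by [].
  by rewrite horner_map fmorph_eq0 -rootE (root_cyclotomic xi_prim).
have lead1 : P`_(totient d) = 1.
  have /monicP : P \is monic by rewrite map_monic cyclotomic_monic.
  by rewrite lead_coefE szP.
apply: (fmorph_inj iota); rewrite rmorphXn /= -!coef_map PhiE.
have GE : cyclotomic xi d = P by rewrite PE lead1 scale1r.
by rewrite [in RHS]GE coef_map.
Qed.

(** The reversal vanishes at the inverses of the primitive roots, so it is a multiple of the
    polynomial. The two agree at 1, where the value is nonzero because [d > 1]. *)
Lemma cyclo_palindrome i : (1 < d)%N -> (i <= totient d)%N ->
  Phi`_(totient d - i) = Phi`_i.
Proof.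
move=> d1; case: Phi_cyclo => L [iota [xi [xi_prim PhiE]]] le_i.
set G := cyclotomic xi d in PhiE; set r := totient d.
have szG : size G = r.+1 by exact: size_cyclotomic.
pose P := \poly_(j < r.+1) G`_(r - j).
have PE : P = P`_r *: G.
  apply: (cyclotomic_unique xi_prim); first exact: size_poly.
  move=> x x_prim; have x0 : x != 0.
    apply: contra_eq_neq (prim_expr_order x_prim) => ->.
    by rewrite expr0n gtn_eqF ?(ltnW d1) // eq_sym oner_eq0.
  have -> // : root P x = root G x^-1.
    rewrite !rootE /P horner_poly (@horner_coef_wide _ r.+1 G) ?szG //.
    rewrite -[RHS](mulIr_eq0 _ (mulIf (expf_neq0 r x0))) mulr_suml.
    rewrite (reindex_inj rev_ord_inj) /=; congr (_ == 0).
    apply: eq_bigr => j _; have jr : (j <= r)%N by rewrite -ltnS.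
    rewrite subSS subKn // -mulrA; congr (_ * _).
    have -> : x ^+ r = x ^+ j * x ^+ (r - j) by rewrite -exprD subnKC.
    by rewrite exprVn mulKf // expf_neq0.
  rewrite (root_cyclotomic xi_prim).
  have -> : x^-1 = x ^+ d.-1.
    apply: (mulfI x0); rewrite divff // -exprS prednK ?(ltnW d1) //.
    by rewrite (prim_expr_order x_prim).
  by rewrite prim_root_exp_coprime // coprimePn // ltnW.
have G1 : G.[1] != 0.
  rewrite -rootE (root_cyclotomic xi_prim); apply: contraL d1 => one_prim.
  by rewrite -leqNgt dvdn_leq // (prim_order_dvd one_prim) expr1.
have c1 : P`_r = 1.
  apply: (mulIf G1); rewrite -hornerZ -PE mul1r /P horner_poly.
  rewrite (@horner_coef_wide _ r.+1 G) ?szG // (reindex_inj rev_ord_inj) /=.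
  apply: eq_bigr => j _; have jr : (j <= r)%N by rewrite -ltnS.
  by rewrite subSS subKn // !expr1n.
apply: (fmorph_inj iota); rewrite -!coef_map PhiE -/G.
have GE : G = P by rewrite PE c1 scale1r.
by rewrite [in RHS]GE coef_poly ltnS le_i.
Qed.

End CyclotomicCoefficients.

(** * Counting points on the curve *)

Section QAssociate.

Variables (K : finFieldType) (q : nat).
Hypotheses (q_pchar : [pchar K].-nat q) (q_gt1 : (1 < q)%N).

Local Notation Fq := (base_field K q).

Lemma qassociate_wide N (g : {poly K}) : (size g <= N)%N ->
  qassociate q g = \sum_(i < N) g`_i *: 'X^(q ^ i).
Proof.
move=> gN; rewrite /qassociate (big_ord_widen N (fun i => g`_i *: 'X^(q ^ i))) //.
rewrite big_mkcond; apply: eq_bigr => i _; case: ltnP => // ge_i.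
by rewrite nth_default // scale0r.
Qed.

Lemma qassociateD : {morph (@qassociate K q) : f g / f + g}.
Proof.
move=> f g; set N := maxn (size f) (size g).
rewrite !(@qassociate_wide N) ?leq_maxl ?leq_maxr //; last exact: size_polyD.
by rewrite -big_split; apply: eq_bigr => i _; rewrite coefD scalerDl.
Qed.

Lemma qassociate0 : qassociate q (0 : {poly K}) = 0.
Proof. by rewrite /qassociate size_poly0 big_ord0. Qed.

Lemma qassociateZXn c e : qassociate q (c *: 'X^e : {poly K}) = c *: 'X^(q ^ e).
Proof.
rewrite (@qassociate_wide e.+1); last first.
  by rewrite (leq_trans (size_scale_leq _ _)) ?size_polyXn.
rewrite big_ord_recr /= big1 ?add0r => [|i _].
  by rewrite coefZ coefXn eqxx mulr1.
by rewrite coefZ coefXn ltn_eqF ?mulr0 ?scale0r.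
Qed.

(** Coefficients in F_q are fixed by the power [q ^ e], which therefore only shifts the exponents.
    This is what makes [qassociate] multiplicative for composition in [qactM]. *)
Lemma qassociateMXn e (g : {poly K}) : (forall i, g`_i \in Fq) ->
  qassociate q ('X^e * g) = qassociate q g ^+ (q ^ e).
Proof.
move=> gF; have q_poly : [pchar {poly K}].-nat (q ^ e)%N.
  by rewrite (eq_pnat _ (@pchar_poly K)) (q_pchar_exp q_pchar).
rewrite [in LHS](_ : g = \sum_(i < size g) g`_i *: 'X^i); last first.
  by rewrite -[LHS]coefK poly_def.
rewrite mulr_sumr (big_morph _ qassociateD qassociate0) expr_sum_pchar //.
apply: eq_bigr => i _; rewrite -scalerAr -exprD qassociateZXn exprZn.
by rewrite frob_base // -exprM -expnD addnC.
Qed.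

(** [g] acts on [K] with ['X] acting as the [q]-power map; by [qactM], products act by composition
    when the inner factor has coefficients in F_q. *)
Definition qact (g : {poly K}) (x : K) : K := (qassociate q g).[x].

Lemma qactE g x : qact g x = \sum_(i < size g) g`_i * x ^+ (q ^ i).
Proof.
by rewrite /qact horner_sum; apply: eq_bigr => i _; rewrite hornerZ hornerXn.
Qed.

Lemma qact_wide N (g : {poly K}) x : (size g <= N)%N ->
  qact g x = \sum_(i < N) g`_i * x ^+ (q ^ i).
Proof.
move=> gN; rewrite /qact (qassociate_wide gN) horner_sum.
by apply: eq_bigr => i _; rewrite hornerZ hornerXn.
Qed.

Lemma qactB g : {morph qact g : x y / x - y}.
Proof.
move=> x y; rewrite !qactE -sumrB; apply: eq_bigr => i _.
by rewrite (frobB q_pchar) mulrBr.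
Qed.

Lemma qactD g1 g2 x : qact (g1 + g2) x = qact g1 x + qact g2 x.
Proof. by rewrite /qact qassociateD hornerD. Qed.

Lemma qactZXn c e x : qact (c *: 'X^e) x = c * x ^+ (q ^ e).
Proof. by rewrite /qact qassociateZXn hornerZ hornerXn. Qed.

Lemma qactM (g1 g2 : {poly K}) x : (forall i, g2`_i \in Fq) ->
  qact (g1 * g2) x = qact g1 (qact g2 x).
Proof.
move=> gF; rewrite [in LHS](_ : g1 = \sum_(i < size g1) g1`_i *: 'X^i); last first.
  by rewrite -[LHS]coefK poly_def.
rewrite mulr_suml /qact (big_morph _ qassociateD qassociate0) horner_sum.
rewrite -/(qact g2 x) -/(qact g1 _) qactE; apply: eq_bigr => i _.
rewrite -scalerAl -horner_exp -(qassociateMXn i gF) -hornerZ; congr _.[x].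
have widen N c (g : {poly K}) : (size g <= N)%N ->
    qassociate q (c *: g) = c *: \sum_(i < N) g`_i *: 'X^(q ^ i).
  move=> gN; rewrite (@qassociate_wide N) ?(leq_trans (size_scale_leq _ _)) //.
  by rewrite scaler_sumr; apply: eq_bigr => j _; rewrite coefZ scalerA.
by rewrite (widen (size ('X^i * g2))).
Qed.

Lemma base_coefM (g1 g2 : {poly K}) : (forall i, g1`_i \in Fq) ->
  (forall i, g2`_i \in Fq) -> forall i, (g1 * g2)`_i \in Fq.
Proof.
move=> F1 F2 i; rewrite inE coefM expr_sum_pchar //; apply/eqP/eq_bigr => j _.
by rewrite exprMn (frob_base 1 (F1 _) : _ ^+ q = _) (frob_base 1 (F2 _) : _ ^+ q = _).
Qed.

Lemma base_coefXn e i : ('X^e : {poly K})`_i \in Fq.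
Proof.
by rewrite inE coefXn; case: (i == e); rewrite ?expr1n // expr0n gtn_eqF // ltnW.
Qed.

Lemma base_coef_sum (I : Type) (r : seq I) (P : pred I) (G : I -> {poly K}) :
  (forall j i, P j -> (G j)`_i \in Fq) ->
  forall i, (\sum_(j <- r | P j) G j)`_i \in Fq.
Proof.
move=> GF i; rewrite coef_sum inE expr_sum_pchar //; apply/eqP/eq_bigr => j Pj.
exact: (frob_base 1 (GF j i Pj)).
Qed.

Lemma card_qact_ker (g : {poly K}) : g != 0 ->
  (#|[set x | qact g x == 0%R]| <= q ^ (size g).-1)%N.
Proof.
move=> g0; set A := qassociate q g.
have szA : (size A <= (q ^ (size g).-1).+1)%N.
  rewrite (leq_trans (size_sum _ _ _)) //; apply/bigmax_leqP => i _.
  rewrite (leq_trans (size_scale_leq _ _)) // size_polyXn ltnS leq_exp2l //.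
  by rewrite -ltnS prednK // (leq_ltn_trans _ (ltn_ord i)).
have A0 : A != 0.
  have sg : (0 < size g)%N by rewrite size_poly_gt0.
  apply: contraNneq g0 => /(congr1 (fun B : {poly K} => B`_(q ^ (size g).-1))).
  rewrite /A /qassociate coef0 coef_sum -(prednK sg) big_ord_recr /= big1 ?add0r => [|i _].
    by rewrite coefZ coefXn eqxx mulr1 => /eqP; rewrite -lead_coefE lead_coef_eq0.
  by rewrite coefZ coefXn gtn_eqF ?mulr0 // ltn_exp2l.
rewrite -ltnS (leq_trans _ szA) // (leq_trans _ (card_root_set A0)) // ltnS.
Qed.

End QAssociate.

Lemma size_qassociate (K : fieldType) (q : nat) (g : {poly K}) : (1 < q)%N ->
  g != 0 -> size (qassociate q g) = (q ^ (size g).-1).+1.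
Proof.
move=> q_gt1 g0; have sg : (0 < size g)%N by rewrite size_poly_gt0.
have lg : g`_(size g).-1 != 0 by rewrite -lead_coefE lead_coef_eq0.
rewrite /qassociate -(prednK sg) big_ord_recr /= addrC size_polyDl size_scale ?size_polyXn //.
rewrite ltnS (leq_trans (size_sum _ _ _)) //; apply/bigmax_leqP => i _.
by rewrite (leq_trans (size_scale_leq _ _)) // size_polyXn ltn_exp2l.
Qed.

(* 'X^h times the sum of G and of its adjoint, for which 'X^i becomes 'X^(-i). *)
Definition self_adjoint (K : fieldType) (h : nat) (G : {poly K}) : {poly K} :=
  \sum_(i < h.+1) G`_i *: ('X^(h + i) + 'X^(h - i)).

Section SelfAdjoint.

Variables (K : fieldType) (h : nat).

Lemma self_adjointD : {morph (@self_adjoint K h) : f g / f + g}.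
Proof.
move=> f g; rewrite /self_adjoint -big_split; apply: eq_bigr => i _.
by rewrite coefD scalerDl.
Qed.

Lemma self_adjoint0 : self_adjoint h (0 : {poly K}) = 0.
Proof. by rewrite /self_adjoint big1 // => i _; rewrite coef0 scale0r. Qed.

Lemma self_adjointZXn c e : (e <= h)%N ->
  self_adjoint h (c *: 'X^e : {poly K}) = c *: ('X^(h + e) + 'X^(h - e)).
Proof.
rewrite -ltnS => eh; rewrite /self_adjoint (bigD1 (Ordinal eh)) //= big1 => [|i ie].
  by rewrite coefZ coefXn eqxx mulr1 addr0.
rewrite coefZ coefXn -(inj_eq val_inj) /= in ie *.
by rewrite (negPf ie) mulr0 scale0r.
Qed.

Definition self_adjoint_sum := big_morph (self_adjoint h) self_adjointD self_adjoint0.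

Lemma poly_sum_coef (P : {poly K}) N : (size P <= N)%N ->
  P = \sum_(i < N) P`_i *: 'X^i.
Proof.
move=> PN; rewrite -[LHS]coefK poly_def.
rewrite (big_ord_widen N (fun i => P`_i *: 'X^i)) // big_mkcond.
by apply: eq_bigr => i _; case: ltnP => // iP; rewrite nth_default // scale0r.
Qed.

(** Since [Phi] is palindromic of formal degree [f], the adjoint of ['X^e * Phi] is
    ['X^(- e - f) * Phi]. *)
Lemma self_adjointXnM (Phi : {poly K}) f e : (size Phi <= f.+1)%N ->
  (forall i, (i <= f)%N -> Phi`_(f - i) = Phi`_i) -> (e + f <= h)%N ->
  self_adjoint h ('X^e * Phi) = ('X^(h + e) + 'X^(h - e - f)) * Phi.
Proof.
move=> szP pal efh; rewrite [in LHS](poly_sum_coef szP) mulr_sumr self_adjoint_sum.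
have E (i : 'I_f.+1) : self_adjoint h ('X^e * (Phi`_i *: 'X^i)) =
    'X^(h + e) * (Phi`_i *: 'X^i) + 'X^(h - e - f) * (Phi`_(f - i) *: 'X^(f - i)).
  have i_f : (i <= f)%N by rewrite -ltnS.
  rewrite pal // -!scalerAr -!exprD self_adjointZXn; last by lia.
  by rewrite -scalerDr addnA; congr (_ *: (_ + 'X^_)); lia.
rewrite (eq_bigr _ (fun i _ => E i)) big_split /= mulrDl; congr (_ + _).
  by rewrite -mulr_sumr -poly_sum_coef.
rewrite -mulr_sumr; congr (_ * _); rewrite [RHS](poly_sum_coef szP).
rewrite [RHS](reindex_inj rev_ord_inj) /=; apply: eq_bigr => i _.
by rewrite subSS.
Qed.

Lemma palindrome_split (Phi : {poly K}) r : (size Phi <= (2 * r).+1)%N ->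
  (forall i, (i <= 2 * r)%N -> Phi`_(2 * r - i) = Phi`_i) ->
  Phi = \sum_(i < r) Phi`_i *: ('X^(2 * r - i) + 'X^i) + Phi`_r *: 'X^r.
Proof.
move=> szP pal; have szP' : (size Phi <= r + r.+1)%N by rewrite (leq_trans szP) //; lia.
rewrite [LHS](poly_sum_coef szP') big_split_ord big_ord_recl /= addn0.
rewrite [X in _ + X]addrC addrA; congr (_ + _).
rewrite [X in _ + X](reindex_inj rev_ord_inj) -big_split /=; apply: eq_bigr => i _.
have ir := ltn_ord i; rewrite scalerDr addrC /bump /=.
have -> : (r + (1 + (r - i.+1)) = 2 * r - i)%N by lia.
by rewrite pal //; lia.
Qed.

End SelfAdjoint.

Lemma card_AS_points (K : finFieldType) (q N : nat) (f : {poly K}) :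
  [pchar K].-nat q -> (1 < q)%N -> (0 < N)%N -> #|K| = (q ^ N)%N ->
  AS_points q f = (1 + q * #|[set x | trace q N f.[x] == 0%R]|)%N.
Proof.
move=> q_pchar q_gt1 N_gt0 cardK; rewrite /AS_points; congr addn.
rewrite -[LHS]sum1_card (partition_big (fun u : K * K => u.1) xpredT) //=.
transitivity (\sum_(x in [set x | trace q N f.[x] == 0%R]) q)%N; last first.
  by rewrite sum_nat_const mulnC.
rewrite [RHS]big_mkcond; apply: eq_bigr => x _; rewrite sum1dep_card.
have := card_artin_fibre q_pchar q_gt1 N_gt0 cardK [set f.[x]].
have -> : #|[set z in [set f.[x]] | trace q N z == 0]| = (trace q N f.[x] == 0).
  rewrite (_ : [set z in _ | _] = if trace q N f.[x] == 0 then [set f.[x]] else set0).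
    by case: ifP; rewrite ?cards1 ?cards0.
  apply/setP => z; rewrite !inE; case: (z =P f.[x]) => [->|/eqP zf] /=.
    by case: ifP; rewrite ?inE ?eqxx.
  by case: ifP; rewrite ?inE ?(negPf zf).
rewrite inE => E; transitivity (q * (trace q N f.[x] == 0%R))%N; last first.
  by case: (_ == _); rewrite ?muln1 ?muln0.
have inj : injective (fun y : K => (x, y)) by move=> y z [].
rewrite -E -[RHS](card_imset _ inj).
apply: eq_card => -[x' y]; rewrite !inE /=; apply/andP/imsetP.
  by case=> e /eqP <-; exists y; rewrite // !inE.
by case=> y'; rewrite !inE => e [-> ->]; rewrite eqxx.
Qed.

(** * The quadratic form of the curve: its radical and its number of zeros *)

Section Application.

Variables (p m q k d r a M : nat).
Hypotheses (hp_odd : odd p) (hm : (0 < m)%N) (hq : q = (p ^ m)%N).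
Hypotheses (hk : (0 < k)%N) (hk_even : ~~ odd k).
Hypotheses (hd : (1 < d)%N) (hdk : (d %| k)%N) (hpd : ~~ (p %| d)%N).
Hypotheses (hr : totient d = (2 * r)%N) (ha : k = (a + r)%N) (hM : (0 < M)%N).
Local Notation n := (k * (2 * M + 1))%N.
Local Notation h := (k * M + r)%N.
Variables (K : finFieldType) (hK : #|K| = (q ^ (2 * n))%N) (pK : p \in [pchar K]).
Variables (Phi : {poly K}) (hPhi : is_cyclotomic_poly d Phi).

Local Notation Fq := (base_field K q).
Local Notation half_field := (base_field K (q ^ n)).

Let p_pr : prime p. Proof. by case/andP: pK. Qed.
Let q_gt1 : (1 < q)%N.
Proof. by rewrite hq -(exp1n m) ltn_exp2r // prime_gt1. Qed.
Let q_odd : odd q. Proof. by rewrite hq oddX hp_odd orbT. Qed.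
Let q_pchar : [pchar K].-nat q.
Proof. by rewrite (eq_pnat _ (pcharf_eq pK)) hq pnatX pnat_id. Qed.
Let n_gt0 : (0 < n)%N. Proof. by rewrite muln_gt0 hk addn1. Qed.
Let n_even : ~~ odd n. Proof. by rewrite oddM (negPf hk_even). Qed.
Let N_gt0 : (0 < 2 * n)%N. Proof. by rewrite muln_gt0. Qed.

Let szPhi : size Phi = (2 * r).+1. Proof. by rewrite (size_cyclo hPhi) hr. Qed.
Let Phi_pal i : (i <= 2 * r)%N -> Phi`_(2 * r - i) = Phi`_i.
Proof. by rewrite -hr; exact: cyclo_palindrome. Qed.
Let Phi_base i : Phi`_i \in Fq.
Proof. by rewrite inE hq (cyclo_frobenius hPhi). Qed.
Let Phi_lead : Phi`_(2 * r) = 1.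
Proof. by have /monicP := monic_cyclo hPhi; rewrite lead_coefE szPhi. Qed.

(** The right-hand side of the curve is [x] times the [q]-associate of this polynomial
    ([AS_curveE]); its coefficients are thus those of the trace form. *)
Definition curve_poly : {poly K} :=
  \sum_(j < M) 'X^(a + k * j) * Phi + \sum_(i < r) Phi`_i *: 'X^(r - i)
  + (Phi`_r / 2%:R) *: 'X^0.

Local Notation G := curve_poly.

Let two_neq0 : 2%:R != 0 :> K := natr2_neq0 q_pchar q_gt1 q_odd.

Lemma curve_poly_base i : G`_i \in Fq.
Proof.
have FD (x y : K) : x \in Fq -> y \in Fq -> x + y \in Fq.
  by rewrite !inE exprDn_pchar // => /eqP -> /eqP ->.
have FM (x y : K) : x \in Fq -> y \in Fq -> x * y \in Fq.
  by rewrite !inE exprMn => /eqP -> /eqP ->.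
have F2 : (2%:R : K)^-1 \in Fq.
  by rewrite inE exprVn mulr2n exprDn_pchar // expr1n.
rewrite !coefD !FD //.
- by apply: base_coef_sum => // j i' _; apply: base_coefM => //; exact: base_coefXn.
- apply: base_coef_sum => // j i' _; rewrite coefZ FM //; exact: base_coefXn.
- by rewrite coefZ !FM //; exact: base_coefXn.
Qed.

Lemma size_curve_poly_le : (size G <= h.+1)%N.
Proof.
apply: (leq_trans (size_polyD _ _)); rewrite geq_max; apply/andP; split.
  apply: (leq_trans (size_polyD _ _)); rewrite geq_max; apply/andP; split.
  - apply: (leq_trans (size_sum _ _ _)); apply/bigmax_leqP => j _.
    apply: (leq_trans (size_polyMleq _ _)); rewrite size_polyXn szPhi.
    have : (k * j.+1 <= k * M)%N by rewrite leq_mul2l ltn_ord orbT.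
    by rewrite mulnS; lia.
  - apply: (leq_trans (size_sum _ _ _)); apply/bigmax_leqP => j _.
    by apply: (leq_trans (size_scale_leq _ _)); rewrite size_polyXn; lia.
by apply: (leq_trans (size_scale_leq _ _)); rewrite size_polyXn.
Qed.

Lemma curve_poly_lead : G`_h = 1.
Proof.
have kM : (0 < k * M)%N by rewrite muln_gt0 hk.
rewrite /G !coefD coefZ coefXn gtn_eqF ?mulr0 ?addr0; last by lia.
rewrite [X in _ + X]coef_sum [X in _ + X]big1 ?addr0; last first.
  by move=> i _; rewrite coefZ coefXn gtn_eqF ?mulr0 //; lia.
rewrite coef_sum -(prednK hM) big_ord_recr /= big1 ?add0r => [|j _].
  rewrite coefXnM (_ : k * M.-1.+1 + r - (a + k * M.-1) = 2 * r)%N; last by rewrite mulnS; lia.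
  by rewrite ltnNge Phi_lead (_ : a + k * M.-1 <= k * M.-1.+1 + r)%N // mulnS; lia.
rewrite coefXnM nth_default ?if_same // szPhi.
have jM : (j.+2 <= M)%N by have := ltn_ord j; lia.
have : (k * j.+2 <= k * M)%N by rewrite leq_mul2l jM orbT.
by rewrite !mulnS; lia.
Qed.

Lemma size_curve_poly : size G = h.+1.
Proof.
apply/eqP; rewrite eqn_leq size_curve_poly_le /= ltnNge; apply/negP => le_h.
by have := curve_poly_lead; rewrite nth_default // => /esym/eqP; rewrite oner_eq0.
Qed.

Let D : {poly K} := \sum_(l < 2 * M + 1) 'X^(k * l).

(** The equation of the curve is designed for this. The first sum yields the shifted copies
    ['X^(k * l) * Phi] for [l] other than [M]. The other two terms are one half of [Phi], folded at
    its middle coefficient, and yield the missing copy [l = M]; the middle coefficient is halved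
    because it is its own mirror image. *)
Lemma self_adjoint_curve_poly : self_adjoint h G = D * Phi.
Proof.
have sumE := @self_adjoint_sum K h.
rewrite /G !self_adjointD !sumE.
have E1 : \sum_(j < M) self_adjoint h ('X^(a + k * j) * Phi) =
    (\sum_(j < M) 'X^(k * (M.+1 + j)) + \sum_(j < M) 'X^(k * (M - j.+1))) * Phi.
  rewrite mulrDl !mulr_suml -big_split; apply: eq_bigr => j _ /=.
  have jM := ltn_ord j.
  have kj : (k * j.+1 <= k * M)%N by rewrite leq_mul2l jM orbT.
  rewrite (@self_adjointXnM _ _ _ (2 * r)) ?szPhi //; last by move: kj; rewrite mulnS; lia.
  rewrite -mulrDl; congr ((_ + _) * _); congr 'X^_.
    by rewrite mulnDr mulnS; lia.
  by rewrite mulnBr; move: kj; rewrite mulnS; lia.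
have E2 : \sum_(i < r) self_adjoint h (Phi`_i *: 'X^(r - i))
    + self_adjoint h ((Phi`_r / 2%:R) *: 'X^0) = 'X^(k * M) * Phi.
  rewrite self_adjointZXn // addn0 subn0 -mulr2n -scalerMnr scalerMnl -mulr_natr divfK //.
  rewrite [X in _ = _ * X](@palindrome_split _ _ r) ?szPhi // mulrDr mulr_sumr.
  congr (_ + _); last by rewrite -scalerAr -exprD.
  apply: eq_bigr => i _; have ir := ltn_ord i.
  rewrite self_adjointZXn; last by lia.
  by rewrite -scalerAr mulrDr -!exprD; congr (_ *: ('X^_ + 'X^_)); lia.
rewrite -addrA E2 E1 -mulrDl; congr (_ * _).
rewrite /D (_ : 2 * M + 1 = M + M.+1)%N; last by lia.
rewrite big_split_ord big_ord_recl /= addn0 [LHS]addrAC [RHS]addrC; congr (_ + _).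
  by rewrite addrC; congr (_ + _); apply: eq_bigr => j _; rewrite addSnnS.
by rewrite [LHS](reindex_inj rev_ord_inj) /=; apply: eq_bigr => j _;
  rewrite subnSK // subKn // ltnW.
Qed.

Local Notation s := (fun i => G`_i).

Let A_base i : (D * Phi)`_i \in Fq.
Proof.
by apply: base_coefM => // j; apply: base_coef_sum => // l t _; exact: base_coefXn.
Qed.

(** The coefficients lie in F_q and [q ^ (2 * n)]-th powers are trivial on [K]. So the [q ^ h]-th
    power of the second factor in [polar_trace] is [self_adjoint h G] acting on [x]. *)
Lemma qact_ker_rad x : qact q (D * Phi) x = 0 -> x \in rad q n h s.
Proof.
move=> Ax; have hn : (h <= 2 * n)%N by rewrite ha; lia.
set c := \sum_(i < h.+1) (G`_i * x ^+ (q ^ i) + (G`_i * x) ^+ (q ^ (2 * n - i))).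
have c0 : c = 0.
  have q0 : (0 < q ^ h)%N by rewrite expn_gt0 ltnW.
  suff /eqP: c ^+ (q ^ h) = 0 by rewrite expf_eq0 q0 => /eqP.
  rewrite -Ax -self_adjoint_curve_poly.
  rewrite {1}/c expr_sum_pchar ?q_pchar_exp // /self_adjoint /qact.
  rewrite (big_morph _ (@qassociateD K q) (@qassociate0 K q)) horner_sum.
  apply: eq_bigr => i _; have ih : (i <= h)%N by rewrite -ltnS.
  rewrite scalerDr qassociateD hornerD -!/(qact q _ x) !qactZXn.
  rewrite (frobD q_pchar) !exprMn -!frob_add !(frob_base _ (curve_poly_base i)).
  rewrite [(h + i)%N]addnC (_ : 2 * n - i + h = 2 * n + (h - i))%N; last first.
    by rewrite addnBA // addnBAC // (leq_trans ih).
  by rewrite (frob_add _ (2 * n)) (frob_card hK).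
rewrite inE; apply/forallP => y; rewrite (polar_trace q_pchar n_gt0 hK) //.
by rewrite -/c c0 mulr0 (trace0 _ q_pchar).
Qed.

(** With [Psi * Phi = 'X^k - 1] one has [Psi * (D * Phi) = 'X^n - 1], which kills F_{q^n}. So
    [D * Phi] maps F_{q^n} into the kernel of [Psi], of size at most [q ^ (k - 2 * r)], and its own
    kernel there has at least [q ^ (n - k + 2 * r) = q ^ (2 * h)] elements. *)
Lemma card_rad_curve : (q ^ (2 * h) <= #|rad q n h s :&: half_field|)%N.
Proof.
have /dvdpP[Psi PsiE] := dvdp_cyclo hPhi hdk.
have Xk0 : 'X^k - 1 != 0 :> {poly K} by rewrite -size_poly_eq0 size_XnsubC.
have Psi0 : Psi != 0 by apply: contraNneq Xk0 => P0; rewrite PsiE P0 mul0r.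
have Phi0 : Phi != 0 by rewrite -size_poly_eq0 szPhi.
have szPsi : (size Psi + 2 * r = k.+1)%N.
  by rewrite -(size_XnsubC (1 : K) hk) polyC1 PsiE size_mul // szPhi addnS.
have PsiD : Psi * (D * Phi) = 1 *: 'X^n + (-1) *: 'X^0.
  rewrite mulrCA -PsiE scale1r scaleN1r expr0 exprM [RHS]subrX1 mulrC.
  by congr (_ * _); apply: eq_bigr => l _; rewrite exprM.
have kerE x : x \in half_field -> qact q Psi (qact q (D * Phi) x) = 0.
  move/half_fieldP=> xn; rewrite -qactM // PsiD qactD !qactZXn expn0 expr1 xn.
  by rewrite mul1r mulN1r subrr.
have := @card_additive_fibres _ _ (qact q (D * Phi)) half_field.
have -> : #|half_field| = (q ^ n)%N by rewrite (card_half_field q_pchar).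
have fib0 : zmod_closed half_field.
  split=> [|u v]; last exact: half_fieldB.
  by apply/half_fieldP; rewrite expr0n gtn_eqF // expn_gt0 ltnW.
move=> /(_ fib0 (in2W (qactB q_pchar _))) E.
have im_le : (#|qact q (D * Phi) @: half_field| <= q ^ (size Psi).-1)%N.
  apply: leq_trans (card_qact_ker q_gt1 Psi0); apply: subset_leq_card.
  by apply/subsetP => _ /imsetP[x xF ->]; rewrite inE kerE.
have sPsi : (0 < size Psi)%N by rewrite size_poly_gt0.
have q0 : (0 < q ^ (size Psi).-1)%N by rewrite expn_gt0 ltnW.
rewrite -(leq_pmul2r q0) -expnD (_ : 2 * h + (size Psi).-1 = n)%N; last by lia.
rewrite [X in (X <= _)%N]E leq_mul // subset_leq_card //.
apply/subsetP => x; rewrite inE => /andP[xF /eqP Ax].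
by rewrite in_setI xF andbT qact_ker_rad.
Qed.

Lemma card_AS_curve :
  (AS_points q ('X * qassociate q G) + (q - 1) * q ^ (n + h) = q ^ (2 * n) + 1)%N.
Proof.
rewrite (card_AS_points _ q_pchar q_gt1 N_gt0 hK).
have s_half i : G`_i \in half_field.
  exact: base_sub_half (curve_poly_base i).
have s_lead : G`_h != 0 by rewrite curve_poly_lead oner_neq0.
have := card_qform q_pchar q_gt1 n_gt0 hK q_odd n_even s_half s_lead card_rad_curve.
have -> : #|[set x | trace q (2 * n) ('X * qassociate q G).[x] == 0]| =
    #|[set x | qform q n h s x == 0]|.
  apply: eq_card => x; rewrite !inE hornerM hornerX -/(qact q G x).
  rewrite (@qact_wide _ _ h.+1) ?size_curve_poly //; congr (trace _ _ _ == 0).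
  by rewrite mulr_sumr; apply: eq_bigr => i _; rewrite mulrCA mulrA.
have -> : (q ^ (n + h) = q * q ^ (n + h).-1)%N by rewrite -expnS prednK // addn_gt0 n_gt0.
have -> : (q ^ (2 * n) = q * q ^ (2 * n).-1)%N by rewrite -expnS prednK.
by move: #|_| => N0 <-; rewrite mulnDr mulnCA; lia.
Qed.

Lemma size_AS_curve : size ('X * qassociate q G) = (q ^ h).+2.
Proof.
have G0 : G != 0 by rewrite -size_poly_eq0 size_curve_poly.
rewrite mulrC size_mulX ?size_qassociate ?size_curve_poly //.
by rewrite -size_poly_eq0 size_qassociate.
Qed.

Lemma AS_curveE :
  'X * qassociate q G =
  'X * (\sum_(0 <= j < M) qassociate q Phi ^+ (q ^ (a + k * j)))
  + 'X * (\sum_(0 <= i < r) Phi`_i *: 'X^(q ^ (k - a - i)))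
  + (Phi`_r / 2%:R) *: 'X^2.
Proof.
have sumE := big_morph _ (@qassociateD K q) (@qassociate0 K q).
rewrite /G !qassociateD !sumE !mulrDr qassociateZXn expn0 !big_mkord.
congr (_ + _ + _); last by rewrite -scalerAr.
  by congr (_ * _); apply: eq_bigr => j _; rewrite qassociateMXn.
congr (_ * _); apply: eq_bigr => i _; rewrite qassociateZXn.
by rewrite (_ : k - a = r)%N // ha addKn.
Qed.

End Application.

(** * Valuation rings *)

From mathcomp Require Import boolp classical_sets cardinality.

Section Place.

Variables (K F : fieldType) (iota : {rmorphism K -> F}).

Section MaximalIdeal.

Variable P : place iota.
Local Notation O := (local_ring P).

Lemma place0 : O 0. Proof. by rewrite -(rmorph0 iota); exact: place_const. Qed.
Lemma place1 : O 1. Proof. by rewrite -(rmorph1 iota); exact: place_const. Qed.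

Lemma placeN z : O z -> O (- z).
Proof. by move=> Oz; rewrite -sub0r; apply: place_sub => //; exact: place0. Qed.

Lemma placeD z w : O z -> O w -> O (z + w).
Proof. by move=> Oz Ow; rewrite -[w]opprK; apply: place_sub => //; exact: placeN. Qed.

Lemma placeX z n : O z -> O (z ^+ n).
Proof.
by move=> Oz; elim: n => [|n IH]; [exact: place1|rewrite exprS; exact: place_mul].
Qed.

Lemma place_sum (I : Type) (r : seq I) (Q : pred I) (E : I -> F) :
  (forall i, Q i -> O (E i)) -> O (\sum_(i <- r | Q i) E i).
Proof. by move=> OE; apply: big_ind => //; [exact: place0|exact: placeD]. Qed.

(** The maximal ideal, that is, the non-units. Zero is listed apart because [0^-1 = 0] lies in the
    ring. *)
Definition place_max (z : F) : Prop := z = 0 \/ ~ O z^-1.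

Lemma place_max_local z : place_max z -> O z.
Proof. by case=> [->|nO]; [exact: place0|case: (place_total P z)]. Qed.

Lemma place_notin_max z : ~ O z -> place_max z^-1.
Proof. by right; rewrite invrK. Qed.

Lemma place_max1 : ~ place_max 1.
Proof. by case=> [/eqP|]; rewrite ?oner_eq0 // invr1; case; exact: place1. Qed.

Lemma place_unit_inv z : ~ place_max z -> O z^-1.
Proof. by move=> zU; apply: contrapT => nO; apply: zU; right. Qed.

Lemma place_unit_neq0 z : ~ place_max z -> z != 0.
Proof. by move=> zU; apply/eqP => z0; apply: zU; left. Qed.

Lemma place_maxMr z w : place_max z -> O w -> place_max (z * w).
Proof.
case=> [->|nO] Ow; first by left; rewrite mul0r.
have [->|w0] := eqVneq w 0; first by left; rewrite mulr0.
right; rewrite invfM => Ozw; apply: nO.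
by rewrite -[z^-1](mulfVK w0); exact: place_mul.
Qed.

Lemma place_maxMl z w : O z -> place_max w -> place_max (z * w).
Proof. by move=> Oz mw; rewrite mulrC; exact: place_maxMr. Qed.

Lemma place_maxN z : place_max z -> place_max (- z).
Proof.
by move=> mz; rewrite -mulrN1; apply: place_maxMr => //; apply: placeN; exact: place1.
Qed.

Lemma place_maxD z w : place_max z -> place_max w -> place_max (z + w).
Proof.
wlog Ozw : z w / O (z / w).
  move=> wl mz mw; case: (place_total P (z / w)) => [Ozw|]; first exact: wl.
  by rewrite invf_div addrC => Owz; exact: wl.
move=> mz mw; have [w0|w0] := eqVneq w 0; first by rewrite w0 addr0.
have -> : z + w = (z / w + 1) * w by rewrite mulrDl divfK // mul1r.
by apply: place_maxMl => //; apply: placeD => //; exact: place1.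
Qed.

Lemma place_maxB z w : place_max z -> place_max w -> place_max (z - w).
Proof. by move=> mz mw; apply: place_maxD => //; exact: place_maxN. Qed.

Lemma place_max_sum (I : Type) (r : seq I) (Q : pred I) (E : I -> F) :
  (forall i, Q i -> place_max (E i)) -> place_max (\sum_(i <- r | Q i) E i).
Proof. by move=> OE; apply: big_ind => //; [left|exact: place_maxD]. Qed.

Lemma place_max_prime z w : place_max (z * w) -> place_max z \/ place_max w.
Proof.
move=> mzw; apply: contrapT => /not_orP[zU wU].
case: mzw => [/eqP|nO]; first by rewrite mulf_eq0 => /orP[] /eqP e0; [apply: zU|apply: wU]; left.
by apply: nO; rewrite invfM; apply: place_mul; exact: place_unit_inv.
Qed.

Lemma place_unitM z w : ~ place_max z -> ~ place_max w -> ~ place_max (z * w).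
Proof. by move=> zU wU /place_max_prime[]. Qed.

Lemma place_maxX z n : place_max (z ^+ n) -> place_max z.
Proof.
elim: n => [|n IH]; first by rewrite expr0 => /place_max1.
by rewrite exprS => /place_max_prime[].
Qed.

Lemma place_unitX z n : ~ place_max z -> ~ place_max (z ^+ n).
Proof. by move=> zU /place_maxX. Qed.

Lemma place_max_expS z n : place_max z -> place_max (z ^+ n.+1).
Proof.
by move=> mz; rewrite exprS; apply: place_maxMr => //; apply/placeX/place_max_local.
Qed.

Lemma place_root z n : (0 < n)%N -> O (z ^+ n) -> O z.
Proof.
case: n => // n _ Ozn; apply: contrapT => nO.
have [z0|zn0] := eqVneq (z ^+ n.+1) 0.
  by move: nO; move/eqP: z0; rewrite expf_eq0 => /eqP ->; apply; exact: place0.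
have := place_max_expS n (place_notin_max nO); rewrite exprVn.
case=> [/eqP|]; first by rewrite invr_eq0 (negPf zn0).
by rewrite invrK.
Qed.

Lemma place_unit_add z w : ~ place_max z -> place_max w -> ~ place_max (z + w).
Proof.
by move=> zU mw mzw; apply: zU; rewrite -[z](addrK w); exact: place_maxB.
Qed.

End MaximalIdeal.

Lemma place_ext (P Q : place iota) :
  (forall z, local_ring P z <-> local_ring Q z) -> P = Q.
Proof.
case: P => O1 c1 s1 m1 t1 p1; case: Q => O2 c2 s2 m2 t2 p2 /= E.
have {}E : O1 = O2 by apply/funext => z; apply/propext.
case: O2 / E c2 s2 m2 t2 p2 => c2 s2 m2 t2 p2.
congr Place; exact: Prop_irrelevance.
Qed.

(** * Chevalley's theorem on the existence of places *)

Section Chevalley.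

Variables (B : F -> Prop) (b : F).
Hypotheses (B_const : forall c, B (iota c)).
Hypotheses (B_sub : forall z w, B z -> B w -> B (z - w)).
Hypotheses (B_mul : forall z w, B z -> B w -> B (z * w)).
Hypotheses (Bb : B b) (nBb : ~ B b^-1).

Let good (C : set F) := [/\ (forall z w, C z -> C w -> C (z - w)),
  (forall z w, C z -> C w -> C (z * w)) & ~ C b^-1].

(* A maximal subring with these properties is a valuation ring. *)
Let maximal_subring : exists C : set F,
  [/\ good C, (forall z, B z -> C z)
    & forall C', good C' -> (forall z, C z -> C' z) -> forall z, C' z -> C z].
Proof.
(* Zorn is applied to sets whose union with [B] is good, so that the empty chain, with its empty
   union, is covered too. *)
have [|A [gA maxA]] := @Zorn_bigcup F (fun A => good (A `|` B)%classic).
  move=> E EP Etot; have dir z w : ((\bigcup_(X in E) X) `|` B)%classic z ->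
      ((\bigcup_(X in E) X) `|` B)%classic w ->
      exists C : set F, [/\ good C, C z, C w
        & forall t, C t -> ((\bigcup_(X in E) X) `|` B)%classic t].
    have goodB : good B by [].
    have sub X : E X -> forall t, (X `|` B)%classic t ->
        ((\bigcup_(X in E) X) `|` B)%classic t.
      by move=> EX t [Xt|Bt]; [left; exists X|right].
    move=> [[X EX Xz]|Bz] [[Y EY Yw]|Bw].
    - case: (Etot X Y EX EY) => XY.
        by exists (Y `|` B)%classic; split; [exact: EP|left; exact: XY|left|exact: sub].
      by exists (X `|` B)%classic; split; [exact: EP|left|left; exact: XY|exact: sub].
    - by exists (X `|` B)%classic; split; [exact: EP|left|right|exact: sub].
    - by exists (Y `|` B)%classic; split; [exact: EP|right|left|exact: sub].
    - by exists B; split=> //; right.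
  split=> [z w hz hw|z w hz hw|hb].
  - by have [C [[sC _ _] Cz Cw]] := dir z w hz hw; apply; exact: sC.
  - by have [C [[_ mC _] Cz Cw]] := dir z w hz hw; apply; exact: mC.
  - by have [C [[_ _ nC] Cz Cw _]] := dir _ _ hb hb; exact: nC.
exists (A `|` B)%classic; split=> // [z Bz|C' gC' sub z C'z]; first by right.
apply: contrapT => nz; have C'B : (C' `|` B)%classic = C'.
  by apply/seteqP; split=> t; [case=> // Bt; apply: sub; right|left].
apply: (maxA C'); last by rewrite C'B.
split=> [t At|/(_ z C'z) Az]; first by apply: sub; left.
by apply: nz; left.
Qed.

(** Let [C] be maximal among the subrings containing [B] but not [b^-1]. If neither [z] nor [z^-1]
    were in [C], then both [C[z]] and [C[z^-1]] would contain [b^-1]. Two such expressions are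
    played against each other to lower the degrees until [b^-1] falls into [C]. *)
Lemma place_exists :
  exists P : place iota, (forall z, B z -> local_ring P z) /\ place_max P b.
Proof.
have [C [[Csub Cmul nCb] BC maxC]] := maximal_subring.
have C0 : C 0 by apply: BC; rewrite -(rmorph0 iota).
have C1 : C 1 by apply: BC; rewrite -(rmorph1 iota).
have CN z : C z -> C (- z) by rewrite -sub0r; exact: Csub.
have CD z w : C z -> C w -> C (z + w).
  by move=> Cz Cw; rewrite -[w]opprK; apply: Csub => //; exact: CN.
have CX z n : C z -> C (z ^+ n).
  by move=> Cz; elim: n => [|n IH]; rewrite ?expr0 // exprS; exact: Cmul.
have Csum (I : Type) (r : seq I) (E : I -> F) :
    (forall i, C (E i)) -> C (\sum_(i <- r) E i).
  by move=> CE; elim/big_ind: _.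
have Cb : C b by exact: BC.
have b0 : b != 0 by apply/eqP => b0; apply: nCb; rewrite b0 invr0.
have extend z : ~ C z -> exists2 g : {poly F}, (forall i, C g`_i) & g.[z] = b^-1.
  move=> nCz; apply: contrapT => nb.
  pose C' w := exists2 g : {poly F}, (forall i, C g`_i) & g.[z] = w.
  apply/nCz/(maxC C'); last 1 first.
  - by exists 'X; rewrite ?hornerX // => i; rewrite coefX; case: (i == 1%N).
  - split=> // [_ _ [g Cg <-] [e Ce <-]|_ _ [g Cg <-] [e Ce <-]].
      by exists (g - e); rewrite ?hornerD ?hornerN // => i; rewrite coefB; exact: Csub.
    by exists (g * e); rewrite ?hornerM // => i; rewrite coefM; apply: Csum => j; exact: Cmul.
  - by move=> w Cw; exists w%:P; rewrite ?hornerC // => i; rewrite coefC; case: (i == 0%N).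
(* If [v = 1 - b * c] were not invertible in [C], then [b^-1] would be a polynomial in [v^-1], so
   [v ^+ l / b] would be in [C] for some [l]. But [(1 - v ^+ l) / b] is in [C] as [b] divides
   [1 - v], and the sum is [b^-1]. *)
have unitC c : C c -> C (1 - b * c)^-1.
  move=> Cc; apply: contrapT => /extend[g Cg gE]; set v := 1 - b * c in gE.
  have Cv : C v by apply: Csub => //; exact: Cmul.
  have [v0|v0] := eqVneq v 0.
    apply: nCb; rewrite -gE v0 invr0 horner_coef0; exact: Cg.
  have [l szg] : exists l, (size g <= l.+1)%N by exists (size g).
  have Cs : C (v ^+ l / b).
    rewrite -gE (horner_coef_wide _ szg) mulr_sumr; apply: Csum => i.
    rewrite mulrCA exprVn; apply: Cmul => //; have il : (i <= l)%N by rewrite -ltnS.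
    rewrite (_ : v ^+ l = v ^+ (l - i) * v ^+ i); last by rewrite -exprD subnK.
    by rewrite mulfK ?expf_neq0 //; exact: CX.
  have Ct : C ((1 - v ^+ l) / b).
    have -> : (1 - v ^+ l) / b = c * \sum_(i < l) v ^+ i.
      have -> : 1 - v ^+ l = b * (c * \sum_(i < l) v ^+ i).
        by rewrite -[LHS]opprB subrX1 {1}/v; ring.
      by rewrite mulrC mulKf.
    by apply: Cmul => //; apply: Csum => i; exact: CX.
  by apply: nCb; have := CD _ _ Cs Ct; rewrite -mulrDl addrC subrK mul1r.
have no_pair N (z : F) (g g' : {poly F}) : (size g + size g' <= N)%N -> z != 0 ->
    (forall i, C g`_i) -> (forall i, C g'`_i) -> g.[z] = b^-1 -> g'.[z^-1] = b^-1 -> False.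
  elim: N z g g' => [|N IH] z g g' szN z0 Cg Cg' gE g'E.
    apply: nCb; rewrite -gE (_ : g = 0) ?horner0 //; apply/eqP; rewrite -size_poly_eq0; lia.
  wlog le_sz : z g g' szN z0 Cg Cg' gE g'E / (size g' <= size g)%N.
    move=> wl; case: (leqP (size g') (size g)) => [|/ltnW]; first exact: (wl z).
    by apply: (wl z^-1); rewrite ?invr_eq0 ?invrK 1?addnC.
  case: (leqP (size g) 1) => [sz1|sz2].
    by apply: nCb; rewrite -gE (size1_polyC sz1) hornerC.
  (* The relation for [g'] says that the terms of positive degree in [z^-1] sum to
     [(1 - b * g'_0) / b]. Dividing by this and multiplying by [z ^+ n] expresses [z ^+ n] through
     lower powers of [z], with the [v j] as coefficients; this lowers the degree of [g]. *)
  pose v j := b * g'`_j * (1 - b * g'`_0)^-1.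
  have Cv j : C (v j) by apply: (Cmul); [exact: Cmul|exact: unitC].
  have u0 : 1 - b * g'`_0 != 0.
    apply/eqP => /eqP; rewrite subr_eq0 => /eqP e1; apply: nCb.
    by rewrite -[b^-1]mulr1 e1 mulKf.
  pose n := (size g).-1; have szg : size g = n.+1 by rewrite prednK // ltnW.
  have zn : \sum_(i < n) v (n - i)%N * z ^+ i = z ^+ n.
    have E : \sum_(j < n) g'`_j.+1 * z^-1 ^+ j.+1 = b^-1 - g'`_0.
      have szg' : (size g' <= n.+1)%N by rewrite -szg.
      rewrite -g'E (horner_coef_wide _ szg') big_ord_recl /= expr0 mulr1.
      by rewrite addrC addKr.
    transitivity (z ^+ n * (b / (1 - b * g'`_0) * (b^-1 - g'`_0))); last first.
      by field; rewrite b0 u0.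
    rewrite -E !mulr_sumr (reindex_inj rev_ord_inj) /=; apply: eq_bigr => j _.
    have jn := ltn_ord j; rewrite subKn // exprVn.
    have -> : z ^+ n = z ^+ (n - j.+1) * z ^+ j.+1 by rewrite -exprD subnK.
    by rewrite /v; field; rewrite u0 expf_neq0.
  pose h := \poly_(i < n) (g`_i + g`_n * v (n - i)%N).
  apply: (IH z h g') => //.
  - have : (size h <= n)%N by exact: size_poly.
    by move: szN; rewrite szg; lia.
  - move=> i; rewrite coef_poly; case: ifP => // _.
    by apply: CD => //; exact: Cmul.
  - rewrite horner_poly -gE horner_coef szg big_ord_recr /= -zn mulr_sumr -big_split /=.
    by apply: eq_bigr => i _; ring.
have total z : C z \/ C z^-1.
  apply: contrapT => /not_orP[nz nz']; have z0 : z != 0.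
    by apply/eqP => z0; apply: nz; rewrite z0.
  have [g Cg gE] := extend _ nz; have [g' Cg' g'E] := extend _ nz'.
  exact: (no_pair (size g + size g')%N z g g').
have const c : C (iota c) by apply: BC.
exists (Place const Csub Cmul total (ex_intro (fun z => ~ C z) _ nCb)); split=> //.
by right.
Qed.

End Chevalley.

End Place.

(** * The function field *)

Section FunctionField.

Variables (K F : fieldType) (iota : {rmorphism K -> F}).
Variables (q : nat) (f : {poly K}) (x y : F).
Hypotheses (q_gt1 : (1 < q)%N).
Hypothesis hF : AS_function_field iota q f x y.

Definition evx : {poly K} -> F := horner_eval x \o map_poly iota.
HB.instance Definition _ := GRing.RMorphism.on evx.

(** Here [y] is the outer variable, which makes division by the equation of [y] available. In
    [AS_function_field] the outer variable is [x]; [affine_coords] passes from that convention to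
    this one. *)
Definition evxy : {poly {poly K}} -> F := horner_eval y \o map_poly evx.
HB.instance Definition _ := GRing.RMorphism.on evxy.

Lemma evxE g : evx g = (map_poly iota g).[x]. Proof. by []. Qed.
Lemma evxyE R : evxy R = (map_poly evx R).[y]. Proof. by []. Qed.

Lemma evxX : evx 'X = x. Proof. by rewrite evxE map_polyX hornerX. Qed.
Lemma evxC c : evx c%:P = iota c. Proof. by rewrite evxE map_polyC hornerC. Qed.
Lemma evxyC g : evxy g%:P = evx g. Proof. by rewrite evxyE map_polyC hornerC. Qed.
Lemma evxyX : evxy 'X = y. Proof. by rewrite evxyE map_polyX hornerX. Qed.

Lemma evx_eq0 g : (evx g == 0) = (g == 0).
Proof.
case: hF => x_tr _ _; apply/eqP/eqP => [|->]; last exact: rmorph0.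
exact: x_tr.
Qed.

Lemma y_eq : y ^+ q = y + evx f.
Proof. by case: hF => _ yE _; rewrite evxE -yE addrC subrK. Qed.

Definition affine (z : F) : Prop := exists R, z = evxy R.

Lemma affine_evx g : affine (evx g). Proof. by exists g%:P; rewrite evxyC. Qed.
Lemma affine_y : affine y. Proof. by exists 'X; rewrite evxyX. Qed.
Lemma affineD z w : affine z -> affine w -> affine (z + w).
Proof. by move=> [R ->] [S ->]; exists (R + S); rewrite rmorphD. Qed.
Lemma affineB z w : affine z -> affine w -> affine (z - w).
Proof. by move=> [R ->] [S ->]; exists (R - S); rewrite rmorphB. Qed.
Lemma affineM z w : affine z -> affine w -> affine (z * w).
Proof. by move=> [R ->] [S ->]; exists (R * S); rewrite rmorphM. Qed.
Lemma affineX z n : affine z -> affine (z ^+ n).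
Proof. by move=> [R ->]; exists (R ^+ n); rewrite rmorphXn. Qed.
Lemma affine1 : affine 1. Proof. by exists 1; rewrite rmorph1. Qed.
Lemma affine0 : affine 0. Proof. by exists 0; rewrite rmorph0. Qed.
Lemma affine_const c : affine (iota c). Proof. by rewrite -evxC; exact: affine_evx. Qed.

Lemma affine_ind (Q : F -> Prop) : (forall g, Q (evx g)) -> Q y ->
  (forall z w, Q z -> Q w -> Q (z + w)) -> (forall z w, Q z -> Q w -> Q (z * w)) ->
  forall z, affine z -> Q z.
Proof.
move=> Qx Qy QD QM z [R ->]; elim/poly_ind: R => [|R g IH].
  by rewrite rmorph0 -(rmorph0 evx).
by rewrite rmorphD rmorphM /= evxyX evxyC; apply: QD => //; exact: QM.
Qed.

Lemma affine_horner (p : {poly {poly K}}) z : affine z -> affine (map_poly evx p).[z].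
Proof.
move=> Az; elim/poly_ind: p => [|p g IH]; first by rewrite map_poly0 horner0; exact: affine0.
rewrite rmorphD rmorphM /= map_polyX map_polyC hornerD hornerM hornerX hornerC.
by apply: affineD; [exact: affineM|exact: affine_evx].
Qed.

Lemma affine_reduced z : affine z -> exists2 R : {poly {poly K}}, (size R <= q)%N & z = evxy R.
Proof.
move=> [R ->]; pose P : {poly {poly K}} := 'X^q - ('X + f%:P).
have szXf : (size ('X + f%:P : {poly {poly K}})%R < q.+1)%N.
  rewrite (leq_ltn_trans (size_polyD _ _)) // size_polyX gtn_max ltnS q_gt1 ltnS.
  by rewrite (leq_trans (size_polyC_leq1 _)) // ltnW.
have P_monic : P \is monic.
  by rewrite monicE lead_coefDl ?size_polyXn ?size_polyN // lead_coefXn.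
have szP : size P = q.+1 by rewrite size_polyDl ?size_polyXn ?size_polyN.
have P0 : evxy P = 0.
  by rewrite rmorphB rmorphXn rmorphD /= !evxyX evxyC y_eq subrr.
exists (Pdiv.Ring.rmodp R P).
  by rewrite -ltnS -szP Pdiv.Ring.ltn_rmodpN0 // monic_neq0.
by rewrite {1}(Pdiv.RingMonic.rdivp_eq P_monic R) rmorphD rmorphM /= P0 mulr0 add0r.
Qed.

(** [z] is integral over K[x]. After cancelling powers of [z], its equation has a nonzero constant
    term [g], which is a multiple of [z] in K[x, y]. *)
Lemma affine_inv z : affine z -> z != 0 ->
  exists w g, [/\ affine w, g != 0 & z^-1 = w / evx g].
Proof.
move=> Az z0; have [p p_monic pz] : integralOver evx z.
  case: Az => R ->; rewrite evxyE; apply: integral_horner => [_ /(nthP 0)[i _ <-]|].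
    by rewrite coef_map; exact: integral_id.
  exists ('X^q - ('X + f%:P)).
    rewrite monicE lead_coefDl ?lead_coefXn // size_polyN size_polyXn ltnS.
    rewrite (leq_trans (size_polyD _ _)) // geq_max size_polyX q_gt1.
    by rewrite (leq_trans (size_polyC_leq1 _)) // ltnW.
  rewrite rootE rmorphB rmorphD /= map_polyXn map_polyX map_polyC.
  by rewrite hornerD hornerN hornerD hornerXn hornerX hornerC y_eq subrr.
have p0 := monic_neq0 p_monic.
elim/poly_ind: p p0 pz {p_monic} => [|p g IH]; first by rewrite eqxx.
move=> pXg; rewrite rootE rmorphD rmorphM /= map_polyX map_polyC.
rewrite hornerD hornerM hornerX hornerC /=.
have [g0|g0] := eqVneq g 0.
  rewrite g0 raddf0 addr0 mulf_eq0 (negPf z0) orbF => pz; apply: IH => //.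
  by apply: contraNneq pXg => ->; rewrite g0 mul0r add0r.
move=> pz; exists (- (map_poly evx p).[z]), g; split=> //.
  by rewrite -sub0r; apply: affineB; [exact: affine0|exact: affine_horner].
have gz : evx g != 0 by rewrite evx_eq0.
apply: (mulIf gz); rewrite divfK //; apply: (mulfI z0).
move: pz; rewrite addr_eq0 => /eqP pz; rewrite mulrA divff // mul1r mulrN mulrC pz.
by rewrite opprK.
Qed.

Lemma affine_coords (u : {poly {poly K}}) :
  affine (map_poly (map_poly iota) u).[x%:P].[y].
Proof.
elim/poly_ind: u => [|u c IH]; first by rewrite map_poly0 !horner0; exact: affine0.
rewrite rmorphD rmorphM /= map_polyX map_polyC hornerD hornerM hornerX hornerC.
rewrite hornerD hornerM hornerC; apply: affineD.
  by apply: affineM => //; rewrite -evxX; exact: affine_evx.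
rewrite /=; elim/poly_ind: c => [|c t IHc]; first by rewrite map_poly0 horner0; exact: affine0.
rewrite rmorphD rmorphM /= map_polyX map_polyC hornerD hornerM hornerX hornerC.
by apply: affineD; [apply: affineM => //; exact: affine_y|exact: affine_const].
Qed.

Lemma fraction z : exists (R : {poly {poly K}}) (D : {poly K}),
  [/\ D != 0, (size R <= q)%N & z = evxy R / evx D].
Proof.
case: hF => _ _ gen; have [u [v [v0 ->]]] := gen z.
have [w [g [Aw g0 ->]]] := affine_inv (affine_coords v) v0.
have [R szR E] := affine_reduced (affineM (affine_coords u) Aw).
by exists R, g; split; rewrite // -E mulrA.
Qed.

End FunctionField.

(** * The place at infinity *)

Section Infinity.

Variables (K F : fieldType) (iota : {rmorphism K -> F}).
Variables (q m : nat) (f : {poly K}) (x y : F).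
Hypotheses (q_gt1 : (1 < q)%N) (m_gt0 : (0 < m)%N) (co_qm : coprime q m).
Hypotheses (szf : size f = m.+1) (hF : AS_function_field iota q f x y).

Local Notation evx := (evx iota x).
Local Notation evxy := (evxy iota x y).
Let evx0 := evx_eq0 hF.

Section AtInfinity.

Variable P : place iota.
Local Notation O := (local_ring P).
Local Notation M := (place_max P).
Hypothesis x_pole : ~ O x.

Let xV_max : M x^-1. Proof. exact: place_notin_max. Qed.
Let x0 : x != 0.
Proof. by apply/eqP => x0; apply: x_pole; rewrite x0; exact: place0. Qed.

Let unit z := O z /\ ~ M z.

Let unitM z w : unit z -> unit w -> unit (z * w).
Proof.
by move=> [Oz Uz] [Ow Uw]; split; [exact: place_mul|exact: place_unitM].
Qed.

Let unitV z : unit z -> unit z^-1.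
Proof.
move=> [Oz Uz]; split; first exact: place_unit_inv.
case=> [/eqP|]; rewrite ?invrK //.
by rewrite invr_eq0 (negPf (place_unit_neq0 Uz)).
Qed.

Let unitX z n : unit z -> unit (z ^+ n).
Proof. by move=> [Oz Uz]; split; [exact: placeX|exact: place_unitX]. Qed.

Let unit_const c : c != 0 -> unit (iota c).
Proof.
move=> c0; split; first exact: place_const.
case=> [/eqP|]; first by rewrite fmorph_eq0 (negPf c0).
by rewrite -fmorphV; apply; exact: place_const.
Qed.

Let unit_evx g : g != 0 -> unit (evx g / x ^+ (size g).-1).
Proof.
move=> g0; have sg : (0 < size g)%N by rewrite size_poly_gt0.
have -> : evx g / x ^+ (size g).-1 = iota (lead_coef g)
    + \sum_(i < (size g).-1) iota g`_i * x^-1 ^+ ((size g).-1 - i).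
  have szg : (size (map_poly iota g) <= (size g).-1.+1)%N by rewrite size_map_poly prednK.
  rewrite evxE (horner_coef_wide _ szg) big_ord_recr /= mulrDl.
  rewrite coef_map mulfK ?expf_neq0 // addrC; congr (_ + _).
  rewrite mulr_suml; apply: eq_bigr => i _; rewrite coef_map /= -mulrA exprVn.
  congr (_ * _); have il := ltnW (ltn_ord i).
  rewrite (_ : x ^+ (size g).-1 = x ^+ i * x ^+ ((size g).-1 - i)).
    by rewrite invfM mulVKf // expf_neq0.
  by rewrite -exprD subnKC.
have lg : lead_coef g != 0 by rewrite lead_coef_eq0.
have [Ol Ul] := unit_const lg.
have Msum : M (\sum_(i < (size g).-1) iota g`_i * x^-1 ^+ ((size g).-1 - i)).
  apply: place_max_sum => i _; apply: place_maxMl; first exact: place_const.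
  by rewrite -[(_ - _)%N]prednK ?subn_gt0 //; exact: place_max_expS.
by split; [apply: placeD => //; exact: place_max_local|exact: place_unit_add].
Qed.

(* As the pole order of x is prime to that of y, comparing q-th powers with powers
   of x replaces the value group. *)
Let weight z k := unit (z ^+ q / x ^+ k).

Let weightM z w k l : weight z k -> weight w l -> weight (z * w) (k + l).
Proof. by move=> Hz Hw; rewrite /weight exprMn exprD invfM mulrACA; exact: unitM. Qed.

Let weight_evx g : g != 0 -> weight (evx g) (q * (size g).-1).
Proof. by move=> g0; rewrite /weight mulnC exprM -exprVn -exprMn; exact/unitX/unit_evx. Qed.

(** [y] has a pole, since otherwise [f], and with it [x], would be regular. Then
    [y ^+ q * (1 - y^-1 ^+ q.-1)] equals [f], and the factor in parentheses is a unit. *)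
Let weight_y : weight y m.
Proof.
have f0 : f != 0 by rewrite -size_poly_eq0 szf.
have := unit_evx f0; rewrite szf /= => uf.
have y_pole : ~ O y.
  move=> Oy; apply: x_pole; apply: (place_root m_gt0).
  have Of : O (evx f).
    rewrite -[evx f](addKr y) -(y_eq hF) addrC.
    by apply: place_sub => //; exact: placeX.
  have xm0 : x ^+ m != 0 by rewrite expf_neq0.
  have -> : x ^+ m = evx f / (evx f / x ^+ m) by rewrite invf_div mulrC divfK ?evx0.
  by apply: place_mul => //; case: (unitV uf).
have y0 : y != 0 by apply/eqP => y0; apply: y_pole; rewrite y0; exact: place0.
have My := place_notin_max y_pole.
have uw : unit (1 - y^-1 ^+ q.-1).
  have Mq : M (y^-1 ^+ q.-1).
    by rewrite -(prednK (_ : 0 < q.-1)%N); [exact: place_max_expS|lia].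
  split; first by apply: place_sub; [exact: place1|exact: place_max_local].
  by apply: place_unit_add; [exact: place_max1|exact: place_maxN].
have -> : weight y m = unit (evx f / x ^+ m / (1 - y^-1 ^+ q.-1)).
  congr unit; rewrite mulrAC; congr (_ / _).
  rewrite -[evx f](addKr y) -(y_eq hF); apply/esym.
  have -> : - y + y ^+ q = y ^+ q * (1 - y^-1 ^+ q.-1).
    rewrite mulrBr mulr1 addrC exprVn; congr (_ - _).
    have yq : y ^+ q = y * y ^+ q.-1 by rewrite -exprS prednK // ltnW.
    by rewrite yq mulfK // expf_neq0.
  by rewrite mulfK //; case: uw => _ /place_unit_neq0.
by apply: unitM => //; exact: unitV.
Qed.

Let weight_yX j : weight (y ^+ j) (j * m).
Proof.
elim: j => [|j IH]; last by rewrite exprS mulSn; exact: weightM.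
rewrite /weight expr0 expr1n mul0n expr0 divr1.
by split; [exact: place1|exact: place_max1].
Qed.

Let weight_neq0 z k : weight z k -> z != 0.
Proof.
case=> _ /place_unit_neq0; rewrite mulf_eq0 expf_eq0 => /norP[+ _].
by rewrite (ltnW q_gt1).
Qed.

Let weight_div a b i j : weight a i -> weight b j -> (i <= j)%N ->
  exists2 u, unit u & (a / b) ^+ q = u * x^-1 ^+ (j - i).
Proof.
move=> Ha Hb ij; exists (a ^+ q / x ^+ i / (b ^+ q / x ^+ j)).
  by apply: unitM => //; exact: unitV.
have b0 := weight_neq0 Hb.
have -> : x ^+ j = x ^+ i * x ^+ (j - i) by rewrite -exprD subnKC.
by rewrite expr_div_n exprVn; field; rewrite !expf_neq0.
Qed.

Let weight_le a b i j : weight a i -> weight b j -> (i <= j)%N -> O (a / b).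
Proof.
move=> Ha Hb ij; have [u [Ou _] E] := weight_div Ha Hb ij.
apply: (place_root (ltnW q_gt1)); rewrite E.
by apply: place_mul => //; apply: placeX; exact: place_max_local.
Qed.

Let weight_lt a b i j : weight a i -> weight b j -> (i < j)%N -> M (a / b).
Proof.
move=> Ha Hb ij; have [u [Ou _] E] := weight_div Ha Hb (ltnW ij).
apply: (@place_maxX _ _ _ _ _ q); rewrite E; apply: place_maxMl => //.
by rewrite -[(j - i)%N]prednK ?subn_gt0 //; exact: place_max_expS.
Qed.

Let weight_term (R : {poly {poly K}}) j : R`_j != 0 ->
  weight (evx R`_j * y ^+ j) (q * (size (R`_j)%R).-1 + j * m).
Proof. by move=> Rj; apply: weightM => //; exact: weight_evx. Qed.

Let evxy_sum (R : {poly {poly K}}) : (size R <= q)%N ->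
  evxy R = \sum_(j < q) evx R`_j * y ^+ j.
Proof.
move=> szR; rewrite evxyE (@horner_coef_wide _ q); last first.
  exact: leq_trans (size_poly _ _) szR.
by apply: eq_bigr => j _; rewrite coef_map.
Qed.

Lemma infinity_memP (R : {poly {poly K}}) (D : {poly K}) : (size R <= q)%N ->
  D != 0 ->
  (forall j : 'I_q, R`_j != 0 -> (q * (size (R`_j)%R).-1 + j * m <= q * (size D).-1)%N) ->
  O (evxy R / evx D).
Proof.
move=> szR D0 H; rewrite evxy_sum // mulr_suml; apply: place_sum => j _.
have [->|Rj] := eqVneq (R`_j) 0; first by rewrite raddf0 !mul0r; exact: place0.
exact: weight_le (weight_term Rj) (weight_evx D0) (H j Rj).
Qed.

(** Modulo [q] the weight of a term in [y ^+ j] is [j * m], and [m] is prime to [q]. So the terms of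
    a polynomial of degree below [q] in [y] have distinct weights and cannot cancel at infinity. *)
Let weight_inj (i j a b : nat) : (i < q)%N -> (j < q)%N ->
  (q * a + i * m = q * b + j * m)%N -> i = j.
Proof.
wlog ij : i j a b / (i <= j)%N.
  move=> wl iq jq e; case: (leqP i j) => [|/ltnW] ij; first exact: (wl i j a b).
  by apply/esym; apply: (wl j i b a).
move=> iq jq e; have : (q %| (j - i) * m)%N.
  apply/dvdnP; exists (a - b)%N; rewrite mulnBl mulnBl [(a * q)%N]mulnC [(b * q)%N]mulnC.
  have: (i * m <= j * m)%N by rewrite leq_mul2r ij orbT.
  lia.
rewrite Gauss_dvdl //; case: (posnP (j - i)) => [|ji]; first by lia.
by move/(dvdn_leq ji); lia.
Qed.

Lemma dominant_term (R : {poly {poly K}}) : (size R <= q)%N -> R != 0 ->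
  exists J : 'I_q, [/\ R`_J != 0, unit (evxy R / (evx R`_J * y ^+ J))
    & forall j : 'I_q, R`_j != 0 ->
        (q * (size (R`_j)%R).-1 + j * m <= q * (size (R`_J)%R).-1 + J * m)%N].
Proof.
move=> szR R0; have sR : (0 < size R)%N by rewrite size_poly_gt0.
have j0q : ((size R).-1 < q)%N by rewrite prednK.
have Rj0 : R`_(Ordinal j0q) != 0 by rewrite -lead_coefE lead_coef_eq0.
pose wt (j : 'I_q) := (q * (size (R`_j)%R).-1 + j * m)%N.
case: (@arg_maxnP _ (Ordinal j0q) (fun j : 'I_q => R`_j != 0) wt Rj0) => J RJ maxJ.
exists J; split=> //; rewrite evxy_sum // mulr_suml (bigD1 J) //=.
have WJ := weight_term RJ; rewrite divff ?(weight_neq0 WJ) //.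
set S := \sum_(j < q | _) _.
have MS : M S.
  apply: place_max_sum => j jJ.
  have [->|Rj] := eqVneq (R`_j) 0; first by rewrite raddf0 !mul0r; left.
  apply: (weight_lt (weight_term Rj) WJ); rewrite ltn_neqAle (maxJ j Rj : (wt j <= wt J)%N) andbT.
  apply: contraNneq jJ => /(weight_inj (ltn_ord j) (ltn_ord J)) e.
  by apply/eqP/val_inj.
split; first by apply: placeD; [exact: place1|exact: place_max_local].
by apply: place_unit_add => //; exact: place_max1.
Qed.

(** The quotient has the size of its dominant term. Were that weight above the weight of [D], the
    inverse of the quotient would be in the maximal ideal, and so would 1. *)
Lemma infinity_mem_weight (R : {poly {poly K}}) (D : {poly K}) : (size R <= q)%N ->
  D != 0 -> O (evxy R / evx D) -> forall j : 'I_q, R`_j != 0 ->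
  (q * (size (R`_j)%R).-1 + j * m <= q * (size D).-1)%N.
Proof.
move=> szR D0 OR j Rj; have R0 : R != 0 by apply: contraNneq Rj => ->; rewrite coef0.
have [J [RJ uJ maxJ]] := dominant_term szR R0.
apply: leq_trans (maxJ j Rj) _; rewrite leqNgt; apply/negP => lt.
have WJ := weight_term RJ; have wJ0 := weight_neq0 WJ.
have MJ := weight_lt (weight_evx D0) WJ lt.
have OJ : O (evx R`_J * y ^+ J / evx D).
  have [OV _] := unitV uJ; have [_ /place_unit_neq0 U0] := uJ.
  have R1 : evxy R != 0 by apply: contraNneq U0 => ->; rewrite mul0r.
  have -> : evx R`_J * y ^+ J / evx D =
      evxy R / evx D * (evxy R / (evx R`_J * y ^+ J))^-1.
    by rewrite invf_div; field; rewrite R1 evx0.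
  exact: place_mul.
apply: (@place_max1 _ _ _ P); have := place_maxMl OJ MJ.
by rewrite mulrA divfK ?evx0 // divff.
Qed.

End AtInfinity.

Lemma infinity_exists : exists P : place iota, ~ local_ring P x.
Proof.
pose B (z : F) := exists g : {poly K}, z = (map_poly iota g).[x^-1].
have x0 : x != 0.
  by rewrite -(evxX iota x) evx0 polyX_eq0.
have [||||nB|P [_ [/eqP|]]] := @place_exists K F iota B x^-1.
- by move=> c; exists c%:P; rewrite map_polyC hornerC.
- by move=> _ _ [g ->] [h ->]; exists (g - h); rewrite rmorphB hornerD hornerN.
- by move=> _ _ [g ->] [h ->]; exists (g * h); rewrite rmorphM hornerM.
- by exists 'X; rewrite map_polyX hornerX.
- case: nB => g; rewrite invrK horner_coef size_map_poly => xE.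
  (* If [x] were a polynomial in [x^-1], clearing denominators would give the nonzero equation [h]
     for [x]. So [x^-1] is a non-unit of K[x^-1], and some place has it in its ideal. *)
  pose n := size g; pose h : {poly K} := 'X^(n.+1) - \sum_(i < n) g`_i *: 'X^(n - i).
  have h0 : h != 0.
    rewrite -size_poly_eq0 size_polyDl size_polyXn // size_polyN ltnS.
    apply: (leq_trans (size_sum _ _ _)); apply/bigmax_leqP => i _.
    by rewrite (leq_trans (size_scale_leq _ _)) // size_polyXn ltnS leq_subr.
  move: h0; rewrite -evx0 /h rmorphB rmorphXn raddf_sum /= evxX exprSr {2}xE mulr_sumr.
  rewrite -sumrB big1 ?eqxx // => i _.
  rewrite coef_map /= evxE map_polyZ map_polyXn hornerZ hornerXn mulrCA; apply/eqP.
  rewrite subr_eq0; apply/eqP; congr (_ * _); have il := ltnW (ltn_ord i).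
  rewrite (_ : x ^+ n = x ^+ (n - i) * x ^+ i); last by rewrite -exprD subnK.
  by rewrite exprVn mulfK // expf_neq0.
- by rewrite invr_eq0 (negPf x0).
- by move=> nO; exists P; rewrite -[x]invrK.
Qed.

(** The criterion for membership given by [infinity_memP] and [infinity_mem_weight] does not mention
    the place. *)
Lemma infinity_unique (P Q : place iota) :
  ~ local_ring P x -> ~ local_ring Q x -> P = Q.
Proof.
have sub (P' Q' : place iota) : ~ local_ring P' x -> ~ local_ring Q' x ->
    forall z, local_ring P' z -> local_ring Q' z.
  move=> hP hQ z; have [R [D [D0 szR ->]]] := fraction q_gt1 hF z.
  move=> OP; apply: (infinity_memP hQ szR D0).
  exact: (infinity_mem_weight hP szR D0 OP).
by move=> hP hQ; apply: place_ext => z; split; exact: sub.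
Qed.

End Infinity.

(** * Finite places *)

Section FinitePlaces.

Variables (K : finFieldType) (F : fieldType) (iota : {rmorphism K -> F}).
Variables (q N : nat) (f : {poly K}) (x y : F).
Hypotheses (q_pchar : [pchar K].-nat q) (q_gt1 : (1 < q)%N) (N_gt0 : (0 < N)%N).
Hypotheses (cardK : #|K| = (q ^ N)%N) (hF : AS_function_field iota q f x y).

Local Notation evx := (evx iota x).
Local Notation evxy := (evxy iota x y).
Local Notation affine := (affine iota x y).
Let evx0 := evx_eq0 hF.

Let card_pchar i : [pchar K].-nat (#|K| ^ i)%N.
Proof. by rewrite cardK -expnM q_pchar_exp. Qed.

Let poly_pchar i : [pchar {poly K}].-nat (#|K| ^ i)%N.
Proof. by rewrite (eq_pnat _ (@pchar_poly K)). Qed.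

Let F_pchar n : [pchar K].-nat n -> [pchar F].-nat n.
Proof. by rewrite (eq_pnat _ (fmorph_pchar iota)). Qed.

Let card_gt1 : (1 < #|K|)%N.
Proof. by rewrite cardK -(exp1n N) ltn_exp2r. Qed.

(** The product of all monic irreducible polynomials over [K] of degree dividing [s], for positive
    [s]. Being separable, it serves as a uniformizer at every place above one of its roots. *)
Definition frob_poly (s : nat) : {poly K} := 'X^(#|K| ^ s) - 'X.

Lemma frob_poly_neq0 s : (0 < s)%N -> frob_poly s != 0.
Proof.
move=> s0; have W1 : (1 < #|K| ^ s)%N by rewrite -(expn0 #|K|) ltn_exp2l.
by rewrite -size_poly_eq0 size_polyDl ?size_polyXn // size_polyN size_polyX ltnS.
Qed.

(** Two of the powers ['X^(#|K| ^ i)] agree modulo [D] by the pigeonhole principle, and their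
    difference is a Frobenius power of some [frob_poly]. *)
Lemma dvdp_frob_poly (D : {poly K}) : D != 0 ->
  exists s t, (0 < s)%N /\ D %| frob_poly s ^+ (#|K| ^ t).
Proof.
move=> D0; pose T := {ffun 'I_(size D) -> K}.
pose r i : {poly K} := 'X^(#|K| ^ i) %% D.
pose c (i : 'I_(#|T|.+1)) : T := [ffun k : 'I_(size D) => (r i)`_k].
have [i [j [ij cij]]] : exists i j, i != j /\ c i = c j.
  apply: contrapT => H; have /leq_card : injective c.
    by move=> i j cij; apply/eqP/negPn/negP => ij; apply: H; exists i, j.
  by rewrite card_ord ltnn.
wlog lt_ij : i j ij cij / (i < j)%N.
  move=> wl; move: (ij); rewrite neq_ltn => /orP[lt|lt]; first exact: (wl i j).
  by apply: (wl j i) => //; rewrite eq_sym.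
exists (j - i)%N, i; rewrite subn_gt0; split=> //.
rewrite /frob_poly exprB_pchar // -exprM -expnD subnK ?(ltnW lt_ij) //.
have rE : r i = r j.
  apply/polyP => k; case: (ltnP k (size D)) => kD.
    by have /ffunP/(_ (Ordinal kD)) := cij; rewrite !ffunE.
  by rewrite !nth_default ?(leq_trans _ kD) // ltnW // ltn_modp.
have -> : 'X^(#|K| ^ j) - 'X^(#|K| ^ i) =
    ('X^(#|K| ^ j) %/ D - 'X^(#|K| ^ i) %/ D) * D :> {poly K}.
  rewrite {1}(divp_eq 'X^(#|K| ^ j) D) {1}(divp_eq 'X^(#|K| ^ i) D).
  by rewrite -/(r i) -/(r j) rE mulrBl opprD addrACA subrr addr0.
exact: dvdp_mulIr.
Qed.

Section Congruence.

Variable s : nat.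
Hypothesis s_gt0 : (0 < s)%N.
Let W := (#|K| ^ s)%N.
Let pi := evx (frob_poly s).

Let cong (z w : F) := exists2 b, affine b & z - w = pi * b.

Let congxx z : cong z z.
Proof. by exists 0; [exact: affine0|rewrite subrr mulr0]. Qed.

Let cong_trans z w t : cong z w -> cong w t -> cong z t.
Proof.
move=> [b Ab E] [c Ac E']; exists (b + c); first exact: affineD.
by rewrite mulrDr -E -E' addrA subrK.
Qed.

Let congD z w z' w' : cong z w -> cong z' w' -> cong (z + z') (w + w').
Proof.
move=> [b Ab E] [c Ac E']; exists (b + c); first exact: affineD.
by rewrite mulrDr -E -E' opprD addrACA.
Qed.

Let congM z w z' w' : affine z' -> affine w ->
  cong z w -> cong z' w' -> cong (z * z') (w * w').
Proof.
move=> Az' Aw [b Ab E] [c Ac E']; exists (b * z' + w * c).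
  by apply: affineD; exact: affineM.
by rewrite mulrDr mulrA -E mulrCA -E'; ring.
Qed.

Let W_pchar : [pchar F].-nat W. Proof. exact/F_pchar/card_pchar. Qed.
Let W_gt0 : (0 < W)%N. Proof. by rewrite expn_gt0 (ltnW card_gt1). Qed.

Let affine_pi : affine pi. Proof. exact: affine_evx. Qed.

Let congW z w : cong z w -> cong (z ^+ W) (w ^+ W).
Proof.
move=> [b Ab E]; exists (pi ^+ W.-1 * b ^+ W).
  by apply: affineM; exact: affineX.
by rewrite -exprB_pchar // E exprMn mulrA -exprS prednK.
Qed.

Let cong_evx g : cong (evx g ^+ W) (evx g).
Proof.
suff /dvdpP[h hE] : frob_poly s %| g ^+ W - g.
  by exists (evx h); [exact: affine_evx|rewrite -rmorphXn -rmorphB hE rmorphM mulrC].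
elim/poly_ind: g => [|g c IH].
  by rewrite expr0n gtn_eqF // subr0 dvdp0.
rewrite exprDn_pchar ?poly_pchar // exprMn.
have -> : (c%:P : {poly K}) ^+ W = c%:P.
  rewrite -rmorphXn /W /=; congr _%:P; elim: s => [|i IHi]; first by rewrite expn0 expr1.
  by rewrite expnS exprM expf_card.
have -> : g ^+ W * 'X^W + c%:P - (g * 'X + c%:P) =
    (g ^+ W - g) * 'X^W + g * frob_poly s by rewrite /frob_poly; ring.
by rewrite dvdp_add ?dvdp_mulIr // dvdp_mulr.
Qed.

Let y_frob i : exists tau, y ^+ (q ^ i) = y + evx tau.
Proof.
elim: i => [|i [tau E]]; first by exists 0; rewrite expn0 expr1 raddf0 addr0.
exists (f + tau ^+ q); rewrite expnSr exprM E exprDn_pchar ?F_pchar //.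
by rewrite (y_eq hF) -rmorphXn -addrA -rmorphD.
Qed.

Let q_eq0 : q%:R = 0 :> K.
Proof.
have : pdiv q \in [pchar K].
  case/andP: q_pchar => _ /allP; apply.
  by rewrite mem_primes pdiv_prime // pdiv_dvd ltnW.
by case/andP => _ /eqP p0; have /dvdnP[e ->] := pdiv_dvd q; rewrite natrM p0 mulr0.
Qed.

(* The residue fields are finite, and affine / pi is reduced because x ^+ W - x
   is separable and the covering is unramified over the affine line. *)
Lemma frob_affine : exists2 W', (1 < W')%N &
  forall a, affine a -> exists2 b, affine b & a ^+ W' - a = pi * b.
Proof.
have W_gt1 : (1 < W)%N by rewrite -(expn0 #|K|) ltn_exp2l.
(* The [W]-th power fixes K[x] modulo [pi] and sends [y] to [y + tau] for some [tau] in K[x]. Its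
   [q]-fold iterate sends [y] to [y + q tau], which is [y] in characteristic [p]. *)
exists (W ^ q)%N; first by rewrite -(exp1n q) ltn_exp2r // ltnW.
have iterW i z : z ^+ (W ^ i.+1) = (z ^+ (W ^ i)) ^+ W by rewrite expnSr exprM.
suff H a : affine a -> affine a /\ cong (a ^+ (W ^ q)) a by move=> a /H[].
have Wq_pchar : [pchar F].-nat (W ^ q)%N by rewrite pnatX W_pchar.
move: a; apply: affine_ind => [g||z w [Az cz] [Aw cw]|z w [Az cz] [Aw cw]].
- split; first exact: affine_evx.
  elim: q => [|i IH]; first by rewrite expn0 expr1; exact: congxx.
  by rewrite iterW; apply: cong_trans (congW IH) _; exact: cong_evx.
- split; first exact: affine_y.
  have [tau] := y_frob (N * s); rewrite expnM -cardK -/W => yW.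
  suff H i : cong (y ^+ (W ^ i)) (y + evx (tau *+ i)).
    by have := H q; rewrite -mulr_natr -polyC_natr q_eq0 mulr0 raddf0 addr0.
  elim: i => [|i IH]; first by rewrite expn0 expr1 mulr0n raddf0 addr0; exact: congxx.
  rewrite iterW; apply: cong_trans (congW IH) _; rewrite exprDn_pchar // yW.
  rewrite mulrS rmorphD addrA; apply: congD; [exact: congxx|exact: cong_evx].
- by split; [exact: affineD|rewrite exprDn_pchar //; exact: congD].
- by split; [exact: affineM|rewrite exprMn; apply: congM => //; exact: affineX].
Qed.

End Congruence.

Section AtFinite.

Variable P : place iota.
Local Notation O := (local_ring P).
Local Notation M := (place_max P).
Hypothesis Ox : O x.

Let O_evx g : O (evx g).
Proof.
elim/poly_ind: g => [|g c IH]; first by rewrite raddf0; exact: place0.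
rewrite rmorphD rmorphM /= evxX evxC; apply: placeD; last exact: place_const.
exact: place_mul.
Qed.
#[local] Hint Resolve O_evx : core.

Let Oy : O y.
Proof.
apply: contrapT => y_pole; have My := place_notin_max y_pole.
have y0 : y != 0 by apply/eqP => y0; apply: y_pole; rewrite y0; exact: place0.
have Mq n : (0 < n)%N -> M (y^-1 ^+ n) by case: n => // n _; exact: place_max_expS.
apply: (@place_max1 _ _ _ P).
have -> : 1 = evx f * y^-1 ^+ q + y^-1 ^+ q.-1.
  have yq : y ^+ q = y * y ^+ q.-1 by rewrite -exprS prednK // ltnW.
  have -> : y^-1 ^+ q.-1 = y * y^-1 ^+ q by rewrite !exprVn yq invfM mulVKf.
  by rewrite -mulrDl addrC -(y_eq hF) exprVn divff // expf_neq0.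
have q1 : (0 < q.-1)%N by rewrite -ltnS prednK // ltnW.
by apply: place_maxD; [apply: place_maxMl => //; exact/Mq/ltnW|exact: Mq].
Qed.

Lemma affine_local z : affine z -> O z.
Proof.
by apply: affine_ind => //; [exact: placeD|exact: place_mul].
Qed.

(** As the local ring is not all of [F], the denominator in K[x] of some function lies in the
    maximal ideal, and it divides a power of some [frob_poly]. *)
Lemma frob_poly_max : exists2 s, (0 < s)%N & M (evx (frob_poly s)).
Proof.
have [D D0 MD] : exists2 D, D != 0 & M (evx D).
  apply: contrapT => H; have [z nOz] := place_proper P; apply: nOz.
  have [R [D [D0 _ ->]]] := fraction q_gt1 hF z.
  apply: place_mul; first by apply: affine_local; exists R.
  by apply: place_unit_inv => MD; apply: H; exists D.
have [s [t [s0 /dvdpP[h hE]]]] := dvdp_frob_poly D0; exists s => //.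
apply: (@place_maxX _ _ _ _ _ (#|K| ^ t)); rewrite -rmorphXn hE rmorphM /=.
by apply: place_maxMl.
Qed.

Variable s : nat.
Hypotheses (s_gt0 : (0 < s)%N) (Mpi : M (evx (frob_poly s))).
Let pi := evx (frob_poly s).

Let pi0 : pi != 0. Proof. by rewrite evx0 frob_poly_neq0. Qed.

(** From [a ^+ W' - a = pi * b] one gets [a * (1 - a ^+ W'.-1) = - pi * b], and [1 - a ^+ W'.-1] is
    a unit when [a] is in the maximal ideal. *)
Lemma uniformizer a : affine a -> M a -> exists e a',
  [/\ affine e, affine a', ~ M e & a * e = pi * a'].
Proof.
move=> Aa Ma; have [W' W1 H] := frob_affine s_gt0; have [b Ab E] := H a Aa.
exists (1 - a ^+ W'.-1), (- b); split.
- by apply: affineB; [exact: affine1|exact: affineX].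
- by rewrite -sub0r; apply: affineB => //; exact: affine0.
- have Me : M (a ^+ W'.-1).
    by rewrite -(@prednK W'.-1); [exact: place_max_expS|lia].
  by apply: place_unit_add; [exact: place_max1|exact: place_maxN].
by rewrite mulrN -E mulrBr mulr1 -exprS prednK ?opprB // ltnW.
Qed.

Lemma residue_order a : affine a -> ~ M a ->
  exists2 n, (0 < n)%N & M (a ^+ n - 1).
Proof.
move=> Aa Ua; have [W' W1 H] := frob_affine s_gt0; have [b Ab E] := H a Aa.
exists W'.-1; first by lia.
have : M (a * (a ^+ W'.-1 - 1)).
  rewrite mulrBr mulr1 -exprS prednK; last exact: ltnW.
  by rewrite E; apply: place_maxMr => //; exact: affine_local.
by case/place_max_prime.
Qed.

(** A denominator [D] in the maximal ideal shares with [frob_poly s] a gcd which, by Bezout, lies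
    there too. One power of [pi] pays for that factor, and the degree of [D] drops. *)
Lemma denominator_bound D : D != 0 -> exists n, O (pi ^+ n / evx D).
Proof.
have [l] := ubnP (size D); elim: l D => // l IH D szD D0.
have [MD|UD] := pselect (M (evx D)); last first.
  by exists 0%N; rewrite expr0 mul1r; exact: place_unit_inv.
pose G := gcdp D (frob_poly s).
have MG : M (evx G).
  have [[u v] /= uv] := Bezoutp D (frob_poly s).
  have /dvdpP[w wE] : u * D + v * frob_poly s %| G by rewrite (eqp_dvdl _ uv).
  rewrite wE rmorphM /=; apply: place_maxMl => //; rewrite rmorphD !rmorphM /=.
  by apply: place_maxD; apply: place_maxMl.
have G0 : G != 0 by rewrite gcdp_eq0 (negPf D0).
have szG : (1 < size G)%N.
  rewrite ltnNge; apply/negP => /size1_polyC GE; apply: (@place_max1 _ _ _ P).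
  have c0 : G`_0 != 0 by apply: contraNneq G0 => c0; rewrite GE c0.
  have -> : 1 = iota (G`_0)^-1 * evx G by rewrite GE evxC coefC -rmorphM mulVf ?rmorph1.
  by apply: place_maxMl => //; exact: place_const.
have /dvdpP[D1 D1E] : G %| D := dvdp_gcdl _ _.
have /dvdpP[p1 p1E] : G %| frob_poly s := dvdp_gcdr _ _.
have D10 : D1 != 0 by apply: contraNneq D0 => e; rewrite D1E e mul0r.
have [|n On] := IH D1 _ D10.
  have szE : size D = (size D1 + size G).-1 by rewrite {1}D1E size_mul.
  by move: szD szG; rewrite szE; move: (size D1) (size G) => d g; lia.
exists n.+1; have -> : pi ^+ n.+1 / evx D = pi ^+ n / evx D1 * evx p1.
  rewrite exprSr {2}/pi D1E p1E !rmorphM /=.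
  by field; rewrite !evx0 ?D10 ?G0.
exact: place_mul.
Qed.

Lemma pole_bound t z : affine t -> M t ->
  exists n, forall n', (n <= n')%N -> O (t ^+ n' * z).
Proof.
move=> At Mt; have [R [D [D0 _ ->]]] := fraction q_gt1 hF z.
have [n On] := denominator_bound D0; exists n => n' /subnK <-.
have [e [t' [Ae At' Ue E]]] := uniformizer At Mt.
rewrite exprD -mulrA; apply: place_mul; first exact/placeX/affine_local.
have e0 := place_unit_neq0 Ue.
have -> : t ^+ n * (evxy R / evx D) = (t' / e) ^+ n * (pi ^+ n / evx D) * evxy R.
  have -> : t = pi * (t' / e) by rewrite mulrA -E mulfK.
  by rewrite exprMn; ring.
apply: place_mul; last by apply: affine_local; exists R.
apply: place_mul => //; apply: placeX; apply: place_mul; first exact: affine_local.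
exact: place_unit_inv.
Qed.

(** The exponent [i] is the valuation of [a]: [pi] is divided out as long as the quotient is in the
    maximal ideal, and [denominator_bound] makes this stop. *)
Lemma uniformizer_power a : affine a -> a != 0 -> exists i e a',
  [/\ affine e, affine a', ~ M e, ~ M a' & e * a = pi ^+ i * a'].
Proof.
move=> Aa a0; have [w [g [Aw g0 aV]]] := affine_inv q_gt1 hF Aa a0.
have [n On] : exists n, O (pi ^+ n / a).
  have [n On] := denominator_bound g0; exists n; rewrite aV mulrCA.
  by apply: place_mul => //; exact: affine_local.
elim: n a Aa a0 On {w g Aw g0 aV} => [|n IH] a Aa a0 On.
  exists 0%N, 1, a; rewrite expr0; split=> //; [exact: affine1|exact: place_max1|].
  by case=> [/eqP|]; [rewrite (negPf a0)|rewrite expr0 mul1r in On].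
have [Ma|Ua] := pselect (M a); last first.
  by exists 0%N, 1, a; rewrite expr0; split=> //; [exact: affine1|exact: place_max1].
have [e [a' [Ae Aa' Ue E]]] := uniformizer Aa Ma.
have e0 := place_unit_neq0 Ue.
have a'0 : a' != 0.
  by apply: contraTneq (mulf_neq0 a0 e0) => a'0; rewrite E a'0 mulr0 eqxx.
have [|i [e' [a'' [Ae' Aa'' Ue' Ua'' E']]]] := IH a' Aa' a'0.
  have -> : pi ^+ n / a' = pi ^+ n.+1 / a / e.
    by rewrite -mulrA -invfM E exprSr; field; rewrite a'0 pi0.
  by apply: place_mul => //; exact: place_unit_inv.
exists i.+1, (e' * e), a''; split=> //; [exact: affineM|exact: place_unitM|].
by rewrite -mulrA [e * a]mulrC E mulrCA E' mulrA -exprS.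
Qed.

End AtFinite.

(** The place [P'] is discrete with uniformizer [pi], so numerator and denominator of [z] are powers
    of [pi] times quotients of elements of K[x, y] outside the ideal. Regularity of [z] forces a
    nonnegative power, and such a product is regular at any place with the same centre. *)
Lemma place_of_center (P Q : place iota) : local_ring P x -> local_ring Q x ->
  (forall a, affine a -> (place_max P a <-> place_max Q a)) -> P = Q.
Proof.
have sub (P' Q' : place iota) : local_ring P' x -> local_ring Q' x ->
    (forall a, affine a -> (place_max P' a <-> place_max Q' a)) ->
    forall z, local_ring P' z -> local_ring Q' z.
  move=> Px Qx PQ z Pz; have [R [D [D0 _ zE]]] := fraction q_gt1 hF z.
  have [->|z0] := eqVneq z 0; first exact: place0.
  have AD : affine (evx D) by exact: affine_evx.
  have AR : affine (evxy R) by exists R.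
  have R0 : evxy R != 0 by apply: contraNneq z0 => R0; rewrite zE R0 mul0r.
  have D'0 : evx D != 0 by rewrite evx0.
  have [s s0 Ms] := frob_poly_max Px.
  have pi0 : evx (frob_poly s) != 0 by rewrite evx0 frob_poly_neq0.
  have unit_tr a : affine a -> ~ place_max P' a -> local_ring Q' a^-1.
    by move=> Aa Ua; apply: place_unit_inv => /(PQ a Aa).
  have [i [e [a [Ae Aa Ue Ua E]]]] := uniformizer_power Px s0 Ms AR R0.
  have [j [e' [a' [Ae' Aa' Ue' Ua' E']]]] := uniformizer_power Px s0 Ms AD D'0.
  have [e0 a0] := (place_unit_neq0 Ue, place_unit_neq0 Ua).
  have [e'0 a'0] := (place_unit_neq0 Ue', place_unit_neq0 Ua').
  have RE : evxy R = evx (frob_poly s) ^+ i * a / e by rewrite -E mulrC mulKf.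
  have DE : evx D = evx (frob_poly s) ^+ j * a' / e' by rewrite -E' mulrC mulKf.
  case: (leqP j i) => ij.
    have -> : z = evx (frob_poly s) ^+ (i - j) * a * e' * (a'^-1 * e^-1).
      rewrite zE RE DE -{1}(subnK ij) exprD.
      by field; rewrite e'0 e0 a'0 expf_neq0.
    apply: place_mul; last by apply: place_mul; exact: unit_tr.
    by apply: affine_local => //; do 2?apply: affineM => //; apply: affineX; exact: affine_evx.
  have : place_max P' (z * evx (frob_poly s) ^+ (j - i)).
    apply: place_maxMl => //; rewrite -[(j - i)%N]prednK ?subn_gt0 //.
    exact: place_max_expS.
  have -> : z * evx (frob_poly s) ^+ (j - i) = a * e' / (a' * e).
    rewrite zE RE DE -{1}(subnK (ltnW ij)) exprD.
    by field; rewrite e'0 e0 a'0 !expf_neq0.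
  move=> /place_max_prime[/(place_unitM Ua Ue') //|].
  case=> [/eqP|]; first by rewrite invr_eq0 mulf_eq0 (negPf a'0) (negPf e0).
  rewrite invrK; case; apply: place_mul; exact: affine_local.
move=> Px Qx PQ; apply: place_ext => z; split; apply: sub => // a Aa.
by split=> /(PQ a Aa).
Qed.

End FinitePlaces.

(** * Separation of finite places and finiteness of poles *)

Section Approximation.

Variables (K : finFieldType) (F : fieldType) (iota : {rmorphism K -> F}).
Variables (q N : nat) (f : {poly K}) (x y : F).
Hypotheses (q_pchar : [pchar K].-nat q) (q_gt1 : (1 < q)%N) (N_gt0 : (0 < N)%N).
Hypotheses (cardK : #|K| = (q ^ N)%N) (hF : AS_function_field iota q f x y).

Local Notation evx := (evx iota x).
Local Notation evxy := (evxy iota x y).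
Local Notation affine := (affine iota x y).
Local Notation fplace P := (local_ring P x).
Let evx0 := evx_eq0 hF.

Let aff_loc (P : place iota) (Px : fplace P) z : affine z -> local_ring P z.
Proof. exact: (affine_local q_gt1 hF Px). Qed.

(** Distinct centres are told apart by some [a] that is a unit at one place and in the ideal of the
    other. A power of [a] is 1 modulo the place where it is a unit, so [E] is [a ^+ n] or
    [1 - a ^+ n]. *)
Lemma separate (P Q : place iota) : fplace P -> fplace Q -> P <> Q ->
  exists E, [/\ affine E, place_max P (E - 1) & place_max Q E].
Proof.
move=> Px Qx PQ.
have [[a [Aa Ua Ma]]|[a [Aa Ma Ua]]] :
    (exists a, [/\ affine a, ~ place_max P a & place_max Q a]) \/
    (exists a, [/\ affine a, place_max P a & ~ place_max Q a]).
- apply: contrapT => /not_orP[H1 H2]; apply: PQ.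
  apply: (place_of_center q_pchar q_gt1 N_gt0 cardK hF Px Qx) => a Aa; split=> Ma.
    by apply: contrapT => Ua; apply: H2; exists a.
  by apply: contrapT => Ua; apply: H1; exists a.
- have [s s0 Ms] := frob_poly_max q_pchar q_gt1 cardK hF Px.
  have [n n0 Mn] := residue_order q_pchar q_gt1 N_gt0 cardK hF Px s0 Ms Aa Ua.
  exists (a ^+ n); split=> //; first exact: affineX.
  by rewrite -(prednK n0); exact: place_max_expS.
have [s s0 Ms] := frob_poly_max q_pchar q_gt1 cardK hF Qx.
have [n n0 Mn] := residue_order q_pchar q_gt1 N_gt0 cardK hF Qx s0 Ms Aa Ua.
exists (1 - a ^+ n); split; first by apply: affineB; [exact: affine1|exact: affineX].
  rewrite addrAC subrr add0r; apply: place_maxN.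
  by rewrite -(prednK n0); exact: place_max_expS.
by rewrite -opprB; exact: place_maxN.
Qed.

(* A place P over D is determined by the residues modulo D lying in its ideal. *)
Lemma finite_poles (r : F) :
  finite_set [set P : place iota | fplace P /\ ~ local_ring P r]%classic.
Proof.
have [R [D [D0 _ rE]]] := fraction q_gt1 hF r.
pose T := {ffun 'I_q -> {ffun 'I_(size D) -> K}}.
pose lift (t : T) : F := evxy (\poly_(j < q) (if insub j is Some j' then
   \poly_(i < size D) (if insub i is Some i' then t j' i' else 0) else 0)).
pose code (P : place iota) : {set T} := [set t | `[< place_max P (lift t) >]].
have lift_mod a : affine a -> exists t, exists2 b, affine b & a = lift t + evx D * b.
  move=> Aa; have [S szS ->] := affine_reduced q_gt1 hF Aa.
  pose t : T := [ffun j : 'I_q => [ffun i : 'I_(size D) => (S`_j %% D)`_i]].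
  have tE : lift t = evxy (\poly_(j < q) (S`_j %% D)).
    congr evxy; apply/polyP => j; rewrite !coef_poly; case: ltnP => // jq.
    rewrite insubT /=; apply/polyP => i; rewrite coef_poly; case: ltnP => iD.
      by rewrite insubT !ffunE.
    by rewrite nth_default // (leq_trans _ iD) // ltnW // ltn_modp.
  exists t, (evxy (\poly_(j < q) (S`_j %/ D))); first by exists (\poly_(j < q) (S`_j %/ D)).
  rewrite tE -(evxyC _ _ y) -rmorphM -rmorphD; congr evxy; apply/polyP => j.
  rewrite coefD mul_polyC coefZ !coef_poly; case: ltnP => jq.
    by rewrite addrC mulrC -divp_eq.
  by rewrite nth_default ?mulr0 ?addr0 // (leq_trans szS).
have inj (P Q : place iota) : fplace P -> fplace Q -> place_max P (evx D) ->
    place_max Q (evx D) -> code P = code Q -> P = Q.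
  move=> Px Qx PD QD PQ; apply: (place_of_center q_pchar q_gt1 N_gt0 cardK hF Px Qx).
  move=> a Aa; have [t [b Ab aE]] := lift_mod a Aa.
  have key P' : fplace P' -> place_max P' (evx D) -> (place_max P' a <-> t \in code P').
    move=> P'x P'D; rewrite inE; split=> [Ma|/asboolP Mt].
      apply/asboolP; rewrite -[lift t](addrK (evx D * b)) -aE.
      by apply: place_maxB => //; apply: place_maxMr => //; exact: aff_loc.
    by rewrite aE; apply: place_maxD => //; apply: place_maxMr => //; exact: aff_loc.
  by rewrite (key P Px PD) (key Q Qx QD) PQ.
have sub (P : place iota) : fplace P -> ~ local_ring P r -> place_max P (evx D).
  move=> Px nr; apply: contrapT => UD; apply: nr; rewrite rE.
  by apply: place_mul; [apply: (aff_loc Px); exists R|exact: place_unit_inv].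
set B := (X in finite_set X).
have injB : {in B &, injective code}.
  move=> P Q; rewrite !inE => -[Px nP] [Qx nQ].
  by apply: inj => //; exact: sub.
by rewrite -(eq_finite_set (inj_card_eq injB)); exact: finite_finset.
Qed.

End Approximation.

(** Classical decidable equality, so that places can be listed in sequences. *)
HB.instance Definition _ (K F : fieldType) (iota : {rmorphism K -> F}) :=
  gen_eqMixin (place iota).

(** * Strong approximation away from infinity, and everywhere regular functions *)

Section StrongApproximation.

Variables (K : finFieldType) (F : fieldType) (iota : {rmorphism K -> F}).
Variables (q N : nat) (f : {poly K}) (x y : F).
Hypotheses (q_pchar : [pchar K].-nat q) (q_gt1 : (1 < q)%N) (N_gt0 : (0 < N)%N).
Hypotheses (cardK : #|K| = (q ^ N)%N) (hF : AS_function_field iota q f x y).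

Local Notation evx := (evx iota x).
Local Notation evxy := (evxy iota x y).
Local Notation affine := (affine iota x y).
Local Notation fplace P := (local_ring P x).
Let evx0 := evx_eq0 hF.

Let aff_loc (P : place iota) (Px : fplace P) z : affine z -> local_ring P z.
Proof. exact: (affine_local q_gt1 hF Px). Qed.

Let pole_bound_at (P : place iota) t z : fplace P -> affine t -> place_max P t ->
  exists n, forall n', (n <= n')%N -> local_ring P (t ^+ n' * z).
Proof.
move=> Px At Mt; have [s s0 Ms] := frob_poly_max q_pchar q_gt1 cardK hF Px.
exact: (pole_bound q_pchar q_gt1 N_gt0 cardK hF Px s0 Ms).
Qed.

Let separate_seq (P : place iota) (s : seq (place iota)) : fplace P ->
  exists E, [/\ affine E, place_max P (E - 1)
    & forall Q, Q \in s -> fplace Q -> Q <> P -> place_max Q E].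
Proof.
move=> Px; elim: s => [|Q s [E [AE ME HE]]].
  by exists 1; split=> //; [exact: affine1|rewrite subrr; left].
have [[Qx QP]|nQ] := pselect (fplace Q /\ Q <> P); last first.
  exists E; split=> // Q'; rewrite inE => /predU1P[->|]; last exact: HE.
  by move=> Q'x Q'P; case: nQ.
have [E' [AE' ME' MQ]] := separate q_pchar q_gt1 N_gt0 cardK hF Px Qx (fun e => QP (esym e)).
exists (E * E'); split; first exact: affineM.
  rewrite (_ : E * E' - 1 = (E - 1) * E' + (E' - 1)); last by ring.
  by apply: place_maxD => //; apply: place_maxMr => //; exact: aff_loc.
move=> Q' + Q'x Q'P; rewrite inE => /predU1P[->|Q's].
  by apply: place_maxMl => //; exact: aff_loc.
by apply: place_maxMr; [exact: HE|exact: aff_loc].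
Qed.

Lemma approximate_at (P : place iota) r : fplace P ->
  exists z, local_ring P (r - z) /\
    forall Q, fplace Q -> Q <> P -> local_ring Q z.
Proof.
move=> Px; have /finite_seqP[s sE] := finite_poles q_pchar q_gt1 N_gt0 cardK hF r.
have poles Q : fplace Q -> ~ local_ring Q r -> Q \in s.
  by move=> Qx nQ; have : [set` s]%classic Q by rewrite -sE.
have [E [AE ME HE]] := separate_seq s Px.
have [n Hn] : exists n, forall n', (n <= n')%N -> forall Q, Q \in s -> fplace Q ->
    Q <> P -> local_ring Q (E ^+ n' * r).
  elim: s HE {sE poles} => [|Q s IH] HE; first by exists 0%N.
  have [|n Hn] := IH; first by move=> Q' Q's; apply: HE; rewrite inE Q's orbT.
  have [[Qx QP]|nQ] := pselect (fplace Q /\ Q <> P); last first.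
    exists n => n' le_n Q'; rewrite inE => /predU1P[->|]; last exact: Hn.
    by move=> Q'x Q'P; case: nQ.
  have [k Hk] := pole_bound_at r Qx AE (HE Q (mem_head _ _) Qx QP).
  exists (maxn n k) => n'; rewrite geq_max => /andP[le_n le_k] Q'.
  by rewrite inE => /predU1P[->|] *; [exact: Hk|exact: Hn].
have AE1 : affine (E - 1) by apply: affineB => //; exact: affine1.
have [k Hk] := pole_bound_at r Px AE1 ME.
(* Taking a power of [q] as exponent gives [E ^+ w - 1 = (E - 1) ^+ w]. So a single large [w] makes
   [E ^+ w * r] regular at the other poles of [r] and [r - E ^+ w * r] regular at [P]. *)
pose w := (q ^ maxn n k)%N.
have w_pchar : [pchar F].-nat w by rewrite (eq_pnat _ (fmorph_pchar iota)) q_pchar_exp.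
have le_w : (maxn n k <= w)%N by exact/ltnW/ltn_expl.
exists (E ^+ w * r); split.
  have -> : r - E ^+ w * r = - ((E - 1) ^+ w * r).
    by rewrite exprB_pchar // expr1n; ring.
  by apply/placeN/Hk/(leq_trans _ le_w)/leq_maxr.
move=> Q Qx QP; have [Qr|nQ] := pselect (local_ring Q r).
  by apply: place_mul => //; apply: aff_loc => //; exact: affineX.
apply: Hn => //; first exact: leq_trans (leq_maxl _ _) le_w.
exact: poles.
Qed.

(** The listed places are cleared one at a time: the correction [z0] for [P0] is regular at all
    other finite places, so subtracting it creates no new pole. *)
Lemma strong_approximation (r : place iota -> F) : repartition r ->
  exists z, forall P, fplace P -> local_ring P (r P - z).
Proof.
move=> /finite_seqP[s sE].
have {sE} : forall P, fplace P -> P \notin s -> local_ring P (r P).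
  move=> P _ Ps; apply: contrapT => nP; move/negP: Ps; apply.
  by have : [set` s]%classic P by rewrite -sE.
elim: s r => [|P0 s IH] r Hr.
  by exists 0 => P Px; rewrite subr0; exact: Hr.
have [P0x|nP0] := pselect (fplace P0); last first.
  apply: IH => P Px Ps; apply: Hr => //; rewrite inE negb_or Ps andbT.
  by apply/eqP => PP0; apply: nP0; rewrite -PP0.
have [z0 [Hz0 Hz0']] := approximate_at (r P0) P0x.
have [|z Hz] := IH (fun P => r P - z0).
  move=> P Px Ps; have [->//|/eqP PP0] := eqVneq P P0.
  apply: place_sub; last exact: Hz0'.
  by apply: Hr => //; rewrite inE negb_or Ps andbT; apply/eqP.
by exists (z0 + z) => P Px; rewrite opprD addrA; exact: Hz.
Qed.

(** The denominator is removed by factors [G = gcdp D (frob_poly K s)], nonconstant because [D]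
    divides a power of [frob_poly K s]; the point is that [G] divides the numerator in K[x, y]. *)
Lemma regular_affine z : (forall P : place iota, fplace P -> local_ring P z) -> affine z.
Proof.
move=> Hz; have [R [D [D0 _ zE]]] := fraction q_gt1 hF z.
have AR : affine (evxy R) by exists R.
have [l] := ubnP (size D); elim: l D D0 (evxy R) AR zE => // l IH D D0 a Aa zE szD.
case: (leqP (size D) 1) => [/size1_polyC DE|sz1].
  rewrite zE DE evxC -fmorphV; apply: affineM => //; exact: affine_const.
have [s [t [s0 Ds]]] := dvdp_frob_poly q_pchar cardK D0.
pose G := gcdp D (frob_poly K s).
have szG : size G != 1%N.
  apply: contraTneq sz1 => /eqP sG1; rewrite -leqNgt.
  have : coprimep D (frob_poly K s ^+ (#|K| ^ t)) by apply: coprimep_expr.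
  by rewrite /coprimep (eqp_size (dvdp_gcd_idl Ds)) => /eqP ->.
have G0 : G != 0 by rewrite gcdp_eq0 (negPf D0).
have /dvdpP[D1 D1E] : G %| D := dvdp_gcdl _ _.
have /dvdpP[p1 p1E] : G %| frob_poly K s := dvdp_gcdr _ _.
have D10 : D1 != 0 by apply: contraNneq D0 => e; rewrite D1E e mul0r.
have eG0 : evx G != 0 by rewrite evx0.
have [b Ab aE] : exists2 b, affine b & a = evx G * b.
  apply: contrapT => nG.
  have a0 : a != 0.
    by apply/eqP => a0; apply: nG; exists 0; rewrite ?mulr0 //; exact: affine0.
  pose B w := exists c k, affine c /\ w = c / a ^+ k.
  (* affine / G is reduced, so a is not nilpotent in it and some place with G in its
     ideal has a as a unit, although a = z * D lies in that ideal. *)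
  have [W' W1 H] := frob_affine q_pchar q_gt1 N_gt0 cardK hF s0.
  have Hj j : exists2 b, affine b & a ^+ (W' ^ j) - a = evx (frob_poly K s) * b.
    elim: j => [|j [b Ab E]].
      by exists 0; [exact: affine0|rewrite expn0 expr1 subrr mulr0].
    have [b' Ab' E'] := H _ (affineX (W' ^ j) Aa).
    exists (b' + b); first exact: affineD.
    by rewrite expnSr exprM mulrDr -E -E' addrA subrK.
  have B_aff c : affine c -> B c by move=> Ac; exists c, 0%N; rewrite expr0 divr1.
  have [||||nB|P [BP MG]] := @place_exists K F iota B (evx G).
  - by move=> c; apply: B_aff; exact: affine_const.
  - move=> _ _ [c [k [Ac ->]]] [c' [k' [Ac' ->]]].
    exists (c * a ^+ k' - c' * a ^+ k), (k + k')%N; split.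
      by apply: affineB; apply: affineM => //; exact: affineX.
    by rewrite exprD; field; rewrite !expf_neq0.
  - move=> _ _ [c [k [Ac ->]]] [c' [k' [Ac' ->]]].
    exists (c * c'), (k + k')%N; split; first exact: affineM.
    by rewrite exprD; field; rewrite !expf_neq0.
  - by apply: B_aff; exact: affine_evx.
  (* If [G] is invertible in K[x, y][a^-1], then it divides some [a ^+ k], hence [a ^+ (W' ^ k)]. It
     also divides [a ^+ (W' ^ k) - a], so it divides [a]. *)
  - case: nB => c [k [Ac cE]]; apply: nG; have [b Ab E] := Hj k.
    have ak : a ^+ k = evx G * c.
      apply: (mulfI (invr_neq0 eG0)); rewrite mulrA mulVf // mul1r cE divfK //.
      by rewrite expf_neq0.
    have kW : (k <= W' ^ k)%N by exact/ltnW/ltn_expl.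
    exists (c * a ^+ (W' ^ k - k) - evx p1 * b).
      apply: affineB; apply: affineM => //; [exact: affineX|exact: affine_evx].
    rewrite mulrBr mulrA -ak -exprD subnKC // mulrA [evx G * _]mulrC.
    by rewrite -rmorphM -p1E -E opprB addrC subrK.
  have Px : fplace P.
    by apply/BP/B_aff; have := affine_evx iota x y 'X; rewrite evxX.
  have Oa : local_ring P a^-1.
    by apply: BP; exists 1, 1%N; split; [exact: affine1|rewrite expr1 mul1r].
  have : place_max P a.
    have -> : a = z * evx D1 * evx G.
      by rewrite -mulrA -rmorphM -D1E zE divfK // evx0.
    apply: place_maxMl => //; apply: place_mul; first exact: Hz.
    by apply: aff_loc => //; exact: affine_evx.
  by case=> [/eqP|]; rewrite ?(negPf a0).
apply: (IH D1 D10 b Ab).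
  by rewrite zE aE {1}D1E rmorphM /=; field; rewrite !evx0 D10 G0.
have szE : size D = (size D1 + size G).-1 by rewrite {1}D1E size_mul.
move: szD szG; rewrite -size_poly_gt0 in G0; rewrite szE.
by move: (size D1) (size G) G0 => d g; lia.
Qed.

End StrongApproximation.

(** * The genus *)

(* Exponents of the functions y ^ j / x ^ l whose pole order j * m - l * q at
   infinity is a gap of the semigroup generated by q and m. *)
Definition gap_set (q m : nat) : {set 'I_q * 'I_m} :=
  [set u : 'I_q * 'I_m | (0 < u.2)%N && (u.2 * q < u.1 * m)%N].

(** The symmetry [(j, l) |-> (q - j, m - l)] of the rectangle [0 < j < q], [0 < l < m] exchanges the
    gaps with the other points. No point lies on the diagonal [j * m = l * q] because [q] and [m]
    are coprime. *)
Lemma card_gap_set (q m : nat) : (0 < q)%N -> (0 < m)%N -> coprime q m ->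
  (2 * #|gap_set q m| = (q - 1) * (m - 1))%N.
Proof.
move=> q0 m0 co.
pose rect : {set 'I_q * 'I_m} := [set u : 'I_q * 'I_m | (0 < u.1)%N && (0 < u.2)%N].
pose B := rect :\: gap_set q m.
have cardR : #|rect| = ((q - 1) * (m - 1))%N.
  have pos n (n0 : (0 < n)%N) : #|[set i : 'I_n | (0 < i)%N]| = (n - 1)%N.
    rewrite (_ : [set i : 'I_n | _] = [set~ Ordinal n0]) ?cardsC1 ?card_ord ?subn1 //.
    by apply/setP => i; rewrite !inE -(inj_eq val_inj) /= lt0n.
  rewrite -(pos q q0) -(pos m m0) -cardsX; apply: eq_card => u.
  by rewrite !inE.
have AR : gap_set q m \subset rect.
  apply/fintype.subsetP => -[j l]; rewrite !inE /= => /andP[l0 lt]; rewrite l0 andbT.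
  by move: lt; case: (val j).
pose rev (u : 'I_q * 'I_m) := (insubd u.1 (q - u.1)%N, insubd u.2 (m - u.2)%N).
have revE u : u \in rect -> ((rev u).1 = q - u.1 :> nat /\ (rev u).2 = m - u.2 :> nat)%N.
  case: u => j l; rewrite inE /= => /andP[j0 l0]; rewrite !val_insubd.
  by rewrite !ifT //; lia.
have rev_inj : {in rect &, injective rev}.
  move=> u v uR vR e; have [u1 u2] := revE u uR; have [v1 v2] := revE v vR.
  move: u1 u2 v1 v2; rewrite e => -> -> e1 e2; case: u v uR vR e e1 e2 => [j l] [j' l'] /=.
  move=> _ _ _ e1 e2; have := (ltn_ord j, ltn_ord j', ltn_ord l, ltn_ord l').
  move=> [[[h1 h2] h3] h4]; congr pair; apply: val_inj; rewrite /=; lia.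
have revAB : rev @: gap_set q m \subset B.
  apply/fintype.subsetP => _ /imsetP[u uA ->]; have uR := fintype.subsetP AR _ uA.
  have [e1 e2] := revE u uR; move: uA uR; rewrite !inE e1 e2.
  case: u {e1 e2} => j l /= /andP[l0 lt] /andP[j0 _].
  have := (ltn_ord j, ltn_ord l) => -[h1 h2]; rewrite !subn_gt0 h1 h2 /= andbT -leqNgt.
  rewrite !mulnBl [(q * m)%N]mulnC; apply: leq_sub2l; exact: ltnW.
have revBA : rev @: B \subset gap_set q m.
  apply/fintype.subsetP => _ /imsetP[u uB ->].
  have uR : u \in rect by move: uB; rewrite inE => /andP[].
  have [e1 e2] := revE u uR; move: uB uR; rewrite !inE e1 e2.
  case: u {e1 e2} => j l /= /andP[nA _] /andP[j0 l0].
  move: nA; rewrite l0 /= -leqNgt => le.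
  have := (ltn_ord j, ltn_ord l) => -[h1 h2]; rewrite subn_gt0 h2 /=.
  have lt : (j * m < l * q)%N.
    rewrite ltn_neqAle le andbT; apply/negP => /eqP e.
    have : (q %| j * m)%N by rewrite e dvdn_mull.
    by rewrite Gauss_dvdl // => /(dvdn_leq j0); rewrite leqNgt h1.
  rewrite !mulnBl [(q * m)%N]mulnC; apply: ltn_sub2l => //.
  by apply: leq_trans lt _; rewrite leq_mul2r ltnW ?orbT.
have cAB : #|gap_set q m| = #|B|.
  have injA : {in gap_set q m &, injective rev} by apply: (sub_in2 (fintype.subsetP AR) rev_inj).
  have injB : {in B &, injective rev}.
    by apply: (sub_in2 _ rev_inj) => u; rewrite inE => /andP[].
  apply/eqP; rewrite eqn_leq; apply/andP; split.
    by rewrite -(card_in_imset injA) subset_leq_card.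
  by rewrite -(card_in_imset injB) subset_leq_card.
have := cardsID (gap_set q m) rect; rewrite -/B (finset.setIidPr AR) -cAB cardR => <-.
by rewrite mul2n addnn.
Qed.

Section Genus.

Variables (K : finFieldType) (F : fieldType) (iota : {rmorphism K -> F}).
Variables (q N m : nat) (f : {poly K}) (x y : F).
Hypotheses (q_pchar : [pchar K].-nat q) (q_gt1 : (1 < q)%N) (N_gt0 : (0 < N)%N).
Hypotheses (cardK : #|K| = (q ^ N)%N) (hF : AS_function_field iota q f x y).
Hypotheses (m_gt0 : (0 < m)%N) (co_qm : coprime q m) (szf : size f = m.+1).

Local Notation evx := (evx iota x).
Local Notation evxy := (evxy iota x y).
Local Notation affine := (affine iota x y).
Local Notation fplace P := (local_ring P x).
Local Notation A := (gap_set q m).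
Let evx0 := evx_eq0 hF.

Let aff_loc (P : place iota) (Px : fplace P) z : affine z -> local_ring P z.
Proof. exact: (affine_local q_gt1 hF Px). Qed.

Let x0 : x != 0. Proof. by rewrite -(evxX iota x) evx0 polyX_eq0. Qed.

Let evxy_poly (E : nat -> {poly K}) :
  evxy (\poly_(j < q) E j) = \sum_(j < q) evx (E j) * y ^+ j.
Proof.
rewrite poly_def rmorph_sum; apply: eq_bigr => j _.
by rewrite -mul_polyC rmorphM rmorphXn /= evxyC evxyX.
Qed.

Definition gap_function (u : 'I_q * 'I_m) : F := x^-1 ^+ u.2 * y ^+ u.1.

(** Concentrated at infinity, since strong approximation removes every finite part of a
    repartition. *)
Definition gap_basis (i : 'I_#|A|) (P : place iota) : F :=
  if `[< fplace P >] then 0 else gap_function (enum_val i).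

(** The coefficient of [y ^+ j] in a combination of gap functions, brought over the common
    denominator [x ^+ m]: the exponent [m - l] stands for [x^-1 ^+ l]. *)
Let gap_poly (gam : nat -> nat -> K) (j : nat) : {poly K} :=
  \sum_(l < m | (0 < l)%N && (l * q < j * m)%N) gam j l *: 'X^(m - l).

Let gap_sum (gam : nat -> nat -> K) :
  \sum_(u in A) iota (gam u.1 u.2) * gap_function u =
  evxy (\poly_(j < q) gap_poly gam j) / evx 'X^m.
Proof.
have -> : evx 'X^m = x ^+ m by rewrite rmorphXn /= evxX.
rewrite evxy_poly mulr_suml.
rewrite (eq_bigl (fun u : 'I_q * 'I_m => xpredT u.1 && ((0 < u.2) && (u.2 * q < u.1 * m))%N)).
  rewrite -(pair_big_dep xpredT (fun (j : 'I_q) (l : 'I_m) => (0 < l) && (l * q < j * m))%N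
    (fun j l => iota (gam j l) * gap_function (j, l))) /=.
  apply: eq_bigr => j _; rewrite rmorph_sum !mulr_suml /=; apply: eq_bigr => l _.
  rewrite -mul_polyC rmorphM rmorphXn /= evxC evxX /gap_function /=.
  have lm := ltnW (ltn_ord l).
  have -> : x ^+ m = x ^+ (m - l) * x ^+ l by rewrite -exprD subnK.
  by rewrite exprVn; field; rewrite !expf_neq0.
by move=> u; rewrite inE.
Qed.

Let coef_gap_poly (gam : nat -> nat -> K) (j i : nat) : (gap_poly gam j)`_i =
  if [&& (0 < i)%N, (i < m)%N & ((m - i) * q < j * m)%N] then gam j (m - i)%N else 0.
Proof.
rewrite /gap_poly coef_sum; case: ifP => [/and3P[i0 im lt]|H].
  have mi : (m - i < m)%N by lia.
  rewrite (bigD1 (Ordinal mi)) /=; last by rewrite subn_gt0 im lt.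
  rewrite coefZ coefXn subKn ?(ltnW im) // eqxx mulr1 big1 ?addr0 // => l /andP[_ ne].
  rewrite coefZ coefXn; case: eqP => [e|]; last by rewrite mulr0.
  by case/eqP: ne; apply: val_inj; rewrite /= e subKn // ltnW.
apply: big1 => l /andP[l0 lt]; rewrite coefZ coefXn; case: eqP => [e|]; last by rewrite mulr0.
have lm := ltn_ord l; move/negP: H; case.
by rewrite e subKn ?(ltnW lm) // lt andbT subn_gt0 lm /= ltn_subrL l0.
Qed.

Let gap_sum_enum (c : 'I_#|A| -> K) (gam : nat -> nat -> K) (P : place iota) :
  ~ fplace P -> (forall i, c i = gam (enum_val i).1 (enum_val i).2) ->
  \sum_(i < #|A|) iota (c i) * gap_basis i P =
  evxy (\poly_(j < q) gap_poly gam j) / evx 'X^m.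
Proof.
move=> nP cE; rewrite -gap_sum [RHS]big_enum_val; apply: eq_bigr => i _.
by rewrite /gap_basis asboolF // cE.
Qed.

Let gap_sum_finite (c : 'I_#|A| -> K) (P : place iota) :
  fplace P -> \sum_(i < #|A|) iota (c i) * gap_basis i P = 0.
Proof. by move=> Px; rewrite big1 // => i _; rewrite /gap_basis asboolT // mulr0. Qed.

(** Each coordinate of [w] on the powers of [y] is expanded in [x^-1] down to [x ^+ (- m)] by
    dividing ['X^m * R_j] by [D]. The nonnegative powers of [x] form [z], the gaps give [c], and the
    other terms and the remainder are regular at infinity. *)
Let gap_exists (P : place iota) (w : F) : ~ fplace P ->
  exists (c : {ffun 'I_#|A| -> K}) (z : F), affine z /\
    local_ring P (w - \sum_(i < #|A|) iota (c i) * gap_basis i P - z).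
Proof.
move=> nP; have [R [D [D0 szR wE]]] := fraction q_gt1 hF w.
pose Q j := ('X^m * R`_j) %/ D; pose rho j := ('X^m * R`_j) %% D.
pose gam j l := (Q j)`_(m - l).
pose S : {poly {poly K}} := \poly_(j < q) drop_poly m (Q j).
pose G j := take_poly m (Q j) - gap_poly gam j.
exists [ffun i : 'I_#|A| => gam (enum_val i).1 (enum_val i).2], (evxy S); split; first by exists S.
rewrite (@gap_sum_enum _ gam) //; last by move=> i; rewrite ffunE.
pose T : {poly {poly K}} := \poly_(j < q) (D * G j + rho j).
have Xm0 : 'X^m != 0 :> {poly K} by rewrite -size_poly_eq0 size_polyXn.
have eX : evx 'X^m != 0 by rewrite evx0.
have eD : evx D != 0 by rewrite evx0.
have -> : w - evxy (\poly_(j < q) gap_poly gam j) / evx 'X^m - evxy S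
    = evxy T / evx (D * 'X^m).
  have RE : R = \poly_(j < q) R`_j.
    by apply/polyP => j; rewrite coef_poly; case: ltnP => // jq;
      rewrite nth_default // (leq_trans szR).
  rewrite wE {1}RE !evxy_poly !mulr_suml -!sumrB; apply: eq_bigr => j _.
  have E : evx 'X^m * evx R`_j = evx D * evx (Q j) + evx (rho j).
    by rewrite -!rmorphM -rmorphD mulrC [D * _]mulrC -divp_eq mulrC.
  have E2 : evx (Q j) = evx (take_poly m (Q j)) + evx (drop_poly m (Q j)) * evx 'X^m.
    by rewrite -rmorphM -rmorphD poly_take_drop.
  have -> : evx R`_j = (evx D * evx (Q j) + evx (rho j)) / evx 'X^m.
    by rewrite -E mulrC mulKf.
  rewrite /G rmorphD !rmorphM rmorphB /= E2; field; exact/andP.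
apply: (infinity_memP q_gt1 m_gt0 co_qm szf hF nP); [exact: size_poly|by rewrite mulf_neq0|].
move=> j; rewrite coef_poly ltn_ord => Tj.
have szD : (0 < size D)%N by rewrite size_poly_gt0.
have szrho : (size (rho j) < size D)%N by rewrite ltn_modp.
have jm : (j * m <= q * m)%N by rewrite leq_mul2r ltnW ?orbT.
have -> : (size (D * 'X^m)).-1 = ((size D).-1 + m)%N.
  by rewrite size_mul ?size_polyXn // addnS /= -(prednK szD).
have szT := leq_trans (size_polyD (D * G j) (rho j)).
have [G0|G0] := eqVneq (G j) 0.
  have : (size (D * G j + rho j)%R <= size (rho j))%N by rewrite G0 mulr0 add0r.
  move=> le; have {}le : ((size (D * G j + rho j)%R).-1 <= (size D).-1)%N by lia.
  have : (q * (size (D * G j + rho j)%R).-1 <= q * (size D).-1)%N by rewrite leq_mul2l le orbT.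
  rewrite mulnDr; lia.
have Gdeg : (q * (size (G j)).-1 + j * m <= q * m)%N.
  rewrite leqNgt; apply/negP => lt.
  have : lead_coef (G j) == 0; last by rewrite lead_coef_eq0 (negPf G0).
  rewrite lead_coefE; set i := (size (G j)).-1 in lt *.
  rewrite /G coefB coef_take_poly coef_gap_poly; apply/eqP.
  case: (ltnP i m) => im /=; last by rewrite andbF subrr.
  have i0 : (0 < i)%N.
    by case: i lt im => // lt _; move: lt; rewrite muln0 add0n ltnNge jm.
  have lt' : ((m - i) * q < j * m)%N.
    by rewrite mulnBl ltn_subLR ?leq_mul2r ?(ltnW im) ?orbT // [(m * q)%N]mulnC [(i * q)%N]mulnC.
  by rewrite i0 lt' /gam subKn ?subrr // ltnW.
have szG : (0 < size (G j))%N by rewrite size_poly_gt0.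
have le : ((size (D * G j + rho j)%R).-1 <= (size D).-1 + (size (G j)).-1)%N.
  have : (size (D * G j + rho j)%R <= maxn (size (D * G j)%R) (size (rho j)))%N.
    exact: size_polyD.
  rewrite size_mul // leq_max; move: szG szD szrho.
  by move: (size _) (size (G j)) (size D) (size (rho j)) => s1 s2 s3 s4 ? ? ? /orP[]; lia.
have : (q * (size (D * G j + rho j)%R).-1 <= q * ((size D).-1 + (size (G j)).-1))%N.
  by rewrite leq_mul2l le orbT.
by rewrite !mulnDr; lia.
Qed.

(** Over the denominator [x ^+ m], [z] contributes only exponents at least [m] and the gaps only
    smaller ones. A nonzero [c i] thus survives as a term whose weight exceeds [q * m], against
    [infinity_mem_weight]. *)
Let gap_free (P : place iota) (c : 'I_#|A| -> K) (z : F) : ~ fplace P -> affine z ->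
  local_ring P (\sum_(i < #|A|) iota (c i) * gap_basis i P + z) -> forall i, c i = 0.
Proof.
move=> nP Az Oz i; have [S szS zE] := affine_reduced q_gt1 hF Az.
pose gam j l := if [pick k : 'I_#|A| | ((enum_val k).1 == j :> nat) && ((enum_val k).2 == l :> nat)]
  is Some k then c k else 0.
have cE k : c k = gam (enum_val k).1 (enum_val k).2.
  rewrite /gam; case: pickP => [k' /andP[/eqP e1 /eqP e2]|/(_ k)]; last by rewrite !eqxx.
  congr c; apply: enum_val_inj; move: e1 e2; case: (enum_val k) (enum_val k') => [a b] [a' b'].
  by move=> /= /val_inj -> /val_inj ->.
rewrite (gap_sum_enum nP cE) in Oz.
have Xm0 : 'X^m != 0 :> {poly K} by rewrite -size_poly_eq0 size_polyXn.
pose T : {poly {poly K}} := \poly_(j < q) (gap_poly gam j + 'X^m * S`_j).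
have TE : evxy (\poly_(j < q) gap_poly gam j) / evx 'X^m + z = evxy T / evx 'X^m.
  have SE : S = \poly_(j < q) S`_j.
    by apply/polyP => j; rewrite coef_poly; case: ltnP => // jq;
      rewrite nth_default // (leq_trans szS).
  rewrite zE {1}SE !evxy_poly !mulr_suml -big_split; apply: eq_bigr => j _ /=.
  have eX : evx 'X^m != 0 by rewrite evx0.
  by rewrite rmorphD rmorphM /=; field.
rewrite TE in Oz; apply/eqP/negPn/negP => ci.
have := enum_valP i; move: ci; rewrite cE; case: (enum_val i) => j l /= ci.
rewrite inE /= => /andP[l0 lt].
have lm := ltn_ord l.
have Tjl : (T`_j)`_(m - l) != 0.
  have c1 : (0 < m - l)%N by rewrite subn_gt0.
  have c2 : (m - l < m)%N by rewrite ltn_subrL l0.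
  rewrite coef_poly ltn_ord coefD coef_gap_poly coefXnM c1 c2 subKn ?(ltnW lm) //.
  by rewrite lt addr0.
have Tj : T`_j != 0 by apply: contraNneq Tjl => ->; rewrite coef0.
have := infinity_mem_weight q_gt1 m_gt0 co_qm szf hF nP (size_poly _ _) Xm0 Oz Tj.
rewrite size_polyXn /=; have : (m - l <= (size (T`_j)%R).-1)%N.
  have : (m - l < size (T`_j)%R)%N.
    by rewrite ltnNge; apply: contra Tjl => le; rewrite nth_default.
  by move: (size _) => t; lia.
move: (size (T`_j)%R).-1 => t le.
have : (q * (m - l) <= q * t)%N by rewrite leq_mul2l le orbT.
rewrite mulnBr; have : (q * l <= q * m)%N by rewrite leq_mul2l ltnW ?orbT.
by move: lt; rewrite [(l * q)%N]mulnC; lia.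
Qed.

Theorem genus_AS : is_genus iota #|A|.
Proof.
have [Pinf nPinf] := infinity_exists hF.
have inf_eq (P : place iota) : ~ fplace P -> P = Pinf.
  by move=> nP; exact: (infinity_unique q_gt1 m_gt0 co_qm szf hF).
exists gap_basis; split=> [i|r Hr].
  apply: (@sub_finite_set _ _ [set Pinf]%classic); last exact: finite_set1.
  move=> P /= nP; apply: inf_eq => Px; apply: nP; rewrite /gap_basis asboolT //.
  exact: place0.
have [z1 Hz1] := strong_approximation q_pchar q_gt1 N_gt0 cardK hF Hr.
have [c [z2 [Az2 Hz2]]] := gap_exists (r Pinf - z1) nPinf.
exists c; split.
  exists (z1 + z2) => P; have [Px|nP] := pselect (fplace P).
    rewrite gap_sum_finite // subr0 opprD addrA; apply: place_sub; first exact: Hz1.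
    exact: aff_loc.
  rewrite (inf_eq P nP); move: Hz2; set s := \sum_(i < _) _.
  by rewrite (_ : _ - z1 - s - z2 = r Pinf - s - (z1 + z2)) //; ring.
move=> c' [z' Hz']; apply/ffunP => i; apply/eqP; rewrite -subr_eq0; apply/eqP.
(* Two solutions differ by a function without finite poles, because the basis vanishes at finite
   places; [gap_free] then compares them at infinity. *)
have Az : affine (z' - (z1 + z2)).
  apply: (regular_affine q_pchar q_gt1 N_gt0 cardK hF) => P Px.
  have := Hz' P; rewrite gap_sum_finite // subr0 => H'.
  rewrite (_ : z' - (z1 + z2) = (r P - z1) - (r P - z') - z2); last by ring.
  by apply: place_sub; [apply: place_sub => //; exact: Hz1|exact: aff_loc].
apply: (gap_free (c := fun k => c k - c' k) nPinf (z := - (z' - (z1 + z2)))).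
  by rewrite -sub0r; apply: affineB => //; exact: affine0.
have -> : \sum_(k < #|A|) iota (c k - c' k) * gap_basis k Pinf =
    \sum_(k < #|A|) iota (c k) * gap_basis k Pinf
    - \sum_(k < #|A|) iota (c' k) * gap_basis k Pinf.
  by rewrite -sumrB; apply: eq_bigr => k _; rewrite rmorphB mulrBl.
move: Hz2 (Hz' Pinf); set s := \sum_(k < _) _; set s' := \sum_(k < _) _ => H1 H2.
rewrite (_ : s - s' - (z' - (z1 + z2)) = (r Pinf - s' - z') - (r Pinf - z1 - s - z2)); last by ring.
exact: place_sub.
Qed.

End Genus.

(** Taking [a] in [nat] loses no case: [totient d <= k], as [d] divides [k], so an integer solution
    of [ha] is at least [k / 2]. *)
Theorem theorem7
  (p m q k d n a : nat)
  (hp : prime p) (hp_odd : odd p) (hm : (0 < m)%N) (hq : q = (p ^ m)%N)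
  (hk : (0 < k)%N) (hk_even : ~~ odd k)
  (hd : (2 <= d)%N) (hdk : (d %| k)%N) (hpd : ~~ (p %| d)%N)
  (hn : (n = k %[mod 2 * k])%N) (hkn : (k < n)%N)
  (ha : (totient d + 2 * a = 2 * k)%N)
  (K : finFieldType) (hK : #|K| = (q ^ (2 * n))%N)
  (Phi : {poly K}) (hPhi : is_cyclotomic_poly d Phi)
  (f : {poly K})
  (hf : f = 'X * (\sum_(0 <= j < (n - k) %/ (2 * k))
                    qassociate q Phi ^+ (q ^ (a + k * j)))
          + 'X * (\sum_(0 <= i < totient d %/ 2)
                    Phi`_i *: 'X^(q ^ (k - a - i)))
          + (Phi`_(totient d %/ 2) / 2%:R) *: 'X^2)
  (F : fieldType) (iota : {rmorphism K -> F}) (x y : F)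
  (hF : AS_function_field iota q f x y) :
  AS_minimal iota q f.
Proof.
have pK : p \in [pchar K] by apply: (@card_finPcharP _ _ (m * (2 * n))) => //; rewrite hK hq -expnM.
set M := ((n - k) %/ (2 * k))%N in hf; set r := (totient d %/ 2)%N in hf.
have hr : totient d = (2 * r)%N.
  by rewrite mulnC divnK // -(dvdn_addl (n := 2 * a)) ?dvdn_mulr // ha dvdn_mulr.
have hkar : k = (a + r)%N.
  by apply/eqP; rewrite -(eqn_pmul2l (isT : 0 < 2)%N) -ha hr mulnDr addnC.
have hdvd : (2 * k %| n - k)%N by rewrite -eqn_mod_dvd ?(ltnW hkn) //; exact/eqP.
have nE : n = (k * (2 * M + 1))%N.
  have : (M * (2 * k) = n - k)%N by exact: divnK.
  by move=> e; rewrite -(subnK (ltnW hkn)) -e mulnDr muln1 mulnC -mulnA [(k * (2 * M))%N]mulnCA.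
have hM : (0 < M)%N.
  by rewrite lt0n; apply: contraTneq hkn => M0; rewrite nE M0 muln0 add0n muln1 ltnn.
have fE := AS_curveE M hq hpd hkar pK hPhi.
have q_gt1 : (1 < q)%N by rewrite hq -(exp1n m) ltn_exp2r // prime_gt1.
have q_pchar : [pchar K].-nat q by rewrite (eq_pnat _ (pcharf_eq pK)) hq pnatX pnat_id.
move: (hK); rewrite nE => hK'.
have N_gt0 : (0 < 2 * (k * (2 * M + 1)))%N by rewrite !muln_gt0 hk addn1.
set h := (k * M + r)%N; have h_gt0 : (0 < h)%N by rewrite addn_gt0 muln_gt0 hk hM.
have szf : size f = (q ^ h).+2.
  by rewrite hf -fE; exact: (size_AS_curve hp_odd hm hq hk hk_even hd hdk hpd hr hkar hM hK').
have count := card_AS_curve hp_odd hm hq hk hk_even hd hdk hpd hr hkar hM hK' pK hPhi.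
rewrite fE -hf -/h -nE in count.
(* The degree [q ^ h + 1] of [f] is prime to [q] because [h > 0]. *)
have co : coprime q (q ^ h).+1 by rewrite -(coprime_pexpl _ _ h_gt0) coprimenS.
have genus := genus_AS q_pchar q_gt1 N_gt0 hK' hF (ltn0Sn _) co szf.
exists #|gap_set q (q ^ h).+1|; split=> //.
have g2 := card_gap_set (ltnW q_gt1) (ltn0Sn _) co.
have -> : sqrtC #|K|%:R = (q ^ n)%:R :> algC.
  by rewrite hK mulnC expnM natrX sqrCK // ler0n.
(* Here [2g = (q - 1) * q ^ h], so [2g * q ^ n] is exactly the defect [(q - 1) * q ^ (n + h)] of the
   point count. *)
have count' : (AS_points q f + 2 * #|gap_set q (q ^ h).+1| * q ^ n = #|K| + 1)%N.
  by rewrite g2 subSS subn0 -mulnA -expnD [(h + n)%N]addnC count hK.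
by rewrite -!natrM; apply: (addIr (2 * #|gap_set q (q ^ h).+1| * q ^ n)%:R);
  rewrite subrK -natrD count' natrD.
Qed.
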